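(* Let $\beta>1/2$ and let $\mu$ be the generalized Cauchy distribution of parameter $\beta$, i.e. the probability measure on $\mathbb{R}$ given by $$\mu(dx) = \frac{dx}{Z(1+x^2)^\beta},$$ where $Z$ is the normalization constant. Let $\sigma$ be the positive function given by $\sigma^2(x) = 1+x^2$, $x\in\mathbb{R}$, and let $$\mathcal{L}_\mu^\sigma f(x) = (1+x^2) f''(x) + 2(1-\beta)x f'(x).$$ Then the spectral gap $\lambda_1(-\mathcal{L}_\mu^\sigma)$ of the operator $-\mathcal{L}_\mu^\sigma$ in $L^2(\mu)$ satisfies $$\lambda_1(-\mathcal{L}_\mu^\sigma) = \begin{cases} 2(\beta-1) & \text{if } \beta>3/2,\\[2pt] \left(\beta-\tfrac12\right)^2 & \text{if } 1/2<\beta\le 3/2.\end{cases}$$ In other words, the value above is the best (largest) constant $\lambda>0$ such that the following weighted Poincaré inequality holds: for every $f\in\mathcal{C}_0^\infty(\mathbb{R})$, $$\lambda\,\mathrm{Var}_\mu(f) \le \int_{\mathbb{R}} (1+x^2)\,(f'(x))^2\,\mu(dx).$$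
   Context: $\mathcal{C}_0^\infty(\mathbb{R})$ denotes the smooth compactly supported real-valued functions on $\mathbb{R}$, and $\mathrm{Var}_\mu(f) = \int_{\mathbb{R}} f^2\,d\mu - \left(\int_{\mathbb{R}} f\,d\mu\right)^2$. The operator $\mathcal{L}_\mu^\sigma$ is defined on $\mathcal{C}_0^\infty(\mathbb{R})$, is essentially self-adjoint, and the same notation is used for its self-adjoint extension in $L^2(\mu)$, whose Dirichlet form is $-\int_{\mathbb{R}} f\mathcal{L}_\mu^\sigma f\,d\mu = \int_{\mathbb{R}} \sigma^2 (f')^2\,d\mu$ with domain $H^1_\sigma(\mathbb{R},\mu) = \{ f\in L^2(\mu) : \int_{\mathbb{R}} \sigma^2 (f')^2\,d\mu<\infty\}$ ($f'$ being the weak derivative). The spectral gap $\lambda_1(-\mathcal{L}_\mu^\sigma)$ is the largest real $\lambda$ such that the spectrum of $-\mathcal{L}_\mu^\sigma$ lies in $\{0\}\cup[\lambda,+\infty)$; it is characterized by $$\lambda_1(-\mathcal{L}_\mu^\sigma) = \inf\left\{ \frac{\int_{\mathbb{R}} \sigma^2 (f')^2\,d\mu}{\mathrm{Var}_\mu(f)} : f \in H^1_\sigma(\mathbb{R},\mu),\ f\ne\text{const}\right\}.$$ *)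

(* Defs.v *)
From HB Require Import structures.
From mathcomp Require Import all_boot all_order all_algebra.
From mathcomp Require Import all_classical all_reals all_analysis.
From mathcomp Require Import measurable_realfun.
Set Implicit Arguments.
Unset Strict Implicit.
Unset Printing Implicit Defensive.
Import Order.TTheory GRing.Theory Num.Theory.
Import numFieldNormedType.Exports.
Local Open Scope classical_set_scope.
Local Open Scope ring_scope.

Section generalized_cauchy.
Context {R : realType}.
Implicit Types (b x : R).
Local Notation leb := (@lebesgue_measure R).

Definition gcauchy_fun b x : R := ((1 + x ^+ 2) `^ b)^-1.

Definition gcauchy_norm b : R := \int[leb]_x gcauchy_fun b x.

Definition gcauchy_pdf b x : R := gcauchy_fun b x / gcauchy_norm b.

Definition gcauchy b : set (measurableTypeR R) -> \bar R :=
  fun A => (\int[leb]_(x in A) (gcauchy_pdf b x)%:E)%E.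

Lemma gcauchy_fun_ge0 b x : 0 <= gcauchy_fun b x.
Proof. by rewrite invr_ge0 powR_ge0. Qed.

Lemma gcauchy_norm_ge0 b : 0 <= gcauchy_norm b.
Proof. by apply: Rintegral_ge0 => x _; exact: gcauchy_fun_ge0. Qed.

Lemma gcauchy_pdf_ge0 b x : 0 <= gcauchy_pdf b x.
Proof. by rewrite divr_ge0 ?gcauchy_fun_ge0 ?gcauchy_norm_ge0. Qed.

Lemma continuous_gcauchy_fun b : continuous (gcauchy_fun b).
Proof.
move=> x; have h0 : 0 < 1 + x ^+ 2 by rewrite ltr_pwDl ?sqr_ge0.
apply: cvgV; first by rewrite gt_eqF// powR_gt0.
apply: (@continuous_comp _ _ _ (fun y : R => 1 + y ^+ 2) (fun y => y `^ b)).
  by apply: cvgD; [exact: cvg_cst|exact: exprn_continuous].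
apply: differentiable_continuous; apply/derivable1_diffP.
by apply: derivable_powR; rewrite in_itv/= h0.
Qed.

Lemma measurable_gcauchy_pdf b : measurable_fun setT (gcauchy_pdf b).
Proof.
apply: measurable_funM; last exact: measurable_cst.
apply: continuous_measurable_fun.
exact: continuous_gcauchy_fun.
Qed.

Let gcauchy0 b : gcauchy b set0 = 0%E.
Proof. by rewrite /gcauchy integral_set0. Qed.

Let gcauchy_ge0 b A : (0 <= gcauchy b A)%E.
Proof. by apply: integral_ge0 => x _; rewrite lee_fin gcauchy_pdf_ge0. Qed.

Let gcauchy_sigma_additive b : semi_sigma_additive (gcauchy b).
Proof.
move=> /= F mF tF mUF; rewrite /gcauchy; apply: cvg_toP.
  apply: ereal_nondecreasing_is_cvgn => m n mn.
  apply: lee_sum_nneg_natr => // k _ _.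
  by apply: integral_ge0 => /= x _; rewrite lee_fin gcauchy_pdf_ge0.
rewrite ge0_integral_bigcup//=.
- apply: measurable_funTS; apply: measurableT_comp => //.
  exact: measurable_gcauchy_pdf.
- by move=> x _; rewrite lee_fin gcauchy_pdf_ge0.
Qed.

HB.instance Definition _ b := isMeasure.Build _ _ _ (gcauchy b)
  (gcauchy0 b) (@gcauchy_ge0 b) (@gcauchy_sigma_additive b).

Lemma gcauchy_fun_lty b : 1 / 2 < b ->
  (\int[leb]_x (gcauchy_fun b x)%:E < +oo)%E.
Proof.
move=> b12.
have a0 : 0 < 2 * b - 1 by rewrite subr_gt0 mulrC -ltr_pdivrMr.
rewrite ge0_symfun_integralT; last 3 first.
- exact: gcauchy_fun_ge0.
- exact: continuous_gcauchy_fun.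
- by move=> x /=; rewrite /gcauchy_fun sqrrN.
rewrite -set_itvcy lte_mul_pinfty//.
have mf (A : set (measurableTypeR R)) : measurable A ->
    measurable_fun A (EFin \o gcauchy_fun b).
  move=> mA; apply: measurable_funTS; apply: measurableT_comp => //.
  exact: continuous_measurable_fun (@continuous_gcauchy_fun b).
rewrite (@itv_bndbnd_setU _ _ _ (BRight 1)) ?bnd_simp// ge0_integral_setU//=;
  last 3 first.
- by rewrite -itv_bndbnd_setU ?bnd_simp//; exact: mf.
- by move=> x _; rewrite lee_fin gcauchy_fun_ge0.
- apply/disj_setPLR => x /=; rewrite !in_itv/= andbT => /andP[_ x1].
  by apply/negP; rewrite -leNgt.
apply: lte_add_pinfty.
  apply: (@le_lt_trans _ _ (\int[leb]_(x in `[0%R, 1%R]) (1%:E))%E).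
    apply: ge0_le_integral => //=.
    - by move=> x _; rewrite lee_fin gcauchy_fun_ge0.
    - exact: mf.
    - move=> x _; rewrite lee_fin invf_le1 ?powR_gt0 ?ltr_pwDl ?sqr_ge0//.
      have e1 : 1 `^ b = 1 :> R by rewrite powR1.
      rewrite -[leLHS]e1 ge0_ler_powR ?nnegrE ?addr_ge0 ?sqr_ge0//.
        by apply: ltW; apply: lt_trans b12.
      by rewrite lerDl sqr_ge0.
  by rewrite integral_cst//= lebesgue_measure_itv/= lte01 mul1e oppr0 adde0
    ltry.
apply: (@le_lt_trans _ _ (\int[leb]_(x in `[1%R, +oo[)
    (x `^ (- (2 * b)))%:E)%E).
  apply: (@le_trans _ _ (\int[leb]_(x in `]1%R, +oo[) (x `^ (- (2 * b)))%:E)%E).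
    apply: ge0_le_integral => //=.
    - by move=> x _; rewrite lee_fin gcauchy_fun_ge0.
    - exact: mf.
    - apply: measurable_funTS; apply: measurableT_comp => //.
    - move=> x; rewrite in_itv/= andbT => x1.
      have x0 : 0 < x by rewrite (lt_trans _ x1).
      rewrite lee_fin powRN lef_pV2 ?posrE ?powR_gt0 ?ltr_pwDl ?sqr_ge0//.
      rewrite powRrM (powR_mulrn 2 (ltW x0)).
      rewrite ge0_ler_powR ?nnegrE ?addr_ge0 ?sqr_ge0 ?lerDr//.
      by apply: ltW; apply: lt_trans b12.
  rewrite ge0_subset_integral//=.
  - apply: measurable_funTS; apply: measurableT_comp => //.
  - by move=> x _; rewrite lee_fin powR_ge0.
  - by apply: subset_itvr; rewrite bnd_simp.
pose F x : R := - (2 * b - 1)^-1 * x `^ (1 - 2 * b).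
have dF (x : R) : 0 < x -> is_derive x 1 F (x `^ (- (2 * b))).
  move=> x0; rewrite /F.
  apply: is_derive_eq.
    apply: is_deriveM.
    exact: is_derive1_powR.
  rewrite scaler0 addr0 /GRing.scale/= mulrA -(opprB _ 1) mulrNN.
  rewrite mulVf ?gt_eqF//.
  by rewrite mul1r opprB addrAC subrr add0r.
have cF (x : R) : 0 < x -> {for x, continuous F}.
  move=> x0; apply: differentiable_continuous; apply/derivable1_diffP.
  exact: (@ex_derive _ _ _ _ _ _ _ (dF x x0)).
rewrite (@ge0_continuous_FTC2y _ _ F _ 0).
- by rewrite sub0e ltry.
- by move=> x _; exact: powR_ge0.
- apply: continuous_in_subspaceT => x; rewrite inE/= in_itv/= andbT => x1.
  apply: differentiable_continuous; apply/derivable1_diffP.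
  by apply: derivable_powR; rewrite in_itv/= andbT (lt_le_trans _ x1).
- rewrite /F -(mulr0 (- (2 * b - 1)^-1)); apply: cvgM; first exact: cvg_cst.
  under eq_cvg do rewrite -opprB powRN.
  apply/gtr0_cvgV0.
    by near=> x; rewrite powR_gt0.
  apply/cvgryPge => A; near=> x.
  rewrite (@le_trans _ _ (Num.max A 0))// ?le_max ?lexx//.
  have -> : Num.max A 0 = (Num.max A 0 `^ (2 * b - 1)^-1) `^ (2 * b - 1).
    by rewrite -powRrM mulVf ?gt_eqF// powRr1// le_max lexx orbT.
  rewrite ge0_ler_powR ?nnegrE ?powR_ge0 ?ltW//.
- by move=> x x1; apply: (@ex_derive _ _ _ _ _ _ _ (dF x (lt_trans ltr01 x1))).
- by apply: cvg_at_right_filter; exact: cF.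
- move=> x; rewrite in_itv/= andbT => x1.
  by rewrite derive1E;
    apply: (@derive_val _ _ _ _ _ _ _ (dF x (lt_trans ltr01 x1))).
Unshelve. all: by end_near. Qed.

Lemma gcauchy_norm_gt0 b : 1 / 2 < b -> 0 < gcauchy_norm b.
Proof.
move=> b12; have b0 : 0 <= b by apply: ltW; apply: lt_trans b12.
have mf (A : set (measurableTypeR R)) : measurable A ->
    measurable_fun A (EFin \o gcauchy_fun b).
  move=> mA; apply: measurable_funTS; apply: measurableT_comp => //.
  exact: continuous_measurable_fun (@continuous_gcauchy_fun b).
apply: fine_gt0; rewrite gcauchy_fun_lty// andbT.
apply: (@lt_le_trans _ _ (\int[leb]_(x in `[0%R, 1%R]) ((2 `^ b)^-1%:E))%E).
  rewrite integral_cst//= lebesgue_measure_itv/= lte01 oppr0 adde0 mule1.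
  by rewrite lte_fin invr_gt0 powR_gt0.
apply: (@le_trans _ _ (\int[leb]_(x in `[0%R, 1%R]) (gcauchy_fun b x)%:E)%E).
  apply: ge0_le_integral => //=.
  - exact: mf.
  - move=> x; rewrite in_itv/= => /andP[x0 x1].
    rewrite lee_fin lef_pV2 ?posrE ?powR_gt0 ?ltr_pwDl ?sqr_ge0//.
    rewrite ge0_ler_powR ?nnegrE ?addr_ge0 ?sqr_ge0//.
    by rewrite -[leRHS]/(1 + 1) lerD2l expr_le1.
apply: ge0_subset_integral => //=; first exact: mf.
by move=> x _; rewrite lee_fin gcauchy_fun_ge0.
Qed.

Lemma gcauchy_setT b : 1 / 2 < b -> gcauchy b setT = 1%E.
Proof.
move=> b12; rewrite /gcauchy.
transitivity (\int[leb]_x ((gcauchy_norm b)^-1%:E * (gcauchy_fun b x)%:E))%E.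
  by apply: eq_integral => x _; rewrite -EFinM mulrC.
rewrite (ge0_integralZl leb)//; last 3 first.
- apply: measurableT_comp => //.
  exact: continuous_measurable_fun (@continuous_gcauchy_fun b).
- by move=> x _; rewrite lee_fin gcauchy_fun_ge0.
- by rewrite lee_fin invr_ge0 gcauchy_norm_ge0.
have fI : (\int[leb]_x (gcauchy_fun b x)%:E)%E \is a fin_num.
  rewrite ge0_fin_numE ?gcauchy_fun_lty//.
  by apply: integral_ge0 => x _; rewrite lee_fin gcauchy_fun_ge0.
rewrite -(fineK fI) -EFinM -/(Rintegral _ _ _) -/(gcauchy_norm b).
by rewrite mulVf// gt_eqF// gcauchy_norm_gt0.
Qed.

End generalized_cauchy.

Section weighted_poincare.
Context {R : realType}.
Local Notation T := (measurableTypeR R).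
Variable mu : {measure set T -> \bar R}.

Definition Cc_infty : set (R -> R) :=
  [set f | (forall n x, derivable f^`(n)%classic x 1) /\
           compact (closure [set x | f x != 0])].

Definition Variance (f : R -> R) : R :=
  \int[mu]_x (f x ^+ 2) - (\int[mu]_x f x) ^+ 2.

Definition gcauchy_gen (b : R) (f : R -> R) (x : R) : R :=
  (1 + x ^+ 2) * f^`(2)%classic x + 2 * (1 - b) * x * f^`()%classic x.

Definition L2norm (f : R -> R) : \bar R := ('N[mu]_2[EFin \o f])%E.

(* Operators in L^2(mu) are handled through their graphs, elements of L^2(mu)
   being represented by square-integrable functions.  [closure_graph D A] is
   the graph of the closure of the operator A defined on D; when A is
   essentially self-adjoint on D, it is its unique self-adjoint extension. *)
Definition closure_graph (D : set (R -> R)) (A : (R -> R) -> R -> R) :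
    set ((R -> R) * (R -> R)) :=
  [set fg | [/\ fg.1 \in Lfun mu 2%:E, fg.2 \in Lfun mu 2%:E &
    exists u : nat -> R -> R,
      [/\ forall n, D (u n),
          L2norm (u n \- fg.1) @[n --> \oo] --> 0%E &
          L2norm (A (u n) \- fg.2) @[n --> \oo] --> 0%E]]].

(* t is in the resolvent set when A - t is a bijection from the domain of A
   onto L^2(mu) with bounded inverse; injectivity follows from the bound.  Real
   t are enough: the spectrum of a self-adjoint operator is real, and a real t
   is in the resolvent set of an operator on the real space L^2(mu) iff it is
   in that of its complexification. *)
Definition resolvent_set (A : set ((R -> R) * (R -> R))) : set R :=
  [set t | (forall h, h \in Lfun mu 2%:E ->
              exists f g, A (f, g) /\ {ae mu, forall x, g x - t * f x = h x}) /\
           (exists C : R, forall f g, A (f, g) ->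
              (L2norm f <= C%:E * L2norm (fun x => g x - t * f x)%R)%E)].

Definition spectrum (A : set ((R -> R) * (R -> R))) : set R :=
  ~` resolvent_set A.

Definition is_largest (S : set R) (l : R) : Prop := S l /\ ubound S l.

Definition is_spectral_gap (A : set ((R -> R) * (R -> R))) (l : R) : Prop :=
  is_largest [set l | spectrum A `<=` [set 0] `|` [set t | l <= t]] l.

End weighted_poincare.

(* Main.v *)
(* Write w = (1 + x^2)^(-b) and p = (1 + x^2)^(1-b), so that L f = (p f')' / w.

   No spectrum in (-oo, gap) except 0.  A Hardy inequality with the weight
   rho = x (1 + x^2)^(c/2), c = 0 or b - 3/2, gives the Poincare inequality for
   f - f(0), hence for f.  For t < gap, t <> 0 it yields
   min(gap - t, |t|) |f| <= |(-L - t) f| on test functions, so -L - t has a bounded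
   inverse on its range.  The range is dense: a k orthogonal to it is a classical
   solution of (p k')' = - t w k, and multiplying the equation by (ze_n)^2 k, with
   ze_n = chi (ln (1 + x^2) / n), and applying the Poincare inequality to ze_n k
   forces k = 0.  Completeness of L^2 makes -L - t bijective.

   Sharpness.  x (for b > 3/2), resp. (1 + x^2)^s with s slightly below
   (b - 1/2) / 2, truncated by the same cutoffs, are approximate eigenfunctions at
   the gap. *)
Require Import Defs.
From mathcomp Require Import all_boot all_order all_algebra.
From mathcomp Require Import all_classical all_reals all_analysis.
From mathcomp Require Import measurable_realfun ring lra.
Set Implicit Arguments.
Unset Strict Implicit.
Unset Printing Implicit Defensive.
Import Order.TTheory GRing.Theory Num.Theory.
Import numFieldNormedType.Exports.
Local Open Scope classical_set_scope.
Local Open Scope ring_scope.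

(** * Smooth functions *)

(** Essential self-adjointness is not assumed: for each t < gap other than 0, the closure of -L - t
    is shown by hand to be onto, and the price is the regularity of weak solutions, an orthogonal k
    being at first merely square integrable. The Hardy constant is decided at infinity. There rho
    grows like |x|^(1+c). The choice c = b - 3/2 makes rho^2 w of order 1/|x|, the threshold of
    integrability; the choice c = 0 gives rho = x, the eigenfunction of eigenvalue 2(b - 1), which
    is in L^2 exactly when b > 3/2. Subtracting f(0) instead of the mean decouples the two
    half-lines, each carrying a Dirichlet condition at 0 and a rho of constant sign. Constants are
    killed by L without being test functions. They are the reason for excluding t = 0, and they
    force the mean of k to be shown to vanish separately, because the Poincare inequality controls
    only a variance. Both conclusions rest on the same pair: a lower bound for |(-L - t) f| deduced
    from a Poincare inequality with an arbitrary constant, and approximate eigenfunctions at the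
    gap. *)

Section smooth.
Context {R : realType}.
Implicit Types (f g h : R -> R) (x : R).

(** A relation between f and an explicit derivative, so that the calculus rules compose on formulas;
    [has_derivE] reads off the library derivative at the end. *)
Definition has_deriv f g := forall x, is_derive x (1 : R) f (g x).

Lemma has_deriv_derivable f g : has_deriv f g -> forall x, derivable f x 1.
Proof. by move=> fg x; exact: (@ex_derive _ _ _ _ _ _ _ (fg x)). Qed.

Lemma has_derivE f g : has_deriv f g -> f^`()%classic = g.
Proof.
move=> fg; apply/funext => x; rewrite derive1E.
exact: (@derive_val _ _ _ _ _ _ _ (fg x)).
Qed.

Lemma derivable_has_deriv f :
  (forall x, derivable f x 1) -> has_deriv f f^`()%classic.
Proof. by move=> df x; rewrite derive1E; exact/derivableP. Qed.

Lemma has_deriv_cont f g : has_deriv f g -> continuous f.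
Proof.
move=> fg x; apply: differentiable_continuous; apply/derivable1_diffP.
exact: has_deriv_derivable fg x.
Qed.

Lemma has_deriv_ext f g h : has_deriv f g -> (forall x, g x = h x) -> has_deriv f h.
Proof. by move=> fg gh x; rewrite -gh. Qed.

Lemma has_derivD f g f' g' : has_deriv f f' -> has_deriv g g' ->
  has_deriv (fun x => f x + g x) (fun x => f' x + g' x).
Proof. by move=> df dg x; exact: is_deriveD. Qed.

Lemma has_derivN f f' : has_deriv f f' -> has_deriv (fun x => - f x) (fun x => - f' x).
Proof. by move=> df x; exact: is_deriveN. Qed.

Lemma has_derivB f g f' g' : has_deriv f f' -> has_deriv g g' ->
  has_deriv (fun x => f x - g x) (fun x => f' x - g' x).
Proof. by move=> df dg x; exact: is_deriveB. Qed.

Lemma is_derive1M f g (x f' g' : R) : is_derive x (1 : R) f f' ->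
  is_derive x (1 : R) g g' ->
  is_derive x (1 : R) (fun y => f y * g y) (f' * g x + f x * g').
Proof.
move=> df dg; apply: (is_derive_eq (is_deriveM df dg)).
by rewrite /GRing.scale/=; ring.
Qed.

Lemma has_derivM f g f' g' : has_deriv f f' -> has_deriv g g' ->
  has_deriv (fun x => f x * g x) (fun x => f' x * g x + f x * g' x).
Proof. by move=> df dg x; exact: is_derive1M. Qed.

Lemma has_deriv_cst (c : R) : has_deriv (fun=> c) (fun=> 0).
Proof. by move=> x; exact: is_derive_cst. Qed.

Lemma has_deriv_id : has_deriv (fun x => x) (fun=> 1).
Proof. by move=> x; exact: is_derive_id. Qed.

Lemma has_derivZ (c : R) f f' : has_deriv f f' ->
  has_deriv (fun x => c * f x) (fun x => c * f' x).
Proof.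
move=> df; apply: has_deriv_ext (has_derivM (has_deriv_cst c) df) _ => x.
by rewrite mul0r add0r.
Qed.

Lemma has_deriv_comp f g f' g' : has_deriv f f' -> has_deriv g g' ->
  has_deriv (fun x => f (g x)) (fun x => f' (g x) * g' x).
Proof.
move=> df dg x; apply: (is_derive_eq (is_derive1_comp (df (g x)) (dg x))).
by rewrite /GRing.scale/= mulrC.
Qed.

Lemma is_derive1V g (x g' : R) : g x != 0 -> is_derive x (1 : R) g g' ->
  is_derive x (1 : R) (fun y => (g y)^-1) (- (g' / g x ^+ 2)).
Proof.
move=> g0 dg; apply: (is_derive_eq (is_deriveV g0 dg)).
by rewrite /GRing.scale/= mulNr mulrC.
Qed.

Lemma has_derivV g g' : (forall x, g x != 0) -> has_deriv g g' ->
  has_deriv (fun x => (g x)^-1) (fun x => - (g' x / g x ^+ 2)).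
Proof. by move=> g0 dg x; exact: is_derive1V. Qed.

Lemma has_derivXn n : has_deriv (fun x => x ^+ n) (fun x => n%:R * x ^+ n.-1).
Proof.
elim: n => [|n IH].
  by apply: has_deriv_ext (has_deriv_cst 1) _ => x; rewrite mul0r.
rewrite (_ : (fun x => x ^+ n.+1) = fun x => x * x ^+ n); last first.
  by apply/funext => x; rewrite exprS.
apply: has_deriv_ext (has_derivM has_deriv_id IH) _ => x /=.
case: n {IH} => [|n] /=; first by rewrite !expr0 mul0r mulr0 addr0 mul1r.
by rewrite exprS -(natr1 n.+1); ring.
Qed.

Definition smooth f := forall n x, derivable (f^`(n)%classic) x 1.

(** Recursion on the first derivative rather than on the last: the product, chain and quotient rules
    express f' through functions of one order less, which is what the inductions need. *)
Fixpoint Ck (n : nat) f : Prop :=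
  if n is n'.+1 then (forall x, derivable f x 1) /\ Ck n' f^`()%classic else True.

Lemma smoothP f : smooth f <-> forall n, Ck n f.
Proof.
split.
  move=> sf n; elim: n f sf => //= n IH f sf; split; first exact: (sf 0%N).
  by apply: IH => m x; rewrite -derive1Sn.
move=> H n; elim: n f H => [|n IH] f H x; first by have [] := H 1%N.
by rewrite derive1Sn; apply: IH => m; have [] := H m.+1.
Qed.

Lemma CkS n f g : has_deriv f g -> Ck n g -> Ck n.+1 f.
Proof.
by move=> fg cg; split; [exact: has_deriv_derivable fg|rewrite (has_derivE fg)].
Qed.

Lemma Ck_deriv n f : Ck n.+1 f -> has_deriv f f^`()%classic.
Proof. by move=> [df _]; exact: derivable_has_deriv. Qed.

Lemma Ck_le n f : Ck n.+1 f -> Ck n f.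
Proof. by elim: n f => // n IH f [df cf]; split => //; exact: IH. Qed.

Lemma smooth_has_deriv f : smooth f -> has_deriv f f^`()%classic.
Proof. by move=> sf; apply: derivable_has_deriv => x; exact: (sf 0%N). Qed.

Lemma smooth_derive1 f : smooth f -> smooth f^`()%classic.
Proof. by move=> sf n x; rewrite -derive1Sn. Qed.

Lemma has_deriv_smooth f g : has_deriv f g -> smooth g -> smooth f.
Proof.
move=> fg /smoothP sg; apply/smoothP => -[//|n].
exact: CkS fg (sg n).
Qed.

Lemma smooth_deriv f g : has_deriv f g -> smooth f -> smooth g.
Proof. by move=> fg /smooth_derive1; rewrite (has_derivE fg). Qed.

Lemma smooth_cont f : smooth f -> continuous f.
Proof. by move=> /smooth_has_deriv /has_deriv_cont. Qed.

Lemma Ck_cst n (c : R) : Ck n (fun=> c).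
Proof.
elim: n c => // n IH c; apply: CkS (has_deriv_cst c) _; exact: IH.
Qed.

Lemma smooth_cst (c : R) : smooth (fun=> c).
Proof. by apply/smoothP => n; exact: Ck_cst. Qed.

Lemma smooth_id : smooth (fun x => x).
Proof. apply: (@has_deriv_smooth _ (fun=> 1)); [exact: has_deriv_id|exact: smooth_cst]. Qed.

Lemma CkD n f g : Ck n f -> Ck n g -> Ck n (fun x => f x + g x).
Proof.
elim: n f g => // n IH f g cf cg.
apply: CkS (has_derivD (Ck_deriv cf) (Ck_deriv cg)) _.
by case: cf => _ ?; case: cg => _ ?; exact: IH.
Qed.

Lemma smoothD f g : smooth f -> smooth g -> smooth (fun x => f x + g x).
Proof. by move=> /smoothP ? /smoothP ?; apply/smoothP => n; exact: CkD. Qed.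

Lemma CkM n f g : Ck n f -> Ck n g -> Ck n (fun x => f x * g x).
Proof.
elim: n f g => // n IH f g cf cg.
apply: CkS (has_derivM (Ck_deriv cf) (Ck_deriv cg)) _.
have [[_ cf'] [_ cg']] := (cf, cg).
by apply: CkD; apply: IH => //; exact: Ck_le.
Qed.

Lemma smoothM f g : smooth f -> smooth g -> smooth (fun x => f x * g x).
Proof. by move=> /smoothP ? /smoothP ?; apply/smoothP => n; exact: CkM. Qed.

Lemma smoothZ (c : R) f : smooth f -> smooth (fun x => c * f x).
Proof. by apply: smoothM; exact: smooth_cst. Qed.

Lemma smoothN f : smooth f -> smooth (fun x => - f x).
Proof.
move=> sf; rewrite (_ : (fun x => - f x) = fun x => -1 * f x); first exact: smoothZ.
by apply/funext => x; rewrite mulN1r.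
Qed.

Lemma smoothB f g : smooth f -> smooth g -> smooth (fun x => f x - g x).
Proof. by move=> sf sg; exact: (smoothD sf (smoothN sg)). Qed.

Lemma smoothX f n : smooth f -> smooth (fun x => f x ^+ n).
Proof.
move=> sf; elim: n => [|n IH]; first exact: smooth_cst.
rewrite (_ : (fun x => f x ^+ n.+1) = fun x => f x * f x ^+ n); first exact: smoothM.
by apply/funext => x; rewrite exprS.
Qed.

Lemma Ck_comp n f g : Ck n f -> Ck n g -> Ck n (fun x => f (g x)).
Proof.
elim: n f g => // n IH f g cf cg.
apply: CkS (has_deriv_comp (Ck_deriv cf) (Ck_deriv cg)) _.
apply: CkM; last by case: cg.
by apply: IH; [case: cf|exact: Ck_le].
Qed.

Lemma smooth_comp f g : smooth f -> smooth g -> smooth (fun x => f (g x)).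
Proof. by move=> /smoothP ? /smoothP ?; apply/smoothP => n; exact: Ck_comp. Qed.

(** The derivative -g' / g^2 involves only g' and 1/g, the latter at the preceding order. *)
Lemma smoothV g : (forall x, g x != 0) -> smooth g -> smooth (fun x => (g x)^-1).
Proof.
move=> g0 /smoothP sg; apply/smoothP; elim => // n IH.
apply: CkS (has_derivV g0 (Ck_deriv (sg n.+1))) _.
have /smoothP sg' : smooth (fun x => - g^`()%classic x).
  by apply: smoothN; apply: smooth_derive1; exact/smoothP.
rewrite [X in Ck n X](_ : _ = fun x => - g^`()%classic x * ((g x)^-1 * (g x)^-1)).
  by apply: CkM => //; exact: CkM.
by apply/funext => x; rewrite expr2 invfM mulNr.
Qed.

(* The functions [x^-k exp(-1/x)] (extended by 0) form a family whose
   derivatives are combinations of its members. *)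
Definition flat (k : nat) x : R := if 0 < x then expR (- x^-1) / x ^+ k else 0.

Lemma flat_ge0 k x : 0 <= flat k x.
Proof.
rewrite /flat; case: ifPn => // x0.
by rewrite divr_ge0 ?expR_ge0// exprn_ge0// ltW.
Qed.

Lemma flat_gt0 x : 0 < x -> 0 < flat 0 x.
Proof. by move=> x0; rewrite /flat x0 expr0 divr1 expR_gt0. Qed.

Lemma flatS k x : flat k x = x * flat k.+1 x.
Proof.
rewrite /flat; case: ifPn => [x0|]; last by rewrite mulr0.
by rewrite exprS invfM mulrCA !mulrA mulfK ?gt_eqF// mulrC.
Qed.

(** With y = 1/x, the inequality y^k / k! <= e^y bounds y^k e^(-y) by k!. *)
Lemma flat_bounded k : exists C : R, forall x, flat k x <= C.
Proof.
exists (k`!%:R) => x; rewrite /flat; case: ifPn => // x0.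
have y0 : 0 <= x^-1 by rewrite invr_ge0 ltW.
have h : (x^-1) ^+ k / k`!%:R <= expR (x^-1).
  case: k => [|k].
    by rewrite expr0 fact0 divr1; apply: le_trans (expR_ge1Dx _); rewrite lerDl.
  by apply: le_trans (expR_ge1Dxn k y0); rewrite lerDr.
rewrite expRN -exprVn mulrC ler_pdivrMr ?expR_gt0//.
by rewrite mulrC -ler_pdivrMr ?ltr0n ?fact_gt0.
Qed.

Lemma has_deriv_flat k :
  has_deriv (flat k) (fun x => flat k.+2 x - k%:R * flat k.+1 x).
Proof.
move=> x; have [x0|x0|->] := ltgtP x 0.
- have -> : flat k.+2 x - k%:R * flat k.+1 x = 0.
    by rewrite /flat ltNge (ltW x0)/= mulr0 subr0.
  apply: (@near_eq_is_derive _ _ _ (cst 0)).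
  + near=> y; rewrite /flat ifF//; apply/negbTE; rewrite -leNgt ltW//.
    by near: y; exact: lt_nbhsl.
- have x0' : x != 0 by rewrite gt_eqF.
  apply: (@near_eq_is_derive _ _ _ (fun x => expR (- x^-1) / x ^+ k)).
  + near=> y; rewrite /flat ifT//.
    by near: y; exact: lt_nbhsr.
  + have dV : is_derive x (1 : R) (fun y : R => - y^-1) (x ^- 2).
      apply: (is_derive_eq (is_deriveN (is_derive1V x0' (is_derive_id x 1)))).
      by rewrite opprK mul1r.
    have dE : is_derive x (1 : R) (fun y : R => expR (- y^-1)) (expR (- x^-1) * x ^- 2).
      apply: (is_derive_eq (is_derive1_comp (is_derive_expR _) dV)).
      by rewrite /GRing.scale/= mulrC.
    have dX : is_derive x (1 : R) (fun y : R => y ^+ k) (k%:R * x ^+ k.-1).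
      exact: has_derivXn.
    have xk0 : x ^+ k != 0 by rewrite expf_neq0.
    have dW := @is_derive1V (fun y => y ^+ k) _ _ xk0 dX.
    apply: (is_derive_eq (is_derive1M dE dW)).
    rewrite /flat x0; case: k {dX dW} xk0 => [|k] xk0 /=; first by rewrite !expr0; field.
    by rewrite !exprS; field; rewrite x0'/= expf_neq0.
- have -> : flat k.+2 0 - k%:R * flat k.+1 0 = 0.
    by rewrite /flat ltxx mulr0 subr0.
  have [C hC] := flat_bounded k.+2.
  have C0 : 0 <= C by apply: le_trans (hC 0); exact: flat_ge0.
  (* At 0 the slope of [flat k] is [flat k.+1] by [flatS]; applying [flatS] once more, it is at most
     C |y| in absolute value, hence continuous at 0 with value 0. *)
  apply/is_derive1_caratheodory; exists (flat k.+1); split.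
  + by move=> z; rewrite subr0 (flatS k z) (flatS k 0) mul0r subr0 mulrC.
  + apply/cvgrPdist_le => /= e e0; near=> y.
    rewrite {1}/flat ltxx sub0r normrN flatS normrM.
    rewrite (ger0_norm (flat_ge0 _ _)).
    apply: (@le_trans _ _ (`|y| * (C + 1))).
      by rewrite ler_wpM2l// (le_trans (hC y))// lerDl.
    rewrite -ler_pdivlMr ?ltr_wpDl//.
    rewrite -normrN -sub0r; near: y; apply: (@cvgr_dist_le _ _ _ _ _ id).
      exact: cvg_id.
    by rewrite divr_gt0// ltr_wpDl.
  + by rewrite /flat ltxx.
Unshelve. all: by end_near. Qed.

Lemma smooth_flat k : smooth (flat k).
Proof.
apply/smoothP => n; elim: n k => // n IH k.
apply: CkS (has_deriv_flat k) _.
rewrite [X in Ck n X](_ : _ = fun x => flat k.+2 x + (- k%:R) * flat k.+1 x).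
  by apply: CkD => //; apply: CkM => //; exact: Ck_cst.
by apply/funext => x; rewrite mulNr.
Qed.

(** The usual smooth transition from 0 on x <= 0 to 1 on x >= 1. *)
Definition step x : R := flat 0 x / (flat 0 x + flat 0 (1 - x)).

Let step_den x : 0 < flat 0 x + flat 0 (1 - x).
Proof.
have [x0|x0] := ltP 0 x.
  by rewrite ltr_wpDr ?flat_ge0// flat_gt0.
by rewrite ltr_wpDl ?flat_ge0// flat_gt0// subr_gt0 (le_lt_trans x0).
Qed.

Lemma smooth_step : smooth step.
Proof.
apply: smoothM; first exact: smooth_flat.
apply: smoothV; first by move=> x; rewrite gt_eqF.
apply: smoothD; first exact: smooth_flat.
apply: smooth_comp; first exact: smooth_flat.
by apply: smoothB; [exact: smooth_cst|exact: smooth_id].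
Qed.

Lemma step_ge0 x : 0 <= step x.
Proof. by rewrite divr_ge0 ?flat_ge0// ltW. Qed.

Lemma step_le1 x : step x <= 1.
Proof. by rewrite ler_pdivrMr// mul1r lerDl flat_ge0. Qed.

Lemma step_eq0 x : x <= 0 -> step x = 0.
Proof. by move=> x0; rewrite /step {1}/flat ltNge x0 mul0r. Qed.

Lemma step_eq1 x : 1 <= x -> step x = 1.
Proof.
move=> x1; rewrite /step [X in _ + X]/flat subr_gt0 ltNge x1/= addr0 divff//.
by rewrite gt_eqF// flat_gt0// (lt_le_trans _ x1).
Qed.

End smooth.

(** * Test functions and weak solutions *)

Section bounded_support.
Context {R : realType}.
Implicit Types (f g h : R -> R) (x : R).
Local Notation leb := (@lebesgue_measure R).

(** Compact support on the line expressed without closures, a form that sums, products and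
    derivatives inherit directly. *)
Definition bsupp f := exists N : R, forall x, N <= `|x| -> f x = 0.

Lemma bsuppP f : bsupp f -> exists2 N : R, 0 < N & forall x, N <= `|x| -> f x = 0.
Proof.
move=> [N fN]; exists (Num.max N 1); first by rewrite lt_max ltr01 orbT.
by move=> x; rewrite ge_max => /andP[Nx _]; exact: fN.
Qed.

Lemma Cc_inftyP f : Cc_infty f <-> smooth f /\ bsupp f.
Proof.
split=> -[sf].
  move=> /compact_bounded[M [Mr hM]]; split => //; exists (`|M| + 2) => x xM.
  apply/eqP; apply: contrapT => /negP fx0.
  have := hM (`|M| + 1); rewrite (le_lt_trans (ler_norm M)) ?ltrDl// => /(_ erefl x).
  have cx : closure [set x | f x != 0] x by apply: subset_closure.
  by move=> /(_ cx) /=; lra.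
move=> [N fN]; split => //; apply: (@subclosed_compact _ _ `[- N, N]%classic).
- exact: closed_closure.
- exact: segment_compact.
- rewrite closureE => x /(_ `[- N, N]%classic); apply; split.
    exact: itv_closed.
  move=> y /= /eqP fy0; rewrite in_itv/= -ler_norml leNgt; apply/negP => /ltW Ny.
  exact/fy0/fN.
Qed.

Lemma bsuppMl f g : bsupp f -> bsupp (fun x => f x * g x).
Proof. by move=> [N fN]; exists N => x /fN ->; rewrite mul0r. Qed.

Lemma bsuppMr f g : bsupp g -> bsupp (fun x => f x * g x).
Proof. by move=> [N fN]; exists N => x /fN ->; rewrite mulr0. Qed.

Lemma bsuppD f g : bsupp f -> bsupp g -> bsupp (fun x => f x + g x).
Proof.
move=> [N fN] [M gM]; exists (Num.max N M) => x; rewrite ge_max => /andP[? ?].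
by rewrite fN// gM// addr0.
Qed.

Lemma bsupp_deriv f g : has_deriv f g -> bsupp f -> bsupp g.
Proof.
(* The margin 1 makes f vanish on a whole neighbourhood of x. *)
move=> fg [N fN]; exists (N + 1) => x Nx.
rewrite -(has_derivE fg) derive1E.
rewrite (_ : 0 = 'D_1 (cst 0 : R -> R) x :> R); last by rewrite derive_cst.
apply: near_eq_derive; near=> y; apply: fN.
have : `|x - y| <= 1.
  by near: y; apply: (@cvgr_dist_le _ _ _ _ _ id) => //; exact: cvg_id.
have := ler_distD y x 0; rewrite !subr0; lra.
Unshelve. all: by end_near. Qed.

Lemma Rintegral_supp f (A : set R) : (forall x, ~ A x -> f x = 0) ->
  \int[leb]_x f x = \int[leb]_(x in A) f x.
Proof.
move=> fA; rewrite [RHS]Rintegral_mkcond; apply: eq_Rintegral => x _.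
by rewrite patchE; case: ifPn => // /negP; rewrite inE => /fA.
Qed.

Lemma nitvP (N x : R) : ~ `[- N, N]%classic x -> N <= `|x|.
Proof.
by rewrite /= in_itv/= -ler_norml => /negP; rewrite -ltNge => /ltW.
Qed.

Lemma continuous_measurable f : continuous f -> measurable_fun setT f.
Proof. exact: continuous_measurable_fun. Qed.

Lemma bsupp_integrable f : continuous f -> bsupp f ->
  leb.-integrable setT (EFin \o f).
Proof.
move=> cf [N fN].
have -> : EFin \o f = (EFin \o f) \_ `[- N, N].
  apply/funext => x; rewrite patchE; case: ifPn => //= /negP.
  by rewrite inE => /nitvP /fN ->.
apply/integrable_restrict => //; rewrite setTI.
apply: continuous_compact_integrable; first exact: segment_compact.
exact: continuous_subspaceT.
Qed.

Lemma FTC2_itv F f a b : has_deriv F f -> continuous f -> a <= b ->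
  \int[leb]_(x in `[a, b]) f x = F b - F a.
Proof.
move=> Ff cf; rewrite le_eqVlt => /predU1P[->|ab].
  by rewrite set_itv1 Rintegral_set1 subrr.
rewrite /Rintegral (@continuous_FTC2 _ f F)//.
- exact: continuous_subspaceT.
- split; first by move=> x _; exact: has_deriv_derivable Ff x.
  + by apply: cvg_at_right_filter; exact: has_deriv_cont Ff _.
  + by apply: cvg_at_left_filter; exact: has_deriv_cont Ff _.
- by move=> x _; rewrite (has_derivE Ff).
Qed.

Lemma Rintegral_deriv_bsupp F f : has_deriv F f -> continuous f -> bsupp F ->
  \int[leb]_x f x = 0.
Proof.
move=> Ff cf sF; have [M fM] := bsupp_deriv Ff sF; have [N N0 FN] := bsuppP sF.
set K := Num.max N M; have K0 : 0 < K by rewrite lt_max N0.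
rewrite (@Rintegral_supp _ `[- K, K]); last first.
  by move=> x /nitvP; rewrite ge_max => /andP[_ /fM].
have NK : N <= K by rewrite le_max lexx.
rewrite (FTC2_itv Ff cf) ?FN ?subrr ?normrN ?gtr0_norm//.
by rewrite (le_trans _ (ltW K0))// oppr_le0 ltW.
Qed.

Lemma Rintegral_ibp F f G g : has_deriv F f -> continuous f ->
  has_deriv G g -> continuous g -> bsupp G ->
  \int[leb]_x (F x * g x) = - \int[leb]_x (f x * G x).
Proof.
move=> Ff cf Gg cg sG.
have cF := has_deriv_cont Ff; have cG := has_deriv_cont Gg.
have c1 : continuous (fun x => f x * G x) by move=> x; exact: cvgM (cf x) (cG x).
have c2 : continuous (fun x => F x * g x) by move=> x; exact: cvgM (cF x) (cg x).
apply/eqP; rewrite -addr_eq0 addrC -RintegralD//; last 2 first.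
- by apply: bsupp_integrable => //; exact: bsuppMr.
- by apply: bsupp_integrable => //; apply: bsuppMr; exact: bsupp_deriv sG.
apply/eqP; apply: (@Rintegral_deriv_bsupp _ _ (has_derivM Ff Gg)).
  by move=> x; exact: cvgD (c1 x) (c2 x).
exact: bsuppMr.
Qed.

Lemma has_deriv_Ny f : continuous f -> leb.-integrable setT (EFin \o f) ->
  has_deriv (fun x => \int[leb]_(y in `]-oo, x]) f y) f.
Proof.
move=> cf fi x.
have iu (u : R) : leb.-integrable `]-oo, u] (EFin \o f).
  by apply: integrableS fi.
have [] := @continuous_FTC1 R f -oo%O x (x + 1) _ (iu _) _ (cf x).
- by rewrite ltrDl.
- by rewrite ltNyr.
by move=> df; rewrite derive1E => <-; exact/derivableP.
Qed.

(** A primitive on the whole line needs a base point to the left of every x. It is taken at -(|x| +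
    1) and the value at 0 is subtracted; by [PB] the result does not depend on the base point, which
    can therefore be frozen at -(|x| + 3) near x. *)
Lemma antiderivative f : continuous f -> exists F, has_deriv F f.
Proof.
move=> cf; pose P (M x : R) := \int[leb]_(y in `[M, x]) f y.
have ii (a b : R) : leb.-integrable `[a, b] (EFin \o f).
  apply: continuous_compact_integrable; first exact: segment_compact.
  exact: continuous_subspaceT.
have PB (M N x : R) : M <= N -> N <= x -> N <= 0 -> P M x - P M 0 = P N x - P N 0.
  move=> MN Nx N0.
  have split (z : R) : N <= z -> P M z = P M N + \int[leb]_(y in `]N, z]) f y.
    move=> Nz; rewrite -(@Rintegral_itvB _ _ (BLeft M) (BRight z) N)//.
      by rewrite subrKC.
  have splitN (z : R) : P N z = \int[leb]_(y in `]N, z]) f y.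
    by rewrite Rintegral_itv_obnd_cbnd//; apply: integrableS (ii N z) => //;
      exact: subset_itv_oc_cc.
  by rewrite (split x) ?(split 0)// !splitN opprD addrACA subrr add0r.
exists (fun x => P (- (`|x| + 1)) x - P (- (`|x| + 1)) 0) => x.
apply: (@near_eq_is_derive _ _ _ (fun y => P (- (`|x| + 3)) y - P (- (`|x| + 3)) 0)).
  near=> y.
  have : `|x - y| <= 1.
    by near: y; apply: (@cvgr_dist_le _ _ _ _ _ id) => //; exact: cvg_id.
  have := ler_distD x y 0; rewrite !subr0 distrC => h1 h2.
  apply: PB; have := ler_norm (- y); rewrite normrN; have := normr_ge0 y; lra.
rewrite -[f x]subr0; apply: is_deriveB.
have [] := @continuous_FTC1_closed R f (- (`|x| + 3)) x (x + 1) _ (ii _ _) _ (cf x).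
- by rewrite ltrDl.
- have := ler_norm (- x); rewrite normrN; lra.
by move=> df; rewrite derive1E => <-; exact/derivableP.
Unshelve. all: by end_near. Qed.

End bounded_support.

Lemma Rdominated_cvg d (T : measurableType d) (R : realType)
    (mu : {measure set T -> \bar R}) (D : set T) (f_ : nat -> T -> R) (f g : T -> R) :
  measurable D -> (forall n, measurable_fun D (f_ n)) ->
  (forall x, D x -> f_ n x @[n --> \oo] --> f x) ->
  mu.-integrable D (EFin \o g) -> (forall n x, D x -> `|f_ n x| <= g x) ->
  \int[mu]_(x in D) f_ n x @[n --> \oo] --> \int[mu]_(x in D) f x.
Proof.
move=> mD mf_ cf ig fg.
have mf : measurable_fun D f.
  exact: (@measurable_fun_cvg _ _ _ _ f_).
have [|||//||i1 _ i2] := @dominated_convergence _ _ _ mu D mD (fun n => EFin \o f_ n)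
  (EFin \o f) (EFin \o g).
- by move=> n; exact/measurable_EFinP.
- exact/measurable_EFinP.
- by apply: aeW => x Dx; apply: cvg_EFin; [exact: nearW|exact: cf].
- by apply: aeW => x n Dx; rewrite lee_fin; exact: fg.
apply: fine_cvg.
by rewrite fineK//; exact: integrable_fin_num i1.
Qed.

(** * The lemmas of the calculus of variations on the line *)

Section du_bois_reymond.
Context {R : realType}.
Implicit Types (f g h u v eta : R -> R) (x : R).
Local Notation leb := (@lebesgue_measure R).

Definition locint u := forall N : R, leb.-integrable `[- N, N] (EFin \o u).

Definition testfun eta := smooth eta /\ bsupp eta.

Lemma locint_itv u a b : locint u -> leb.-integrable `[a, b] (EFin \o u).
Proof.
move=> /(_ (Num.max `|a| `|b|)); apply: integrableS => // x /=; rewrite !in_itv/=.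
move=> /andP[ax xb]; rewrite -ler_norml le_max.
have := ler_norm b; have := ler_norm (- a); rewrite normrN => ha hb.
by rewrite !ler_norml; apply/orP; have [|] := leP 0 x; lra.
Qed.

Lemma locint_measurable u : locint u -> measurable_fun setT u.
Proof.
move=> lu; rewrite (_ : setT = \bigcup_n `[- n%:R, n%:R]%classic :> set R).
  apply/measurable_fun_bigcup => // n.
  by apply/measurable_EFinP; have /integrableP[] := lu n%:R.
apply/seteqP; split => // x _; exists (Num.truncn `|x|).+1 => //=.
by rewrite in_itv/= -ler_norml ltW// truncnS_gt.
Qed.

Lemma locint_continuous u : continuous u -> locint u.
Proof.
move=> cu N; apply: continuous_compact_integrable; first exact: segment_compact.
exact: continuous_subspaceT.
Qed.

Lemma locintD u v : locint u -> locint v -> locint (fun x => u x + v x).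
Proof.
move=> lu lv N.
exact: (@integrableD _ _ _ leb _ (measurable_itv _) _ _ (lu N) (lv N)).
Qed.

Lemma locint_mul u v : locint u -> continuous v -> locint (fun x => u x * v x).
Proof.
move=> lu cv N.
apply: (@integrableMl _ _ _ leb _ _ (EFin \o u) v) => //.
  by apply: measurable_funTS; exact: continuous_measurable.
have [M [Mr hM]] := compact_bounded (continuous_compact (continuous_subspaceT cv)
  (@segment_compact R (- N) N)).
by exists M; split => // z Mz x Nx; apply: (hM z Mz); exists x.
Qed.

Lemma locint_bsupp u : locint u -> bsupp u -> leb.-integrable setT (EFin \o u).
Proof.
move=> lu [N uN].
have -> : EFin \o u = (EFin \o u) \_ `[- N, N].
  apply/funext => x; rewrite patchE; case: ifPn => //= /negP.
  by rewrite inE => /nitvP /uN ->.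
by apply/integrable_restrict => //; rewrite setTI.
Qed.

Lemma locint_locally u : locint u -> locally_integrable setT u.
Proof.
move=> lu; split; [exact: locint_measurable|exact: openT|].
move=> K _ cK; have [M [Mr hM]] := compact_bounded cK.
have /integrableP[_] : leb.-integrable K (EFin \o u).
  apply: integrableS (lu (`|M| + 1)) => //; first exact: compact_measurable.
  move=> x Kx /=; rewrite in_itv/= -ler_norml; apply: hM Kx.
  by rewrite (le_lt_trans (ler_norm M))// ltrDl.
by [].
Qed.

(** Test functions with values in [0, 1] tending pointwise to the indicator of ]a, b[. *)
Definition plateau (a b : R) (n : nat) x := step (n%:R * (x - a)) * step (n%:R * (b - x)).

Lemma testfun_plateau a b n : testfun (plateau a b n).
Proof.
have [->|n0] := eqVneq n 0%N.
  rewrite (_ : plateau a b 0 = fun=> 0); last first.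
    by apply/funext => x; rewrite /plateau !mul0r step_eq0// mul0r.
  by split; [exact: smooth_cst|exists 0].
split.
  apply: smoothM.
    apply: (@smooth_comp _ step (fun x => n%:R * (x - a))); first exact: smooth_step.
    by apply: smoothZ; apply: smoothB; [exact: smooth_id|exact: smooth_cst].
  apply: (@smooth_comp _ step (fun x => n%:R * (b - x))); first exact: smooth_step.
  by apply: smoothZ; apply: smoothB; [exact: smooth_cst|exact: smooth_id].
exists (`|a| + `|b|) => x abx; rewrite /plateau.
have [xa|ax] := leP x a.
  by rewrite step_eq0 ?mul0r// mulr_ge0_le0// subr_le0.
have [xb|bx] := leP b x.
  by rewrite [X in _ * X]step_eq0 ?mulr0// mulr_ge0_le0// subr_le0.
exfalso; have := ler_norm b; have := ler_norm (- a); rewrite normrN.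
have := normr_ge0 a; have := normr_ge0 b.
by have [x0|x0] := leP 0 x; move: abx;
  [rewrite [`|x|]ger0_norm//|rewrite [`|x|]ltr0_norm//]; lra.
Qed.

Lemma plateau_out a b n x : ~ `]a, b[%classic x -> plateau a b n x = 0.
Proof.
rewrite /= in_itv/= => /negP; rewrite negb_and -!leNgt /plateau => /orP[xa|bx].
  by rewrite step_eq0 ?mul0r// mulr_ge0_le0// subr_le0.
by rewrite [X in _ * X]step_eq0 ?mulr0// mulr_ge0_le0// subr_le0.
Qed.

Lemma plateau_cvg a b x : `]a, b[%classic x -> plateau a b n x @[n --> \oo] --> (1 : R).
Proof.
rewrite /= in_itv/= => /andP[ax xb]; apply: cvg_near_cst; near=> n.
rewrite /plateau !step_eq1 ?mulr1//.
  rewrite -ler_pdivrMr ?subr_gt0//; near: n; exact: nbhs_infty_ger.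
rewrite -ler_pdivrMr ?subr_gt0//; near: n; exact: nbhs_infty_ger.
Unshelve. all: by end_near. Qed.

Lemma plateau_le1 a b n x : `|plateau a b n x| <= 1.
Proof. by rewrite normrM !ger0_norm ?step_ge0// mulr_ile1 ?step_ge0 ?step_le1. Qed.

(** Dominated convergence along [plateau] makes the integral of u vanish on every open interval. At
    a Lebesgue point x, u x is the derivative of the integral of u from x - 1, which is constantly
    0. *)
Lemma fundamental_lemma u : locint u ->
  (forall eta, testfun eta -> \int[leb]_x (u x * eta x) = 0) ->
  {ae leb, forall x, u x = 0}.
Proof.
move=> lu hu.
have oo0 (a b : R) : \int[leb]_(x in `]a, b[) u x = 0.
  have io : leb.-integrable `]a, b[ (EFin \o u).
    by apply: integrableS (locint_itv a b lu) => //; exact: subset_itv_oo_cc.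
  have mu := locint_measurable lu.
  have h : \int[leb]_(x in `]a, b[) (u x * plateau a b n x) @[n --> \oo] -->
      \int[leb]_(x in `]a, b[) u x.
    apply: (@Rdominated_cvg _ _ _ leb _ (fun n x => u x * plateau a b n x) _
      (fun x => `|u x|)) => //.
    - move=> n; apply: measurable_funM; first exact: measurable_funTS.
      apply: measurable_funTS; apply: continuous_measurable.
      by have [/smooth_cont] := testfun_plateau a b n.
    - move=> x abx; rewrite -[X in _ --> X]mulr1; apply: cvgM; first exact: cvg_cst.
      exact: plateau_cvg.
    - exact: integrable_norm io.
    - by move=> n x _; rewrite normrM ler_piMr// plateau_le1.
  apply/esym/(cvg_unique _ _ h); first exact: Rhausdorff.
  apply: cvg_near_cst; apply: nearW => n.
  rewrite -(@Rintegral_supp _ _ `]a, b[%classic); last first.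
    by move=> x /plateau_out ->; rewrite mulr0.
  exact/hu/testfun_plateau.
have /= := lebesgue_differentiation (locint_locally lu).
apply: filterS; first exact: (ae_filter_ringOfSetsType leb).
move=> x xL.
have ic : leb.-integrable [set` Interval (BRight (x - 1)) (BRight (x + 1))] (EFin \o u).
  by apply: integrableS (locint_itv (x - 1) (x + 1) lu) => //; exact: subset_itv_oc_cc.
have [||_] := @FTC1_lebesgue_pt R u (BRight (x - 1)) x (x + 1) _ ic _ xL.
- by rewrite ltrDl.
- by rewrite (@lte_fin R) gtrBl.
move=> <-; rewrite (_ : (fun y => _) = cst 0) ?derive1_cst//; apply/funext => y /=.
rewrite -Rintegral_itv_bndo_bndc ?oo0//.
apply: integrableS (locint_itv (x - 1) y lu) => //; exact: subset_itv_oo_cc.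
Qed.

Lemma continuous_testfun eta : testfun eta -> continuous eta.
Proof. by move=> [/smooth_cont]. Qed.

Lemma testfunD eta f : testfun eta -> testfun f -> testfun (fun x => eta x + f x).
Proof. by move=> [? ?] [? ?]; split; [exact: smoothD|exact: bsuppD]. Qed.

Lemma testfunZ (c : R) eta : testfun eta -> testfun (fun x => c * eta x).
Proof. by move=> [? ?]; split; [exact: smoothZ|exact: bsuppMr]. Qed.

Lemma testfunM f eta : smooth f -> testfun eta -> testfun (fun x => f x * eta x).
Proof. by move=> ? [? ?]; split; [exact: smoothM|exact: bsuppMr]. Qed.

Lemma testfun_deriv eta f : has_deriv eta f -> testfun eta -> testfun f.
Proof. by move=> df [? ?]; split; [exact: smooth_deriv df _|exact: bsupp_deriv df _]. Qed.

Lemma testfun_integrable eta : testfun eta -> leb.-integrable setT (EFin \o eta).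
Proof. by move=> [/smooth_cont ? ?]; exact: bsupp_integrable. Qed.

(** The integral from -oo always vanishes far to the left; the zero mean makes it vanish far to the
    right too. *)
Lemma testfun_primitive eta : testfun eta -> \int[leb]_x eta x = 0 ->
  exists2 psi, testfun psi & has_deriv psi eta.
Proof.
move=> te i0; have ce := continuous_testfun te.
have ie := testfun_integrable te.
have dp := has_deriv_Ny ce ie.
exists (fun x => \int[leb]_(y in `]-oo, x]) eta y) => //.
split; first by apply: has_deriv_smooth dp _; case: te.
have [N N0 eN] := bsuppP te.2; exists N => x; rewrite ler_normr => /orP[Nx|xN].
  rewrite -(@Rintegral_supp _ eta `]-oo, x]%classic)// => y /=.
  rewrite in_itv/= => /negP; rewrite -ltNge => xy; apply: eN.
  by rewrite ler_normr (le_trans Nx (ltW xy)).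
rewrite (@eq_Rintegral _ _ _ leb _ (cst 0)) ?Rintegral_cst ?mul0r//.
move=> y; rewrite inE/= in_itv/= => yx; apply: eN; rewrite ler_normr.
by apply/orP; right; lra.
Qed.

(** By contradiction: if all these integrals vanished, [fundamental_lemma] would give r = 0 almost
    everywhere, whereas r > 0 on [0, 1], a set of positive measure. A nonzero integral is then
    normalized. *)
Lemma exists_testfun (r : R -> R) : continuous r -> (forall x, 0 < r x) ->
  exists2 eta, testfun eta & \int[leb]_x (eta x * r x) = 1.
Proof.
move=> cr r0; have : exists2 eta, testfun eta & \int[leb]_x (r x * eta x) != 0.
  apply: contrapT => H.
  have : {ae leb, forall x, r x = 0}.
    apply: (fundamental_lemma (locint_continuous cr)) => eta te.
    by apply/eqP; apply: contrapT => /negP i0; apply: H; exists eta.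
  move=> [A [mA A0 hA]].
  have : (leb `[0%R, 1%R]%classic <= leb A)%E.
    apply: le_measure; rewrite ?inE// => x _; apply: hA => /=.
    by apply/eqP; rewrite gt_eqF.
  by rewrite A0 lebesgue_measure_itv/= lte01 oppr0 adde0 lee_fin ler10.
move=> [eta te i0]; exists (fun x => (\int[leb]_y (r y * eta y))^-1 * eta x).
  exact: testfunZ.
rewrite (@eq_Rintegral _ _ _ leb setT
  (fun x => (\int[leb]_y (r y * eta y))^-1 * (r x * eta x))); last first.
  by move=> x _; rewrite -mulrA (mulrC (eta x)).
rewrite RintegralZl ?mulVf//; apply: bsupp_integrable; last by apply: bsuppMr; case: te.
by move=> x; apply: cvgM; [exact: cr|exact: continuous_testfun te _].
Qed.

(** For e1 of integral 1, the function eta - (int eta) e1 has zero mean, hence is the derivative of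
    a test function. So u - c, with c = int u e1, is orthogonal to every eta. *)
Lemma du_bois_reymond u : locint u ->
  (forall psi eta, testfun psi -> has_deriv psi eta -> \int[leb]_x (u x * eta x) = 0) ->
  exists c : R, {ae leb, forall x, u x = c}.
Proof.
move=> lu hu.
have [e1 te1 ie1] := @exists_testfun (fun=> 1) (fun x => @cvg_cst _ _ _ _ _) (fun=> ltr01).
rewrite (@eq_Rintegral _ _ _ leb setT e1) in ie1; last by move=> x _; rewrite mulr1.
pose c := \int[leb]_x (u x * e1 x); exists c.
have lv : locint (fun x => u x + - c).
  by apply: locintD => //; apply: locint_continuous => x; exact: cvg_cst.
have := fundamental_lemma lv.
have iu eta : testfun eta -> leb.-integrable setT (EFin \o (fun x => u x * eta x)).
  move=> te; apply: locint_bsupp; last by apply: bsuppMr; case: te.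
  exact: locint_mul lu (continuous_testfun te).
have h eta : testfun eta -> \int[leb]_x ((u x + - c) * eta x) = 0.
  move=> te; have ie := testfun_integrable te.
  pose m := \int[leb]_x eta x.
  have te' : testfun (fun x => eta x + (- m) * e1 x) by apply: testfunD => //; exact: testfunZ.
  have [|psi tp dp] := testfun_primitive te'.
    rewrite RintegralD//; last by apply: testfun_integrable; exact: testfunZ.
    rewrite RintegralZl//; last exact: testfun_integrable.
    by rewrite ie1 mulr1 subrr.
  have := hu _ _ tp dp.
  rewrite (@eq_Rintegral _ _ _ leb setT (fun x => u x * eta x + (- m) * (u x * e1 x))); last first.
    by move=> x _; ring.
  rewrite RintegralD ?RintegralZl//; [|exact: iu..|]; last first.
    by have := integrableZl measurableT (- m) (iu _ te1).
  move=> h; rewrite (@eq_Rintegral _ _ _ leb setT (fun x => u x * eta x + (- c) * eta x)); last first.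
    by move=> x _; ring.
  rewrite RintegralD ?RintegralZl//; [|exact: iu|]; last first.
    by have := integrableZl measurableT (- c) ie.
  by rewrite -h -/c -/m; ring.
move=> /(_ h); apply: filterS; first exact: (ae_filter_ringOfSetsType leb).
by move=> x /eqP; rewrite addr_eq0 opprK => /eqP.
Qed.
End du_bois_reymond.

(** * Regularity of weak solutions of (p k')' = - t w k *)

Section weak_solution.
Context {R : realType}.
Implicit Types (f g k p w phi psi : R -> R) (x : R).
Local Notation leb := (@lebesgue_measure R).

Lemma continuous_cumulative f : leb.-integrable setT (EFin \o f) ->
  continuous (fun x => \int[leb]_(y in `]-oo, x]) f y).
Proof.
move=> fi x.
have ii (a b : R) : leb.-integrable `[a, b] (EFin \o f) by apply: integrableS fi.
have iN (b : R) : leb.-integrable `]-oo, b] (EFin \o f) by apply: integrableS fi.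
have hc := @parameterized_integral_continuous R (x - 1) (x + 1) f _ (ii _ _).
have x0 : x - 1 <= x + 1 by lra.
have {hc x0} := hc x0 => hc.
(* Splitting at x - 1 reduces the claim to a segment, where continuity of the parameterized integral
   applies. *)
pose G y := \int[leb]_(t in `]-oo, x - 1]) f t + parameterized_integral leb (x - 1) y f.
have GF : \forall y \near x, G y = \int[leb]_(t in `]-oo, y]) f t.
  near=> y; have y1 : x - 1 <= y by apply: ltW; near: y; apply: lt_nbhsr; rewrite ltrBlDr ltrDl.
  rewrite /G /parameterized_integral -(@Rintegral_itv_obnd_cbnd _ (x - 1) (BRight y)); last first.
    by apply: integrableS (ii (x - 1) y) => //; exact: subset_itv_oc_cc.
  rewrite -(@Rintegral_itvB _ _ -oo%O (BRight y) (x - 1))//.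
  by rewrite subrKC.
have cG : G y @[y --> x] --> G x.
  apply: cvgD; first exact: cvg_cst.
  have xI : x \in `]x - 1, x + 1[ by rewrite in_itv/= ltrBlDr ltrDl ltr01/=.
  by apply: (@within_continuous_continuous _ _ _ (x - 1) (x + 1)) xI => //; lra.
rewrite /continuous_at -(nbhs_singleton GF).
by apply: cvg_trans cG; exact: near_eq_cvg.
Unshelve. all: by end_near. Qed.

(** The primitive of a merely integrable k has no pointwise derivative to rely on, so the parts are
    exchanged by Fubini for k(x) phi'(y) on x <= y: integrating in y first gives -k(x) phi(x),
    integrating in x first gives the primitive of k times phi'. *)
Lemma fubini_by_parts k phi phi1 : leb.-integrable setT (EFin \o k) ->
  testfun phi -> has_deriv phi phi1 ->
  \int[leb]_x (k x * phi x) =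
  - \int[leb]_y ((\int[leb]_(x in `]-oo, y]) k x) * phi1 y).
Proof.
move=> ki tp dp; have tp1 := testfun_deriv dp tp.
have ip1 := testfun_integrable tp1.
have cp1 := continuous_testfun tp1.
have mp1 := continuous_measurable cp1.
have mk : measurable_fun setT k by have /integrableP[/measurable_EFinP] := ki.
pose F (z : measurableTypeR R * measurableTypeR R) : \bar R :=
  (k z.1 * phi1 z.2 * (if z.1 <= z.2 then 1 else 0))%:E.
have mF : measurable_fun setT F.
  apply/measurable_EFinP; apply: measurable_funM.
    by apply: measurable_funM; exact: measurableT_comp.
  apply: measurable_fun_ifT => //.
  by apply: measurable_fun_ler.
have iF : (leb \x leb)%E.-integrable setT F.
  apply/(integrable12ltyP _ _ mF).
  apply: (@le_lt_trans _ _ (\int[leb]_x (`|k x|%:E * \int[leb]_y `|phi1 y|%:E))%E).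
    apply: ge0_le_integral => //=.
    - by move=> x _; exact: integral_ge0.
    - apply: (measurable_fun_fubini_tonelli_F (abse \o F)) => //=.
      exact: measurableT_comp.
    - apply: emeasurable_funM => //; apply: measurableT_comp => //.
      exact: measurableT_comp.
    - move=> x _; rewrite -ge0_integralZl//.
      + apply: ge0_le_integral => //=.
        * apply: measurableT_comp => //.
          apply: measurableT_comp => //; apply: measurable_funM.
            by apply: measurable_funM => //; exact: measurable_cst.
          by apply: measurable_fun_ifT => //; exact: measurable_fun_ler.
        * apply: emeasurable_funM => //; apply: measurableT_comp => //.
          exact: measurableT_comp.
        * move=> y _; rewrite -EFinM lee_fin normrM normrM; case: ifP => _.
            by rewrite normr1 mulr1.
          by rewrite normr0 mulr0 mulr_ge0.
      + by do 2 apply: measurableT_comp => //.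
  rewrite ge0_integralZr//.
  + have /integrableP[_ h1] := ki; have /integrableP[_ h2] := ip1.
    apply: lte_mul_pinfty => //; first exact: integral_ge0.
    by rewrite ge0_fin_numE//; exact: integral_ge0.
  + by do 2 apply: measurableT_comp => //.
  + exact: integral_ge0.
have := integral12_prod_meas1 iF; rewrite -(integral21_prod_meas1 iF).
have FE x : \int[leb]_(y in `[x, +oo[) phi1 y = - phi x.
  have [N N0 fN] := bsuppP tp.2; have [M M0 fM] := bsuppP tp1.2.
  pose K := Num.max (Num.max N M) `|x|.
  have NK : N <= K by rewrite !le_max lexx.
  have MK : M <= K by rewrite !le_max lexx orbT.
  have xK : x <= K by rewrite !le_max ler_norm !orbT.
  transitivity (\int[leb]_(y in `[x, K]) phi1 y).
    rewrite Rintegral_mkcond [RHS]Rintegral_mkcond; apply: eq_Rintegral => y _.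
    rewrite !patchE !mem_setE !in_itv/= andbT; case: (leP x y) => //= xy.
    case: (leP y K) => // Ky; apply: fM.
    by rewrite (le_trans MK)// (le_trans (ltW Ky))// ler_norm.
  rewrite (FTC2_itv dp cp1)// fN ?sub0r// (le_trans NK)// ler_norm//.
have -> : fubini_F leb F = EFin \o (fun x => - (k x * phi x)).
  apply/funext => x; rewrite /fubini_F /F /=.
  have ii : leb.-integrable `[x, +oo[ (EFin \o phi1) by apply: integrableS ip1.
  transitivity (\int[leb]_y ((k x)%:E * ((EFin \o phi1) \_ `[x, +oo[) y))%E.
    apply: eq_integral => y _; rewrite patchE mem_setE in_itv/= andbT.
    by case: (x <= y); rewrite ?mulr1 ?mulr0 ?mule0// EFinM.
  rewrite integralZl//; last by apply/integrable_restrict => //; rewrite setTI.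
  rewrite -integral_mkcond -[X in (_ * X)%E]fineK; last exact: integrable_fin_num ii.
  by rewrite -[fine _]/(Rintegral _ _ _) FE -EFinM mulrN.
have -> : fubini_G leb F = EFin \o (fun y => (\int[leb]_(x in `]-oo, y]) k x) * phi1 y).
  apply/funext => y; rewrite /fubini_G /F /=.
  have ii : leb.-integrable `]-oo, y] (EFin \o k) by apply: integrableS ki.
  transitivity (\int[leb]_x ((phi1 y)%:E * ((EFin \o k) \_ `]-oo, y]) x))%E.
    apply: eq_integral => x _; rewrite patchE mem_setE in_itv/=.
    by case: (x <= y); rewrite ?mulr1 ?mulr0 ?mule0// mulrC EFinM.
  rewrite integralZl//; last by apply/integrable_restrict => //; rewrite setTI.
  rewrite -integral_mkcond -[X in (_ * X)%E]fineK; last exact: integrable_fin_num ii.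
  by rewrite -[fine _]/(Rintegral _ _ _) -EFinM mulrC.
move=> h; apply/eqP; rewrite -eqr_oppLR; apply/eqP.
rewrite [RHS]/Rintegral -h; rewrite -mulN1r -RintegralZl//.
  by rewrite /Rintegral; congr fine; apply: eq_integral => x _; rewrite mulN1r.
have lk : locint k by move=> N; apply: integrableS ki.
apply: locint_bsupp; last by apply: bsuppMr; case: tp.
by apply: locint_mul => //; exact: continuous_testfun tp.
Qed.

(* With phi' = psi / p, for psi any test function orthogonal to 1/p, and k w
   integrated by parts, the hypothesis takes the du Bois-Reymond form in psi. *)
Lemma weak_regularity p w k (t : R) : smooth p -> (forall x, 0 < p x) ->
  smooth w -> (forall x, 0 < w x) ->
  leb.-integrable setT (EFin \o (fun x => k x * w x)) ->
  (forall phi phi1 psi1, testfun phi -> has_deriv phi phi1 ->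
    has_deriv (fun x => p x * phi1 x) psi1 ->
    \int[leb]_x (k x * psi1 x + t * (k x * w x) * phi x) = 0) ->
  exists K K1, [/\ has_deriv K K1,
    has_deriv (fun x => p x * K1 x) (fun x => - t * (K x * w x)) &
    {ae leb, forall x, k x = K x}].
Proof.
move=> sp p0 sw w0 ki hk.
have pn0 x : p x != 0 by rewrite gt_eqF.
have wn0 x : w x != 0 by rewrite gt_eqF.
have lkw : locint (fun x => k x * w x) by move=> N; apply: integrableS ki.
have lk : locint k.
  have cw : continuous (fun x => (w x)^-1) by apply: smooth_cont; exact: smoothV.
  have := locint_mul lkw cw; rewrite (_ : (fun x => _) = k)//.
  by apply/funext => x; rewrite mulfK.
have sV : smooth (fun x => (p x)^-1) by exact: smoothV.
have cV := smooth_cont sV.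
pose H x := \int[leb]_(y in `]-oo, x]) (k y * w y).
have cH : continuous H by exact: continuous_cumulative.
have Vp0 x : 0 < (p x)^-1 by rewrite invr_gt0.
(* Normalized against 1/p: with m the integral of psi/p, psi - m ps1 is orthogonal to 1/p, so that
   (psi - m ps1)/p is the derivative of a test function phi. *)
have [ps1 tps1 ips1] := exists_testfun cV Vp0.
have [et1 dps1] : exists et1, has_deriv ps1 et1.
  by exists ps1^`()%classic; apply: smooth_has_deriv; case: tps1.
have tet1 := testfun_deriv dps1 tps1.
have iu u eta : locint u -> testfun eta ->
    leb.-integrable setT (EFin \o (fun x => u x * eta x)).
  move=> lu te; apply: locint_bsupp; last by apply: bsuppMr; case: te.
  exact: locint_mul lu (continuous_testfun te).
pose Hp x := H x * (p x)^-1.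
have cHp : continuous Hp by move=> x; exact: cvgM (cH x) (cV x).
have lHp := locint_continuous cHp.
have lVp := locint_continuous cV.
(* The functional psi -> int k psi' - t int H psi/p vanishes on the kernel of psi -> int psi/p,
   hence is a multiple of it; its value at ps1, which is -c, gives the factor. *)
pose c := t * \int[leb]_x (Hp x * ps1 x) - \int[leb]_x (k x * et1 x).
have key psi eta : testfun psi -> has_deriv psi eta ->
    \int[leb]_x (k x * eta x) - t * \int[leb]_x (Hp x * psi x)
      + c * \int[leb]_x ((p x)^-1 * psi x) = 0.
  move=> tps dps; have tet := testfun_deriv dps tps.
  pose m := \int[leb]_x ((p x)^-1 * psi x).
  have tpt : testfun (fun x => psi x + (- m) * ps1 x).
    exact: (testfunD tps (testfunZ (- m) tps1)).
  have dpt : has_deriv (fun x => psi x + (- m) * ps1 x) (fun x => eta x + (- m) * et1 x).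
    exact: (has_derivD dps (has_derivZ (- m) dps1)).
  have [|phi tphi dphi] := testfun_primitive (testfunM sV tpt).
    rewrite (@eq_Rintegral _ _ _ leb setT
      (fun x => (p x)^-1 * psi x + (- m) * (ps1 x * (p x)^-1))); last by move=> x _; ring.
    rewrite RintegralD ?RintegralZl//.
    - by rewrite ips1 mulr1 subrr.
    - by apply: testfun_integrable; rewrite (_ : (fun _ => _) = fun x => (p x)^-1 * ps1 x);
        [exact: testfunM|apply/funext => x; rewrite mulrC].
    - by apply: testfun_integrable; exact: testfunM.
    - apply: testfun_integrable; apply: testfunZ.
      by rewrite (_ : (fun _ => _) = fun x => (p x)^-1 * ps1 x);
        [exact: testfunM|apply/funext => x; rewrite mulrC].
  have := hk phi _ (fun x => eta x + (- m) * et1 x) tphi dphi.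
  have -> : (fun x => p x * ((p x)^-1 * (psi x + - m * ps1 x))) =
      (fun x => psi x + - m * ps1 x).
    by apply/funext => x; rewrite mulrA divff// mul1r.
  move=> /(_ dpt).
  rewrite (@eq_Rintegral _ _ _ leb setT
    (fun x => (k x * eta x + (- m) * (k x * et1 x)) + t * ((k x * w x) * phi x)));
    last by move=> x _; ring.
  have i1 := iu _ _ lk tet; have i2 := iu _ _ lk tet1; have i3 := iu _ _ lkw tphi.
  have i2' := integrableZl measurableT (- m) i2.
  have i3' := integrableZl measurableT t i3.
  have i12 := integrableD measurableT i1 i2'.
  rewrite RintegralD// RintegralD// !RintegralZl//.
  rewrite (fubini_by_parts ki tphi dphi) -/H.
  rewrite [X in _ + t * - X](@eq_Rintegral _ _ _ leb setT
    (fun x => Hp x * psi x + (- m) * (Hp x * ps1 x))); last first.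
    by move=> x _; rewrite /Hp -/(H x); ring.
  have j1 := iu _ _ lHp tps; have j2 := iu _ _ lHp tps1.
  have j2' := integrableZl measurableT (- m) j2.
  rewrite RintegralD// RintegralZl// -/m /c.
  move: (\int[leb]_x (k x * eta x)) (\int[leb]_x (k x * et1 x))
    (\int[leb]_x (Hp x * psi x)) (\int[leb]_x (Hp x * ps1 x)) => a1 a2 a3 a4 h.
  by rewrite -h; ring.
(* By [key], -v is the weak derivative of k. Hence k = d - V almost everywhere, and K = d - V
   satisfies p K' = c - t H. *)
pose v x := (t * H x - c) * (p x)^-1.
have cv : continuous v.
  move=> x; apply: cvgM; last exact: cV.
  by apply: cvgB; [apply: cvgM; [exact: cvg_cst|exact: cH]|exact: cvg_cst].
have [V dV] := antiderivative cv.
have lV := locint_continuous (has_deriv_cont dV).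
have [||d hd] := @du_bois_reymond R (fun x => k x + V x).
- exact: locintD.
- move=> psi eta tps dps; have tet := testfun_deriv dps tps.
  rewrite (@eq_Rintegral _ _ _ leb setT (fun x => k x * eta x + V x * eta x)); last first.
    by move=> x _; rewrite mulrDl.
  rewrite RintegralD//; [|exact: iu..].
  rewrite (Rintegral_ibp dV cv dps (continuous_testfun tet) tps.2).
  rewrite -(key _ _ tps dps).
  rewrite [X in _ - X = _](@eq_Rintegral _ _ _ leb setT
    (fun x => t * (Hp x * psi x) + (- c) * ((p x)^-1 * psi x))); last first.
    by move=> x _; rewrite /v /Hp; ring.
  have j1 := iu _ _ lHp tps; have j2 := iu _ _ lVp tps.
  have j1' := integrableZl measurableT t j1.
  have j2' := integrableZl measurableT (- c) j2.
  rewrite RintegralD// !RintegralZl//.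
  by move: (\int[leb]_x (k x * eta x)) (\int[leb]_x (Hp x * psi x))
    (\int[leb]_x ((p x)^-1 * psi x)) => a1 a2 a3; ring.
pose K x := d - V x.
have dK : has_deriv K (fun x => - v x).
  by apply: has_deriv_ext (has_derivB (has_deriv_cst d) dV) _ => x; rewrite sub0r.
have kK : {ae leb, forall x, k x = K x}.
  move: hd; apply: filterS; first exact: (ae_filter_ringOfSetsType leb).
  by move=> x E; rewrite /K -E addrK.
have cKw : continuous (fun x => K x * w x).
  by move=> x; apply: cvgM; [exact: (has_deriv_cont dK)|exact: (smooth_cont sw)].
have aeKw : ae_eq leb setT (EFin \o (fun x => k x * w x)) (EFin \o (fun x => K x * w x)).
  move: kK; apply: filterS; first exact: (ae_filter_ringOfSetsType leb).
  by move=> x /= kx _; rewrite kx.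
have mkw : measurable_fun setT (fun x => k x * w x) by exact: locint_measurable.
have mKw : measurable_fun setT (fun x => K x * w x) by exact: continuous_measurable.
have iKw : leb.-integrable setT (EFin \o (fun x => K x * w x)).
  apply/integrableP; split; first exact/measurable_EFinP.
  have /integrableP[_] := ki; rewrite (@ae_eq_integral _ _ _ leb setT
    (abse \o (EFin \o (fun x => k x * w x))) (abse \o (EFin \o (fun x => K x * w x))))//.
  - by apply: measurableT_comp => //; exact/measurable_EFinP.
  - by apply: measurableT_comp => //; exact/measurable_EFinP.
  - move: kK; apply: filterS; first exact: (ae_filter_ringOfSetsType leb).
    by move=> x /= kx _; rewrite kx.
(* Replacing k by its continuous version K leaves H unchanged and makes it differentiable, with H' =
   K w; this is what turns p K' = c - t H into the equation. *)
have HE : H = fun x => \int[leb]_(y in `]-oo, x]) (K y * w y).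
  apply/funext => x; rewrite /H /Rintegral; congr fine; apply: ae_eq_integral => //.
  - by apply/measurable_EFinP/measurable_funTS.
  - by apply/measurable_EFinP/measurable_funTS.
  - exact: ae_eq_subset aeKw.
have dH := has_deriv_Ny cKw iKw; rewrite -HE in dH.
exists K, (fun x => - v x); split => //.
rewrite (_ : (fun x => p x * - v x) = (fun x => c - t * H x)); last first.
  by apply/funext => x; rewrite /v; field.
apply: has_deriv_ext (has_derivB (has_deriv_cst c) (has_derivZ t dH)) _ => x.
by rewrite sub0r mulNr.
Qed.

End weak_solution.

(** * Square-integrable functions *)

Section L2.
Context d (T : measurableType d) (R : realType) (mu : {measure set T -> \bar R}).
Hypothesis muT : mu setT \is a fin_num.
Implicit Types (f g h : T -> R).
Local Notation L2 := (Lfun mu 2%:E).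

Definition ip f g := \int[mu]_x (f x * g x).
Definition sqn f := \int[mu]_x (f x ^+ 2).

Lemma L2P f : f \in L2 <->
  measurable_fun setT f /\ mu.-integrable setT (EFin \o (fun x => f x ^+ 2)).
Proof.
split.
  move=> fL; split; last exact: Lfun2_integrable_sqr.
  by move: fL; rewrite inE => /andP[/[!inE]].
move=> [mf if2]; rewrite inE; apply/andP; split; rewrite inE//=.
rewrite /finite_norm unlock poweR_lty//.
have /integrableP[_] := if2; apply: le_lt_trans.
apply: ge0_le_integral => //=.
- apply/measurable_EFinP.
  by apply: (@measurableT_comp _ _ _ _ _ _ (fun x : R => x `^ 2)) => //; exact: measurableT_comp.
- by apply/measurable_EFinP/measurableT_comp => //; exact: measurable_funX.
- by move=> x _; rewrite lee_fin normrX powR_mulrn.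
Qed.

Lemma L2_measurable f : f \in L2 -> measurable_fun setT f.
Proof. by move=> /L2P[]. Qed.

Lemma ip_integrable f g : f \in L2 -> g \in L2 ->
  mu.-integrable setT (EFin \o (fun x => f x * g x)).
Proof. by move=> fL gL; apply/Lfun1_integrable; exact: Lfun2_mul_Lfun1. Qed.

Lemma L2_integrable f : f \in L2 -> mu.-integrable setT (EFin \o f).
Proof. by move=> fL; apply/Lfun1_integrable; exact: Lfun_subset12. Qed.

Lemma L2Z (c : R) f : f \in L2 -> (fun x => c * f x) \in L2.
Proof.
move=> /L2P[mf if2]; apply/L2P; split; first exact: measurable_funM.
have := integrableZl measurableT (c ^+ 2) if2; apply: eq_integrable => // x _ /=.
by rewrite exprMn EFinM.
Qed.

Lemma L2D f g : f \in L2 -> g \in L2 -> (fun x => f x + g x) \in L2.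
Proof.
move=> fL gL; have [mf if2] := (L2P f).1 fL; have [mg ig2] := (L2P g).1 gL.
apply/L2P; split; first exact: measurable_funD.
have i1 := integrableD measurableT if2 (integrableZl measurableT 2 (ip_integrable fL gL)).
have := integrableD measurableT i1 ig2; apply: eq_integrable => // x _ /=.
by rewrite -!EFinM -!EFinD; congr EFin; ring.
Qed.

Lemma L2B f g : f \in L2 -> g \in L2 -> (fun x => f x - g x) \in L2.
Proof.
move=> fL gL; have := L2D fL (L2Z (-1) gL).
by rewrite (_ : (fun x => _) = fun x => f x - g x)//; apply/funext => x; rewrite mulN1r.
Qed.

Lemma ip_sqn f : ip f f = sqn f.
Proof. by apply: eq_Rintegral => x _; rewrite expr2. Qed.

Lemma sqn_ge0 f : 0 <= sqn f.
Proof. by apply: Rintegral_ge0 => x _; exact: sqr_ge0. Qed.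

Lemma ipC f g : ip f g = ip g f.
Proof. by apply: eq_Rintegral => x _; rewrite mulrC. Qed.

Lemma ipDl f g h : f \in L2 -> g \in L2 -> h \in L2 ->
  ip (fun x => f x + g x) h = ip f h + ip g h.
Proof.
move=> fL gL hL; rewrite -RintegralD//; try exact: ip_integrable.
by apply: eq_Rintegral => x _; rewrite mulrDl.
Qed.

Lemma ipZl (c : R) f h : f \in L2 -> h \in L2 ->
  ip (fun x => c * f x) h = c * ip f h.
Proof.
move=> fL hL; rewrite -RintegralZl//; last exact: ip_integrable.
by apply: eq_Rintegral => x _; rewrite mulrA.
Qed.

Lemma ipBl f g h : f \in L2 -> g \in L2 -> h \in L2 ->
  ip (fun x => f x - g x) h = ip f h - ip g h.
Proof.
move=> fL gL hL; rewrite -RintegralB//; try exact: ip_integrable.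
by apply: eq_Rintegral => x _; rewrite mulrBl.
Qed.

Lemma sqnD f g (c : R) : f \in L2 -> g \in L2 ->
  sqn (fun x => f x + c * g x) = sqn f + 2 * c * ip f g + c ^+ 2 * sqn g.
Proof.
move=> fL gL; have gL' := L2Z c gL.
rewrite -ip_sqn ipDl//; last exact: L2D.
rewrite ipZl//; last exact: L2D.
rewrite (ipC f) (ipC g) !ipDl// !ipZl// !ip_sqn (ipC g f).
by move: (sqn f) (sqn g) (ip f g) => a1 a2 a3; ring.
Qed.

Lemma eq_sqn f g : (forall x, f x = g x) -> sqn f = sqn g.
Proof. by move=> fg; apply: eq_Rintegral => x _; rewrite fg. Qed.

Lemma eq_ip f g f' g' : (forall x, f x = f' x) -> (forall x, g x = g' x) -> ip f g = ip f' g'.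
Proof. by move=> ff gg; apply: eq_Rintegral => x _; rewrite ff gg. Qed.

Lemma sqnZ (c : R) f : f \in L2 -> sqn (fun x => c * f x) = c ^+ 2 * sqn f.
Proof.
move=> fL; rewrite -RintegralZl//; last by have [] := (L2P f).1 fL.
by apply: eq_Rintegral => x _; rewrite exprMn.
Qed.

Lemma sqnBC f g : sqn (fun x => f x - g x) = sqn (fun x => g x - f x).
Proof. by apply: eq_Rintegral => x _; rewrite -sqrrN opprB. Qed.

Lemma le_sqn f g : f \in L2 -> g \in L2 -> (forall x, f x ^+ 2 <= g x ^+ 2) ->
  sqn f <= sqn g.
Proof.
move=> /L2P[_ fL] /L2P[_ gL] fg.
by apply: le_Rintegral.
Qed.

Lemma parallelogram f g : f \in L2 -> g \in L2 ->
  sqn (fun x => f x + g x) + sqn (fun x => f x - g x) = 2 * sqn f + 2 * sqn g.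
Proof.
move=> fL gL.
rewrite (@eq_sqn (fun x => f x + g x) (fun x => f x + 1 * g x)); last by move=> x; rewrite mul1r.
rewrite (@eq_sqn (fun x => f x - g x) (fun x => f x + (-1) * g x)); last by move=> x; rewrite mulN1r.
by rewrite !sqnD//; ring.
Qed.

Lemma sqnD_le f g : f \in L2 -> g \in L2 ->
  sqn (fun x => f x + g x) <= 2 * sqn f + 2 * sqn g.
Proof. by move=> fL gL; rewrite -parallelogram// lerDl sqn_ge0. Qed.

Lemma quad_disc (a b c : R) : 0 <= c ->
  (forall s, 0 <= a + 2 * s * b + s ^+ 2 * c) -> b ^+ 2 <= a * c.
Proof.
rewrite le_eqVlt => /predU1P[<-|c0] H.
  rewrite mulr0; have [->|b0] := eqVneq b 0; first by rewrite expr0n.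
  (* For c = 0 the expression is affine in s, and this s gives it the value -1. *)
  have := H (- (a + 1) / (2 * b)).
  rewrite mulr0 addr0 (_ : 2 * _ * _ = - (a + 1)); last by field.
  lra.
have := H (- b / c).
rewrite (_ : _ + _ = (a * c - b ^+ 2) / c); last by field; rewrite gt_eqF.
by rewrite pmulr_lge0 ?invr_gt0// subr_ge0.
Qed.

Lemma ip_CS f g : f \in L2 -> g \in L2 -> ip f g ^+ 2 <= sqn f * sqn g.
Proof.
by move=> fL gL; apply: quad_disc (sqn_ge0 _) _ => s; rewrite -sqnD// sqn_ge0.
Qed.

Lemma L2norm_sqn f : f \in L2 -> ('N[mu]_2[EFin \o f])%E = (Num.sqrt (sqn f))%:E.
Proof.
move=> fL; rewrite unlock.
rewrite (_ : (\int[mu]_x _)%E = (sqn f)%:E); first by rewrite poweR_EFin powR12_sqrt// sqn_ge0.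
rewrite /sqn /Rintegral fineK; last first.
  by apply: integrable_fin_num => //; have [] := (L2P f).1 fL.
apply: eq_integral => x _ /=.
by rewrite powR_mulrn// real_normK// num_real.
Qed.

End L2.

(** * Completeness of L^2 for a finite measure *)

Section Riesz_Fischer.
Context d (T : measurableType d) (R : realType) (mu : {measure set T -> \bar R}).
Hypothesis muT : mu setT \is a fin_num.
Implicit Types (f g h : T -> R).
Local Notation L2 := (Lfun mu 2%:E).
Local Notation sqn := (sqn mu).

Lemma cvg_summable_diff (u : nat -> R) :
  (\sum_(0 <= k <oo) `|u k.+1 - u k|%:E < +oo)%E -> cvgn u.
Proof.
move=> us.
have h : cvgn [normed series (telescope u)].
  set M := (\sum_(0 <= k <oo) _)%E in us.
  have M0 : (0 <= M)%E by apply: nneseries_ge0 => k _ _; rewrite lee_fin.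
  apply: nondecreasing_is_cvgn; first by apply: nondecreasing_series => k _ _; exact: normr_ge0.
  exists (fine M) => _ [n _ <-]; rewrite -lee_fin fineK ?ge0_fin_numE//.
  rewrite /series/= -sumEFin; apply: nneseries_lim_ge => k _.
  by rewrite lee_fin.
have := normed_cvg h => c.
rewrite (_ : u = fun n => u 0%N + series (telescope u) n).
  by apply: is_cvgD => //; exact: is_cvg_cst.
by apply/funext => n; rewrite -eq_sum_telescope.
Qed.

(** Young's inequality |D| <= 2^-k + 2^k D^2 bounds the L^1 norm of the k-th increment by 2^-k (M +
    1), M being the total mass. The sum of the absolute increments is thus integrable, hence finite
    almost everywhere. *)
Lemma ae_cvg_fast (g : nat -> T -> R) : (forall n, g n \in L2) ->
  (forall k, sqn (fun x => g k.+1 x - g k x) <= (2 ^- k) ^+ 2) ->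
  {ae mu, forall x, cvgn (fun n => g n x)}.
Proof.
move=> gL gq; pose M := fine (mu setT).
have dL k : (fun x => g k.+1 x - g k x) \in L2 by exact: L2B.
have d1 k : (\int[mu]_x `|g k.+1 x - g k x|%:E <= (2 ^- k * (M + 1))%:E)%E.
  have [_ i2] := (L2P mu _).1 (dL k).
  apply: (@le_trans _ _ (\int[mu]_x (2 ^- k + 2 ^+ k * (g k.+1 x - g k x) ^+ 2)%:E)%E).
    apply: ge0_le_integral => //=.
    - by apply/measurable_EFinP/measurableT_comp => //; exact: L2_measurable (dL k).
    - apply/measurable_EFinP/measurable_funD => //; apply: measurable_funM => //.
      by apply: measurable_funX; exact: L2_measurable (dL k).
    - move=> x _; rewrite lee_fin -[X in _ <= _ + _ * X]real_normK ?num_real//.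
      have : 0 < (2 : R) ^+ k by rewrite exprn_gt0.
      have := normr_ge0 (g k.+1 x - g k x).
      move: (2 ^+ k) `|g k.+1 x - g k x| => s D D0 s0.
      rewrite -subr_ge0 (_ : _ - _ = ((s * D - 1) ^+ 2 + s * D) / s); last by field; rewrite gt_eqF.
      by rewrite divr_ge0 ?addr_ge0 ?sqr_ge0 ?mulr_ge0// ltW.
  rewrite (_ : (fun x => _) = fun x => ((2 ^- k)%:E + (2 ^+ k)%:E * ((g k.+1 x - g k x) ^+ 2)%:E)%E)//.
  have mq : measurable_fun setT (fun x => ((g k.+1 x - g k x) ^+ 2)%:E).
    by apply/measurable_EFinP/measurable_funX; exact: L2_measurable (dL k).
  rewrite ge0_integralD//=; last 2 first.
  - by move=> x _; rewrite mule_ge0// lee_fin ?sqr_ge0// exprn_ge0.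
  - by apply: emeasurable_funM.
  rewrite integral_cst// -(fineK muT) -EFinM ge0_integralZl//; last first.
    by move=> x _; rewrite lee_fin sqr_ge0.
  have -> : (\int[mu]_x ((g k.+1 x - g k x) ^+ 2)%:E)%E = (sqn (fun x => g k.+1 x - g k x))%:E.
    by rewrite /sqn /Rintegral fineK// integrable_fin_num.
  rewrite -EFinM -EFinD lee_fin.
  rewrite mulrDr lerD2l mulr1 (le_trans (ler_wpM2l _ (gq k)))// ?exprn_ge0//.
  by rewrite expr2 mulrA divff ?mul1r// expf_neq0.
pose S x := (\sum_(0 <= k <oo) `|g k.+1 x - g k x|%:E)%E.
have mD k : measurable_fun setT (fun x => `|g k.+1 x - g k x|%:E).
  by apply/measurable_EFinP/measurableT_comp => //; exact: L2_measurable (dL k).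
have mS : measurable_fun setT S by apply: ge0_emeasurable_sum.
have iS : mu.-integrable setT S.
  apply/integrableP; split => //.
  under eq_integral => x _ do rewrite gee0_abs ?nneseries_ge0//.
  rewrite integral_nneseries//.
  apply: (@le_lt_trans _ _ (2 * (M + 1))%:E); last exact: ltry.
  apply: lime_le; first by apply: is_cvg_nneseries => k _ _; exact: integral_ge0.
  have M0 : 0 <= M by rewrite fine_ge0.
  apply: nearW => n.
  apply: (@le_trans _ _ (\sum_(0 <= k < n) (2 ^- k * (M + 1))%:E)%E).
    by apply: lee_sum => k _; exact: d1.
  rewrite sumEFin lee_fin -mulr_suml ler_wpM2r ?addr_ge0//.
  have -> : \sum_(0 <= k < n) (2 : R) ^- k = 2 - 2 * 2 ^- n.
    elim: n => [|n IH]; first by rewrite big_nil expr0; field.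
    rewrite big_nat_recr//= IH exprS; field; rewrite expf_neq0//.
  by rewrite lerBlDr lerDl mulr_ge0.
have := integrable_ae measurableT iS.
apply: filterS => x /(_ I) Sx; apply: cvg_summable_diff.
by rewrite -ge0_fin_numE// nneseries_ge0.
Qed.

(** A rapidly Cauchy subsequence g converges almost everywhere, and Fatou's lemma in k carries the
    bound on u n - g k over to u n - f. Defining f by an upper limit makes it measurable everywhere,
    including where g diverges. *)
Lemma L2_complete (u : nat -> T -> R) : (forall n, u n \in L2) ->
  (forall e : R, 0 < e -> exists N, forall m n, (N <= m)%N -> (N <= n)%N ->
     sqn (fun x => u m x - u n x) <= e) ->
  exists2 f, f \in L2 & sqn (fun x => u n x - f x) @[n --> \oo] --> (0:R).
Proof.
move=> uL uC.
have ek (k : nat) : 0 < ((2 : R) ^- k) ^+ 2 by rewrite exprn_gt0// invr_gt0 exprn_gt0.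
have [N hN] := boolp.choice (fun k => uC _ (ek k)).
(* Both [n_ k] and [n_ k.+1] lie beyond [N k], and [n_ k] >= k tends to infinity. *)
pose n_ k := maxn k (\max_(j < k.+1) N j)%N.
have Nn k j : (j <= k)%N -> (N j <= n_ k)%N.
  rewrite -ltnS => jk.
  exact: leq_trans (@leq_bigmax _ (fun j : 'I_k.+1 => N j) (Ordinal jk)) (leq_maxr _ _).
pose g k := u (n_ k).
have gL k : g k \in L2 by exact: uL.
have aeg := ae_cvg_fast gL (fun k => hN k _ _ (Nn k.+1 k (leqnSn k)) (Nn k k (leqnn k))).
pose f x := fine (limn_esup (fun n => (g n x)%:E)).
have mf : measurable_fun setT f.
  apply: measurableT_comp => //; apply: measurable_fun_limn_esup => n.
  by apply/measurable_EFinP; exact: L2_measurable (gL n).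
have aef : {ae mu, forall x, g n x @[n --> \oo] --> f x}.
  move: aeg; apply: filterS => x cx.
  have cE : (g n x)%:E @[n --> \oo] --> (lim (g n x @[n --> \oo]))%:E.
    by apply: cvg_EFin => //; exact: nearW.
  by rewrite /f is_cvg_limn_esupE ?(cvg_lim _ cE)//; apply/cvg_ex; eexists; exact: cE.
have key e : 0 < e -> exists n0, forall n, (n0 <= n)%N ->
    (\int[mu]_x ((u n x - f x) ^+ 2)%:E <= e%:E)%E.
  move=> e0; have [n0 hn0] := uC e e0; exists n0 => n n0n.
  have mg k : measurable_fun setT (fun x => ((u n x - g k x) ^+ 2)%:E).
    by apply/measurable_EFinP/measurable_funX/measurable_funB; exact: L2_measurable.
  rewrite (@ae_eq_integral _ _ _ mu setT (fun x => limn_einf (fun k => ((u n x - g k x) ^+ 2)%:E)))//.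
  - apply: le_trans.
      by apply: (fatou mu measurableT mg) => k x _; rewrite lee_fin sqr_ge0.
    rewrite limn_einf_lim; apply: lime_le; first exact: is_cvg_einfs.
    near=> k; apply: (@le_trans _ _ (\int[mu]_x ((u n x - g k x) ^+ 2)%:E)%E).
      by apply: ereal_inf_lbound; exists k => /=.
    have [_ i2] := (L2P mu _).1 (L2B (uL n) (gL k)).
    rewrite -[X in (X <= _)%E]fineK ?integrable_fin_num// lee_fin.
    by apply: hn0 => //; rewrite leq_max; apply/orP; left; near: k; exact: nbhs_infty_ge.
  - by apply/measurable_EFinP/measurable_funX/measurable_funB => //; exact: L2_measurable.
  - rewrite (_ : (fun x => _) = fun x => (- limn_esup (fun k => - ((u n x - g k x) ^+ 2)%:E))%E).
      by apply: measurableT_comp => //; apply: measurable_fun_limn_esup => k; exact: measurableT_comp.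
    apply/funext => x.
    by rewrite (limn_esupN (fun k => ((u n x - g k x) ^+ 2)%:E)) oppeK.
  - move: aef; apply: filterS => x cx _.
    have cE : ((u n x - g k x) ^+ 2)%:E @[k --> \oo] --> ((u n x - f x) ^+ 2)%:E.
      apply: cvg_EFin; first exact: nearW.
      have c1 : u n x - g k x @[k --> \oo] --> u n x - f x by apply: cvgB => //; exact: cvg_cst.
      rewrite expr2 (_ : _ \o _ = fun k => (u n x - g k x) * (u n x - g k x)).
        exact: (cvgM c1 c1).
      by apply/funext => k /=; rewrite expr2.
    by rewrite is_cvg_limn_einfE ?(cvg_lim _ cE)//; apply/cvg_ex; eexists; exact: cE.
have dL n : (\int[mu]_x ((u n x - f x) ^+ 2)%:E < +oo)%E -> (fun x => u n x - f x) \in L2.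
  move=> h; apply/L2P; split; first by apply: measurable_funB => //; exact: L2_measurable.
  apply/integrableP; split.
    by apply/measurable_EFinP/measurable_funX/measurable_funB => //; exact: L2_measurable.
  by under eq_integral => x _ do rewrite gee0_abs ?lee_fin ?sqr_ge0//.
have fL : f \in L2.
  have [n0 /(_ n0 (leqnn _)) h] := key 1 ltr01.
  have := L2B (uL n0) (dL n0 (le_lt_trans h (ltry _))).
  by rewrite (_ : (fun x => _) = f)//; apply/funext => x; rewrite subKr.
exists f => //; apply/cvgrPdist_le => e e0; have [n0 hn0] := key e e0.
near=> n; rewrite sub0r normrN ger0_norm ?sqn_ge0// -lee_fin.
rewrite /sqn /Rintegral fineK; first by apply: hn0; near: n; exact: nbhs_infty_ge.
by apply: integrable_fin_num => //; have [] := (L2P mu (fun x => u n x - f x)).1 (L2B (uL n) fL).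
Unshelve. all: by end_near. Qed.

End Riesz_Fischer.

(** * Density of the range of an operator from triviality of its orthogonal *)

Section dense_range.
Context d (T : measurableType d) (R : realType) (mu : {measure set T -> \bar R}).
Hypothesis muT : mu setT \is a fin_num.
Local Notation L2 := (Lfun mu 2%:E).
Local Notation sqn := (sqn mu).
Local Notation ip := (ip mu).

Lemma le0_cvg0 (a : R) (u : nat -> R) : (forall n, a <= u n) ->
  u n @[n --> \oo] --> (0 : R) -> a <= 0.
Proof.
move=> au u0; rewrite leNgt; apply/negP => a0.
have [n /=] : exists n, u n < a.
  have := cvgr_lt _ u0 _ a0 => -[n _ /(_ n (leqnn n))]; by exists n.
by rewrite ltNge au.
Qed.

Variables (D : set (T -> R)) (A : (T -> R) -> T -> R).
Hypothesis DL2 : forall f, D f -> f \in L2 /\ A f \in L2.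
Hypothesis Dlin : forall f g (c : R), D f -> D g ->
  D (fun x => f x + c * g x) /\ forall x, A (fun x => f x + c * g x) x = A f x + c * A g x.
Hypothesis D0 : exists f, D f.

(* Residuals of a minimizing sequence for the distance of h to the range are
   Cauchy; their limit is orthogonal to the range, hence null. *)
Lemma dense_range :
  (forall k, k \in L2 -> (forall f, D f -> ip k (A f) = 0) -> sqn k = 0) ->
  forall h, h \in L2 -> exists2 u : nat -> T -> R, forall n, D (u n) &
    sqn (fun x => A (u n) x - h x) @[n --> \oo] --> (0 : R).
Proof.
move=> Hk h hL; pose E := [set sqn (fun x => A f x - h x) | f in D].
have E0 : has_inf E.
  split; first by have [f Df] := D0; exists (sqn (fun x => A f x - h x)), f.
  by exists 0 => _ [f _ <-]; exact: sqn_ge0.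
pose d0 := inf E.
have d0P f : D f -> d0 <= sqn (fun x => A f x - h x).
  by move=> Df; apply: ge_inf; [case: E0|exists f].
have ex (n : nat) : exists f, D f /\ sqn (fun x => A f x - h x) < d0 + n.+1%:R^-1.
  have n0 : (0 : R) < n.+1%:R^-1 by rewrite invr_gt0.
  by have [_ [f Df <-] lt] := inf_adherent n0 E0; exists f.
have [u hu] := boolp.choice ex.
pose r n x := A (u n) x - h x.
have AL n : A (u n) \in L2 by have [/DL2[]] := hu n.
have rL n : r n \in L2 by exact: L2B.
have rlt n : sqn (r n) < d0 + n.+1%:R^-1 by have [] := hu n.
have rC m n : sqn (fun x => r m x - r n x) <= 2 * m.+1%:R^-1 + 2 * n.+1%:R^-1.
  have := parallelogram (rL m) (rL n).
  (* The midpoint of u m and u n is in D, so its residual (r m + r n)/2 has square norm at least d0;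
     the parallelogram identity then bounds r m - r n. *)
  have [D1 A1] := @Dlin (u n) (u m) (-1) (hu n).1 (hu m).1.
  have [D2 A2] := @Dlin (u m) _ (2^-1) (hu m).1 D1.
  have E2 : sqn (fun x => r m x + r n x) = 2 ^+ 2 * sqn (fun x =>
      A (fun y => u m y + 2^-1 * (u n y + -1 * u m y)) x - h x).
    rewrite -sqnZ; last by apply: L2B => //; have [] := DL2 D2.
    by apply: eq_Rintegral => x _; rewrite A2 A1 /r; field.
  have := d0P _ D2; have := rlt m; have := rlt n; rewrite E2.
  move: (sqn (r m)) (sqn (r n)) (sqn (fun x => r m x - r n x)) => a1 a2 a3.
  move: (sqn _) => a4.
  move: (m.+1%:R^-1) (n.+1%:R^-1) => i1 i2; move: (d0 : R) => d1.
  by rewrite expr2 => *; lra.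
have [k kL rk] : exists2 k, k \in L2 & sqn (fun x => r n x - k x) @[n --> \oo] --> (0 : R).
  apply: L2_complete => // e e0.
  exists (Num.truncn (4 / e)).+1 => m n Nm Nn; apply: le_trans (rC m n) _.
  have b (j : nat) : ((Num.truncn (4 / e)).+1 <= j)%N -> 2 * j.+1%:R^-1 <= e / 2.
    move=> Nj.
    have jj : 4 / e <= j.+1%:R.
      by rewrite (le_trans (ltW (truncnS_gt _)))// ler_nat (leq_trans Nj).
    have j0 : (0 : R) < j.+1%:R by [].
    rewrite ler_pdivrMr//; move: jj; rewrite ler_pdivrMr//; lra.
  by apply: le_trans (lerD (b m Nm) (b n Nn)) _; rewrite -splitr.
have ik f : D f -> ip k (A f) = 0.
  move=> Df; have [fL AfL] := DL2 Df.
  (* Moving u n by s f cannot bring the square distance below d0, which r n exceeds by less than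
     1/(n+1). The resulting quadratic in s is nonnegative, and its discriminant gives the bound. *)
  have h1 n : ip (r n) (A f) ^+ 2 <= n.+1%:R^-1 * sqn (A f).
    apply: quad_disc (sqn_ge0 _ _) _ => s.
    have [D1 A1] := @Dlin (u n) f s (hu n).1 Df.
    have E1 : sqn (fun x => A (fun y => u n y + s * f y) x - h x) =
        sqn (fun x => r n x + s * A f x).
      by apply: eq_Rintegral => x _; rewrite A1 /r; congr (_ ^+ 2); ring.
    have := d0P _ D1; rewrite E1 sqnD//; have := rlt n.
    move: (n.+1%:R^-1) (2 * s * ip (r n) (A f)) (s ^+ 2 * sqn (A f)) (sqn (r n)).
    by move: (d0 : R) => a1 a2 a3 a4 a5; lra.
  have h2 n : ip k (A f) ^+ 2 <= 2 * (n.+1%:R^-1 * sqn (A f)) +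
      2 * (sqn (fun x => r n x - k x) * sqn (A f)).
    have := ip_CS (L2B (rL n) kL) AfL.
    have := h1 n; rewrite ipBl//.
    move: (ip (r n) _) (ip k _) => a b.
    have := sqr_ge0 (a + (a - b)).
    move: (n.+1%:R^-1 * sqn (A f)) (sqn (fun x => r n x - k x) * sqn (A f)) => c1 c2.
    by rewrite !expr2; lra.
  have h3 : 2 * (n.+1%:R^-1 * sqn (A f)) + 2 * (sqn (fun x => r n x - k x) * sqn (A f))
      @[n --> \oo] --> (0 : R).
    rewrite [X in _ --> X](_ : 0 = 2 * (0 * sqn (A f)) + 2 * (0 * sqn (A f))); last by ring.
    apply: cvgD; apply: cvgM; try exact: cvg_cst; apply: cvgM; try exact: cvg_cst => //.
      exact: cvg_harmonic.
    exact: rk.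
  have h4 := le0_cvg0 h2 h3.
  by apply/eqP; rewrite -sqrf_eq0 eq_le h4 sqr_ge0.
exists u; first by move=> n; have [] := hu n.
have k0 := Hk k kL ik.
apply: (@squeeze_cvgr _ _ _ _ (fun=> 0) (fun n => 2 * sqn (fun x => r n x - k x))).
- apply: nearW => n; rewrite sqn_ge0/=.
  have := sqnD_le (L2B (rL n) kL) kL; rewrite k0 mulr0 addr0; apply: le_trans.
  by rewrite le_eqVlt; apply/orP; left; apply/eqP; apply: eq_Rintegral => x _; rewrite subrK.
- exact: cvg_cst.
- by rewrite -[X in _ --> X](mulr0 (2 : R)); apply: cvgM; [exact: cvg_cst|exact: rk].
Qed.

End dense_range.

(** * Integration against a measure given by a density *)

Section density.
Context d (T : measurableType d) (R : realType).
Variables (mu nu : {measure set T -> \bar R}) (h : T -> R).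
Hypothesis mh : measurable_fun setT h.
Hypothesis h0 : forall x, 0 <= h x.
Hypothesis nuE : forall A, measurable A -> nu A = (\int[mu]_(x in A) (h x)%:E)%E.
Local Open Scope ereal_scope.
Import HBNNSimple.

(** On simple functions this is [nuE] with linearity; monotone convergence along [nnsfun_approx]
    does the rest. *)
Lemma ge0_integral_density (f : T -> \bar R) :
  measurable_fun setT f -> (forall x, 0 <= f x) ->
  \int[nu]_x f x = \int[mu]_x (f x * (h x)%:E).
Proof.
move=> mf f0; pose s := nnsfun_approx measurableT mf.
have mhE : measurable_fun setT (EFin \o h) by exact/measurable_EFinP.
have ms n : measurable_fun setT (EFin \o s n) by exact/measurable_EFinP.
have key (u : {nnsfun T >-> R}) :
    \int[nu]_x (u x)%:E = \int[mu]_x ((u x)%:E * (h x)%:E).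
  under [LHS]eq_integral do rewrite fimfunE -fsumEFin//.
  rewrite ge0_integral_fsum//; last 2 first.
  - by move=> r; exact/measurable_EFinP/measurableT_comp.
  - by move=> n x _; rewrite EFinM nnfun_muleindic_ge0.
  under [RHS]eq_integral => x _.
    rewrite fimfunE -fsumEFin// ge0_mule_fsuml; last first.
      by move=> r; rewrite EFinM nnfun_muleindic_ge0.
    over.
  rewrite ge0_integral_fsum//; last 2 first.
  - by move=> r; apply: emeasurable_funM => //; exact/measurable_EFinP/measurableT_comp.
  - move=> n x _; apply: mule_ge0; last by rewrite lee_fin.
    by rewrite EFinM nnfun_muleindic_ge0.
  apply: eq_fsbigr => r _.
  have mr : measurable (u @^-1` [set r]) by [].
  rewrite integralZl_indic_nnsfun// integral_indic// setIT.
  have [r0|r0] := ltP r 0%R.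
    rewrite preimage_nnfun0// measure0 mule0 integral0_eq// => x _.
    by rewrite indic0 mulr0 mul0e.
  under eq_integral do rewrite EFinM -muleA.
  rewrite ge0_integralZl//; last 2 first.
  - by apply: emeasurable_funM => //; exact/measurable_EFinP.
  - by move=> x _; rewrite mule_ge0 ?lee_fin.
  congr (_ * _); rewrite nuE// integral_mkcond; apply: eq_integral => x _.
  by rewrite patchE indicE; case: ifP; rewrite ?mul1e ?mul0e.
transitivity (limn (fun n => \int[nu]_x (s n x)%:E)).
  rewrite -monotone_convergence//.
  - by apply: eq_integral => x _; apply/esym/cvg_lim => //; exact: cvg_nnsfun_approx.
  - by move=> n x _; rewrite lee_fin.
  - by move=> x _ m n mn; rewrite lee_fin; exact/lefP/nd_nnsfun_approx.
under eq_fun do rewrite key.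
rewrite -monotone_convergence//.
- apply: eq_integral => x _; apply/cvg_lim => //; apply: cvgeZr => //.
  exact: cvg_nnsfun_approx.
- by move=> n; apply: emeasurable_funM => //; exact: ms.
- by move=> n x _; rewrite mule_ge0 ?lee_fin.
- by move=> x _ m n mn; rewrite lee_wpmul2r ?lee_fin//; exact/lefP/nd_nnsfun_approx.
Qed.

Lemma integral_density (f : T -> R) : measurable_fun setT f ->
  \int[nu]_x (f x)%:E = \int[mu]_x (f x * h x)%:E.
Proof.
move=> mf; have mfE : measurable_fun setT (EFin \o f) by exact/measurable_EFinP.
rewrite [LHS]integralE [RHS]integralE; congr (_ - _).
  rewrite ge0_integral_density; [|exact: measurable_funepos|exact: funepos_ge0].
  apply: eq_integral => x _; rewrite !funeposE.
  have [fx|/ltW fx] := leP 0%R (f x).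
    by rewrite !max_l ?lee_fin ?mulr_ge0// EFinM.
  by rewrite !max_r ?mul0e ?lee_fin// mulr_le0_ge0.
rewrite ge0_integral_density; [|exact: measurable_funeneg|exact: funeneg_ge0].
apply: eq_integral => x _; rewrite !funenegE.
have [fx|/ltW fx] := leP 0%R (f x).
  by rewrite !max_r ?mul0e// oppe_le0 lee_fin// mulr_ge0.
rewrite !max_l; first by rewrite -!EFinN -EFinM mulNr.
  by rewrite oppe_ge0 lee_fin mulr_le0_ge0.
by rewrite oppe_ge0 lee_fin.
Qed.

Lemma Rintegral_density (f : T -> R) : measurable_fun setT f ->
  (\int[nu]_x f x = \int[mu]_x (f x * h x))%R.
Proof. by move=> mf; rewrite /Rintegral integral_density. Qed.

Lemma integrable_density (f : T -> R) : measurable_fun setT f ->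
  nu.-integrable setT (EFin \o f) <->
  mu.-integrable setT (EFin \o (fun x => f x * h x)%R).
Proof.
move=> mf; have mfh : measurable_fun setT (fun x => f x * h x)%R by exact: measurable_funM.
have E : \int[nu]_x `|(f x)%:E| = \int[mu]_x `|(f x * h x)%:E|.
  rewrite (integral_density (f := fun x => `|f x|%R)); last exact: measurableT_comp.
  by apply: eq_integral => x _; rewrite /= normrM (ger0_norm (h0 x)).
by split=> /integrableP[_ H]; apply/integrableP; split;
  rewrite ?(E)//; first [exact/measurable_EFinP|rewrite -E//].
Qed.
End density.

(** * Poincare inequality for the generalized Cauchy measure *)

Section gcauchy_calculus.
Context {R : realType}.
Implicit Types (f g : R -> R) (x s : R).

(** Powers of the squared Japanese bracket, a family stable under products and, up to polynomial
    factors, under derivatives. Both w and p belong to it. *)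
Definition japow s x : R := (1 + x ^+ 2) `^ s.

Lemma japbase_gt0 x : 0 < 1 + x ^+ 2.
Proof. by rewrite ltr_pwDl ?sqr_ge0. Qed.

Lemma japow_gt0 s x : 0 < japow s x.
Proof. by rewrite powR_gt0// japbase_gt0. Qed.

Lemma japowD s t x : japow (s + t) x = japow s x * japow t x.
Proof. by rewrite /japow powRD//; apply/implyP => _; rewrite gt_eqF// japbase_gt0. Qed.

Lemma japow1 x : japow 1 x = 1 + x ^+ 2.
Proof. by rewrite /japow powRr1// ltW// japbase_gt0. Qed.

Lemma japowS s x : japow (s + 1) x = (1 + x ^+ 2) * japow s x.
Proof. by rewrite japowD japow1 mulrC. Qed.

Lemma has_deriv_japbase : has_deriv (fun x => 1 + x ^+ 2) (fun x => 2 * x).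
Proof.
apply: has_deriv_ext (has_derivD (has_deriv_cst 1) (has_derivXn 2)) _ => x.
by rewrite add0r.
Qed.

Lemma has_deriv_japow s : has_deriv (japow s) (fun x => 2 * s * x * japow (s - 1) x).
Proof.
move=> x; rewrite /japow.
have dP : is_derive (1 + x ^+ 2) (1 : R) (fun y => y `^ s) (s * (1 + x ^+ 2) `^ (s - 1)).
  by apply: is_derive1_powR; exact: japbase_gt0.
have dC := @is_derive1_comp R (fun y => y `^ s) (fun y => 1 + y ^+ 2) x _ _ dP (has_deriv_japbase x).
apply: (is_derive_eq dC).
by rewrite /GRing.scale/=; ring.
Qed.

Lemma has_deriv_japow' s : has_deriv (japow s) (fun x => 2 * s * x / (1 + x ^+ 2) * japow s x).
Proof.
apply: has_deriv_ext (has_deriv_japow s) _ => x.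
rewrite -[in RHS](subrK 1 s) japowS; field.
by rewrite gt_eqF// japbase_gt0.
Qed.

Lemma smooth_japow s : smooth (japow s).
Proof.
apply/smoothP => n; elim: n s => // n IH s.
apply: CkS (has_deriv_japow s) _; apply: CkM => //.
by apply: CkM; [exact: Ck_cst|exact: (smoothP _).1 smooth_id _].
Qed.

Lemma cont_japow s : continuous (japow s).
Proof. by move=> x; apply: smooth_cont; exact: smooth_japow. Qed.

Lemma gcauchy_funE b x : gcauchy_fun b x = japow (- b) x.
Proof. by rewrite /gcauchy_fun /japow powRN. Qed.

(* Barta's trick: [Q = p rho'/rho] with rho = x (1+x^2)^(c/2) turns the
   pointwise inequality -(Q' + Q^2/p) >= lam w into a Hardy inequality for
   functions vanishing at 0. *)
Lemma hardy_monotone (b c lam : R) f f1 G : -1 <= c ->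
  (forall t : R, 0 <= t <= 1 -> lam <= 2 * b - 2 - 3 * c - (c ^+ 2 - 2 * b * c) * t) ->
  has_deriv f f1 ->
  has_deriv G (fun x => japow (1 - b) x * f1 x ^+ 2
                        - lam * (japow (- b) x * (f x - f 0) ^+ 2)) ->
  forall N : R, 0 <= N -> G 0 <= G N.
Proof.
move=> c1 hlam df dG N; rewrite le_eqVlt => /predU1P[<-//|N0].
pose w := japow (- b).
have w0 x : 0 < w x by exact: japow_gt0.
have pw x : japow (1 - b) x = (1 + x ^+ 2) * w x by rewrite addrC japowS.
have s0 x : 1 + x ^+ 2 != 0 by rewrite gt_eqF// japbase_gt0.
(* The boundary term B = Q (f - f 0)^2 is singular at 0 as written. The Caratheodory slope phi of f
   at 0 puts it in the continuous form Bt, which vanishes there. *)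
have [phi [fphi cphi phi0]] := (is_derive1_caratheodory f 0 (f1 0)).1 (df 0).
pose Bt x := w x * (1 + (1 + c) * x ^+ 2) * phi x ^+ 2 * x.
pose B x := w x * ((1 + (1 + c) * x ^+ 2) * x^-1) * (f x - f 0) ^+ 2.
have BtB x : 0 < x -> B x = Bt x.
  move=> x0; rewrite /B /Bt fphi subr0; field; by rewrite gt_eqF.
have dB x : 0 < x -> is_derive x (1 : R) B
   (w x * (1 - 2 * b + c - x ^- 2 - 2 * b * c * (x ^+ 2 / (1 + x ^+ 2))) * (f x - f 0) ^+ 2
    + 2 * (w x * ((1 + (1 + c) * x ^+ 2) * x^-1)) * ((f x - f 0) * f1 x)).
  move=> x0; have xn0 : x != 0 by rewrite gt_eqF.
  have dV := @is_derive1V R (fun y => y) x 1 xn0 (has_deriv_id x).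
  have dP : has_deriv (fun y : R => 1 + (1 + c) * y ^+ 2) (fun y => (1 + c) * (2 * y)).
    apply: has_deriv_ext (has_derivD (has_deriv_cst 1) (has_derivZ (1 + c) (has_derivXn 2))) _ => y.
    by rewrite add0r.
  have dW := has_deriv_japow' (- b).
  have dF : has_deriv (fun y => f y - f 0) f1.
    by apply: has_deriv_ext (has_derivB df (has_deriv_cst (f 0))) _ => y; rewrite subr0.
  have dF2 : has_deriv (fun y => (f y - f 0) ^+ 2) (fun y => 2 * ((f y - f 0) * f1 y)).
    rewrite (_ : (fun y => (f y - f 0) ^+ 2) = fun y => (f y - f 0) * (f y - f 0)); last first.
      by apply/funext => y; rewrite expr2.
    by apply: has_deriv_ext (has_derivM dF dF) _ => y; ring.
  apply: (is_derive_eq (is_derive1M (is_derive1M (dW x) (is_derive1M (dP x) dV)) (dF2 x))).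
  by rewrite /w; field; rewrite s0 xn0.
(* With g = f - f 0, the derivative of G - B is p (f' - (rho'/rho) g)^2 plus a multiple of w g^2
   that [hlam] makes nonnegative. *)
have mono e : 0 < e -> e <= N -> G e - B e <= G N - B N.
  move=> e0 eN; apply: (@ger0_derive1_ndecr R (fun x => G x - B x) e N) => //.
  - move=> x; rewrite in_itv/= => /andP[ex _]; have x0 := lt_trans e0 ex.
    by have [] := is_deriveB (dG x) (dB x x0).
  - move=> x; rewrite in_itv/= => /andP[ex _]; have x0 := lt_trans e0 ex.
    rewrite derive1E; have [_ ->] := is_deriveB (dG x) (dB x x0).
    pose t := x ^+ 2 / (1 + x ^+ 2).
    have t01 : 0 <= t <= 1.
      apply/andP; split; first by rewrite divr_ge0 ?sqr_ge0// ltW// japbase_gt0.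
      by rewrite ler_pdivrMr ?japbase_gt0// mul1r lerDr.
    have := hlam t t01; rewrite -subr_ge0 => ht.
    pose g := f x - f 0.
    have -> : japow (1 - b) x * f1 x ^+ 2 - lam * (japow (- b) x * (f x - f 0) ^+ 2) -
      (w x * (1 - 2 * b + c - x ^- 2 - 2 * b * c * (x ^+ 2 / (1 + x ^+ 2))) * (f x - f 0) ^+ 2
      + 2 * (w x * ((1 + (1 + c) * x ^+ 2) * x^-1)) * ((f x - f 0) * f1 x)) =
      w x * ((1 + x ^+ 2) * (f1 x - (1 + (1 + c) * x ^+ 2) / (x * (1 + x ^+ 2)) * g) ^+ 2
      + (2 * b - 2 - 3 * c - (c ^+ 2 - 2 * b * c) * t - lam) * g ^+ 2).
      rewrite pw -/(w x) /t /g; field; by rewrite s0 gt_eqF.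
    apply: mulr_ge0; first exact: ltW.
    apply: addr_ge0; apply: mulr_ge0 => //; try exact: sqr_ge0.
    by rewrite ltW// japbase_gt0.
  - apply: derivable_within_continuous => x; rewrite in_itv/= => /andP[ex _].
    have x0 := lt_le_trans e0 ex.
    by have [] := is_deriveB (dG x) (dB x x0).
have BN0 : 0 <= B N.
  rewrite /B mulr_ge0 ?sqr_ge0// mulr_ge0 ?ltW// mulr_gt0 ?invr_gt0//.
  rewrite ltr_wpDr// mulr_ge0 ?sqr_ge0//; lra.
have cG : G x - Bt x @[x --> 0^'+] --> G 0.
  apply: cvg_at_right_filter.
  have -> : G 0 = G 0 - w 0 * (1 + (1 + c) * 0 ^+ 2) * phi 0 ^+ 2 * 0 by rewrite mulr0 subr0.
  apply: cvgB; first exact: has_deriv_cont dG _.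
  apply: cvgM; last exact: cvg_id.
  apply: cvgM; last first.
    by rewrite expr2; under eq_cvg do rewrite expr2; exact: cvgM.
  apply: cvgM; first exact: cont_japow.
  apply: cvgD; first exact: cvg_cst.
  by apply: cvgM; [exact: cvg_cst|exact: exprn_continuous].
apply: (cvgr_to_le cG); near=> e.
have e0 : 0 < e by near: e; exact: nbhs_right_gt.
have eN : e <= N by near: e; exact: nbhs_right_le.
rewrite -BtB//; have := mono e e0 eN; lra.
Unshelve. all: by end_near. Qed.

End gcauchy_calculus.

(** * The generalized Cauchy measure, its Poincare inequality and its generator *)

Section gcauchy_measure.
Context {R : realType}.
Variable b : R.
Hypothesis hb : 1 / 2 < b.
Implicit Types (f g k : R -> R) (x : R).
Local Notation leb := (@lebesgue_measure R).
Local Notation mu := (gcauchy b).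
Local Notation L2 := (Lfun mu 2%:E).
Local Notation w := (japow (- b)).
Local Notation p := (japow (1 - b)).
Local Notation Z := (gcauchy_norm b).
Local Notation L := (gcauchy_gen b).

Lemma Z_gt0 : 0 < Z. Proof. exact: gcauchy_norm_gt0. Qed.

Lemma pw x : p x = (1 + x ^+ 2) * w x.
Proof. by rewrite addrC japowS. Qed.

Lemma pdfE x : gcauchy_pdf b x = w x * Z^-1.
Proof. by rewrite /gcauchy_pdf gcauchy_funE. Qed.

Lemma gcauchy_fin : mu setT \is a fin_num.
Proof. by rewrite gcauchy_setT. Qed.

Let muE A : measurable A -> mu A = (\int[leb]_(x in A) (gcauchy_pdf b x)%:E)%E.
Proof. by []. Qed.

Let mpdf : measurable_fun (setT : set (measurableTypeR R)) (gcauchy_pdf b).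
Proof. exact: measurable_gcauchy_pdf. Qed.

Lemma Rintegral_one (c : R) : \int[mu]_x c = c.
Proof.
have E : fine (gcauchy b setT) = 1 by rewrite gcauchy_setT.
rewrite Rintegral_cst//; exact: etrans (congr1 ( *%R c) E) (mulr1 c).
Qed.

Lemma gcauchy_integrableP f : measurable_fun setT f ->
  mu.-integrable setT (EFin \o f) <->
  leb.-integrable setT (EFin \o (fun x => f x * w x)).
Proof.
move=> mf; have mw : measurable_fun setT w by apply: continuous_measurable; exact: cont_japow.
apply: (iff_trans (@integrable_density _ (measurableTypeR R) R leb mu _ mpdf (gcauchy_pdf_ge0 b) muE f mf)).
split=> [/(integrableZl measurableT Z)|/(integrableZl measurableT Z^-1)];
  apply: eq_integrable => // x _ /=; rewrite -EFinM; congr EFin.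
  by rewrite pdfE; field; rewrite gt_eqF// Z_gt0.
by rewrite pdfE; field; rewrite gt_eqF// Z_gt0.
Qed.

Lemma gcauchy_Rintegral f : leb.-integrable setT (EFin \o (fun x => f x * w x)) ->
  measurable_fun setT f ->
  \int[mu]_x f x = Z^-1 * \int[leb]_x (f x * w x).
Proof.
move=> fi mf.
rewrite (@Rintegral_density _ (measurableTypeR R) R leb mu _ mpdf (gcauchy_pdf_ge0 b) muE f mf).
rewrite -RintegralZl//; apply: eq_Rintegral => x _.
by rewrite pdfE; ring.
Qed.

Lemma ae_gcauchy (P : set R) : {ae leb, forall x, P x} -> {ae mu, forall x, P x}.
Proof.
move=> [A [mA A0 hA]]; exists A; split => //.
rewrite muE//; apply: null_set_integral => //.
by apply/measurable_EFinP; apply: measurable_funTS; exact: mpdf.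
Qed.

Lemma cont_bsupp_bounded f : continuous f -> bsupp f -> exists C : R, forall x, `|f x| <= C.
Proof.
move=> cf [N fN].
have [M [Mr hM]] := compact_bounded (continuous_compact (continuous_subspaceT cf)
  (@segment_compact R (- N) N)).
exists (`|M| + 1) => x; have [xN|/ltW Nx] := leP `|x| N.
  apply: (hM (`|M| + 1)); first by rewrite (le_lt_trans (ler_norm M))// ltrDl.
  by exists x => //=; rewrite in_itv/= -ler_norml.
by rewrite fN// normr0 addr_ge0.
Qed.

Lemma L2_bounded f C : measurable_fun setT f -> (forall x, `|f x| <= C) -> f \in L2.
Proof.
move=> mf fC; apply/L2P; split => //.
have ic : mu.-integrable setT (cst (C ^+ 2)%:E).
  apply/integrableP; split => //; rewrite integral_cst//.
  have E : (`|(C ^+ 2)%:E| * gcauchy b setT < +oo)%E by rewrite gcauchy_setT// mule1 ltry.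
  exact: E.
apply: (le_integrable measurableT _ _ ic).
  by apply/measurable_EFinP; exact: measurable_funX.
move=> x _ /=; rewrite lee_fin normrX [leRHS]ger0_norm ?sqr_ge0//.
by rewrite ler_sqr ?nnegrE// (le_trans _ (fC x)).
Qed.

Lemma L2_cst (c : R) : (fun=> c) \in L2.
Proof. by apply: (@L2_bounded _ `|c|) => //; exact: measurable_cst. Qed.

Lemma L2_cont_bsupp f : continuous f -> bsupp f -> f \in L2.
Proof.
move=> cf sf; have [C fC] := cont_bsupp_bounded cf sf.
by apply: L2_bounded fC; exact: continuous_measurable.
Qed.

Lemma L2_le f g : measurable_fun setT f -> g \in L2 -> (forall x, `|f x| <= `|g x|) -> f \in L2.
Proof.
move=> mf /L2P[mg ig] fg; apply/L2P; split => //.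
apply: (le_integrable measurableT _ _ ig).
  by apply/measurable_EFinP; exact: measurable_funX.
by move=> x _ /=; rewrite lee_fin !normrX ler_sqr ?nnegrE.
Qed.

Lemma sqn_bound f g (C : R) : measurable_fun setT f -> g \in L2 ->
  (forall x, `|f x| <= C * `|g x|) -> sqn mu f <= C ^+ 2 * sqn mu g.
Proof.
move=> mf gL fg.
have gL' := L2Z C gL.
have fg' x : `|f x| <= `|C * g x|.
  by rewrite normrM (le_trans (fg x))// ler_wpM2r// ler_norm.
rewrite -sqnZ//; apply: le_sqn => //; first exact: L2_le fg'.
by move=> x; rewrite -real_normK ?num_real// -[leRHS]real_normK ?num_real// ler_sqr ?nnegrE.
Qed.

Lemma cvg_Rintegral_itv f : leb.-integrable setT (EFin \o f) ->
  \int[leb]_(x in `[- n%:R, n%:R]) f x @[n --> \oo] --> \int[leb]_x f x.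
Proof.
move=> fi; have mf : measurable_fun setT f by have /integrableP[/measurable_EFinP] := fi.
under eq_cvg do rewrite Rintegral_mkcond.
apply: (@Rdominated_cvg _ _ _ leb setT (fun n => f \_ `[- n%:R, n%:R]) f (fun x => `|f x|)) => //.
- by move=> n; apply/(measurable_restrictT _ _).1 => //; exact: measurable_funTS.
- move=> x _; apply: cvg_near_cst; near=> n; rewrite patchE ifT//.
  by rewrite mem_setE in_itv/= -ler_norml; near: n; exact: nbhs_infty_ger.
- exact: integrable_norm fi.
- by move=> n x _; rewrite patchE; case: ifP => //; rewrite normr0.
Unshelve. all: by end_near. Qed.

Definition gap : R := if 3 / 2 < b then 2 * (b - 1) else (b - 1 / 2) ^+ 2.

Lemma gap_gt0 : 0 < gap.
Proof.
by rewrite /gap; case: (ltP (3 / 2) b) => h; [lra|rewrite exprn_gt0// subr_gt0].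
Qed.

(** At t = 1, that is at infinity, the right-hand side equals (1 + c)(2b - 2 - c), which is maximal
    at c = b - 3/2 with value (b - 1/2)^2. For that c the excess over the gap is (9/4 - b^2)(1 - t),
    nonnegative when b <= 3/2. For larger b, c = 0 removes t and leaves 2b - 2. *)
Lemma gap_exponent : exists2 c : R, -1 <= c & forall t : R, 0 <= t <= 1 ->
  gap <= 2 * b - 2 - 3 * c - (c ^+ 2 - 2 * b * c) * t.
Proof.
exists (if 3 / 2 < b then 0 else b - 3 / 2).
  by have := hb; case: (ltP (3 / 2) b) => hb3; lra.
move=> t /andP[t0 t1]; rewrite /gap; case: (ltP (3 / 2) b) => hb3.
  by rewrite expr2; lra.
rewrite -subr_ge0 (_ : _ - _ = (9 / 4 - b ^+ 2) * (1 - t)); last by field.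
rewrite mulr_ge0 ?subr_ge0// (_ : 9 / 4 = (3 / 2) ^+ 2); last by field.
have hb' := hb; by rewrite ler_sqr ?nnegrE; lra.
Qed.

Lemma sqn_sub_cst f (c : R) : f \in L2 ->
  sqn mu (fun x => f x - c) = sqn mu f - 2 * c * (\int[mu]_x f x) + c ^+ 2.
Proof.
move=> fL; rewrite (@eq_sqn _ _ _ mu _ (fun x => f x + (- c) * (fun=> 1) x)); last first.
  by move=> x; rewrite mulr1.
rewrite sqnD//; last exact: L2_cst.
have -> : ip mu f (fun=> 1) = \int[mu]_x f x by apply: eq_Rintegral => x _; rewrite mulr1.
have -> : sqn mu (fun=> 1) = 1.
  rewrite /sqn (@eq_Rintegral _ _ _ mu setT (fun=> 1)) ?Rintegral_one//.
  by move=> x _; rewrite expr1n.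
by ring.
Qed.

(** Stated for functions of class C^1, so as to apply to a cutoff times a weak solution, whose
    derivative is only known to be continuous. *)
Lemma poincare f f1 : has_deriv f f1 -> continuous f1 -> bsupp f ->
  gap * Variance mu f <= \int[mu]_x ((1 + x ^+ 2) * f1 x ^+ 2).
Proof.
move=> df cf1 sf; have cf := has_deriv_cont df; have fL := L2_cont_bsupp cf sf.
have sf1 := bsupp_deriv df sf.
have f0L : (fun x => f x - f 0) \in L2 by apply: L2B => //; exact: L2_cst.
(* The variance is the smallest square distance to a constant, hence at most the one to f 0. *)
apply: (@le_trans _ _ (gap * sqn mu (fun x => f x - f 0))).
  rewrite ler_wpM2l ?(ltW gap_gt0)// sqn_sub_cst// /Variance -/(sqn mu f).
  rewrite -subr_ge0 (_ : _ - _ = (\int[mu]_x f x - f 0) ^+ 2) ?sqr_ge0//.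
  by ring.
have cs : continuous (fun x : R => 1 + x ^+ 2).
  by move=> x; apply: cvgD; [exact: cvg_cst|exact: exprn_continuous].
have c2 (h : R -> R) : continuous h -> continuous (fun x => h x ^+ 2).
  by move=> ch x; rewrite (_ : (fun x => _) = fun x => h x * h x);
    [exact: (cvgM (ch x) (ch x))|apply/funext => y; rewrite expr2].
have cE : continuous (fun x => (1 + x ^+ 2) * f1 x ^+ 2).
  by move=> x; exact: (cvgM (cs x) (c2 _ cf1 x)).
have mE := continuous_measurable cE.
have sE : bsupp (fun x => (1 + x ^+ 2) * f1 x ^+ 2).
  by case: sf1 => N hN; exists N => x /hN ->; rewrite expr0n mulr0.
have cw := @cont_japow R (- b).
have iE : leb.-integrable setT (EFin \o (fun x => (1 + x ^+ 2) * f1 x ^+ 2 * w x)).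
  by apply: bsupp_integrable; [move=> x; exact: (cvgM (cE x) (cw x))|exact: bsuppMl].
have [m0 i0] := (L2P mu _).1 f0L.
have m02 : measurable_fun setT (fun x => (f x - f 0) ^+ 2) by exact: measurable_funX.
have i0' := (gcauchy_integrableP m02).1 i0.
rewrite /sqn !gcauchy_Rintegral// mulrCA ler_pM2l ?invr_gt0 ?Z_gt0// -RintegralZl//.
have i1 := integrableZl measurableT gap i0'.
(* As f - f 0 need not vanish at infinity, the inequality is established on [-n, n] through an
   antiderivative G of the difference of the integrands, and n is then sent to infinity. *)
have key (n : nat) : 0 <= \int[leb]_(x in `[- n%:R, n%:R])
    (((1 + x ^+ 2) * f1 x ^+ 2 * w x) - gap * ((f x - f 0) ^+ 2 * w x)).
  pose F x := p x * f1 x ^+ 2 - gap * (w x * (f x - f 0) ^+ 2).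
  have cF : continuous F.
    move=> x; apply: cvgB.
      by apply: cvgM; [exact: cont_japow|exact: c2].
    apply: cvgM; first exact: cvg_cst.
    apply: cvgM; first exact: cont_japow.
    by apply: (c2 (fun x => f x - f 0)) => y; apply: cvgB; [exact: cf|exact: cvg_cst].
  have [G dG] := antiderivative cF.
  rewrite (@eq_Rintegral _ _ _ leb _ F); last by move=> x _; rewrite /F pw; ring.
  rewrite (FTC2_itv dG cF); last by rewrite (@le_trans _ _ 0)// oppr_le0.
  have [c c1 hgap] := gap_exponent.
  have GN : G 0 <= G n%:R by apply: (hardy_monotone c1 hgap df dG).
  (* The reflection x -> -x preserves w and p and carries the half-line estimate over to [-n, 0]. *)
  have df' : has_deriv (fun x => f (- x)) (fun x => - f1 (- x)).
    apply: has_deriv_ext (has_deriv_comp df (has_derivN has_deriv_id)) _ => x.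
    by rewrite mulrN1.
  have dG' : has_deriv (fun x => - G (- x)) (fun x => p x * (- f1 (- x)) ^+ 2
     - gap * (w x * (f (- x) - f (- 0)) ^+ 2)).
    apply: has_deriv_ext (has_derivN (has_deriv_comp dG (has_derivN has_deriv_id))) _ => x.
    by rewrite /F /japow !sqrrN oppr0 mulrN1 opprK.
  have := hardy_monotone c1 hgap df' dG' (ler0n _ n).
  rewrite oppr0 lerN2; lra.
rewrite -subr_ge0 -RintegralB//; apply: (cvgr_to_ge (cvg_Rintegral_itv _) (nearW _ key)).
exact: (integrableB measurableT iE i1).
Qed.

Lemma genE f f1 f2 x : has_deriv f f1 -> has_deriv f1 f2 ->
  L f x = (1 + x ^+ 2) * f2 x + 2 * (1 - b) * x * f1 x.
Proof.
move=> d1 d2; rewrite /gcauchy_gen derive1nS derive1n1.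
by rewrite (has_derivE d1) (has_derivE d2).
Qed.

Lemma has_deriv_flux f f1 f2 : has_deriv f f1 -> has_deriv f1 f2 ->
  has_deriv (fun x => p x * f1 x) (fun x => w x * L f x).
Proof.
move=> d1 d2; apply: has_deriv_ext (has_derivM (has_deriv_japow (1 - b)) d2) _ => x.
rewrite (genE _ d1 d2) pw (_ : 1 - b - 1 = - b); last by ring.
by ring.
Qed.

Lemma smooth_gen f : smooth f -> smooth (L f).
Proof.
move=> sf; have s1 := smooth_derive1 sf; have s2 := smooth_derive1 s1.
rewrite (_ : L f = fun x => (1 + x ^+ 2) * f^`()^`()%classic x
   + (2 * (1 - b) * x) * f^`()%classic x); last first.
  by apply/funext => x; rewrite (genE x (smooth_has_deriv sf) (smooth_has_deriv s1)).
have sA : smooth (fun x => 1 + x ^+ 2 : R).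
  by apply: smoothD; [exact: smooth_cst|apply: smoothX; exact: smooth_id].
have sB : smooth (fun x : R => 2 * (1 - b) * x) by apply: smoothZ; exact: smooth_id.
exact: (smoothD (smoothM sA s2) (smoothM sB s1)).
Qed.

Lemma bsupp_gen f : smooth f -> bsupp f -> bsupp (L f).
Proof.
move=> sf bf; have s1 := smooth_derive1 sf.
have [N1 h1] := bsupp_deriv (smooth_has_deriv sf) bf.
have [N2 h2] := bsupp_deriv (smooth_has_deriv s1) (bsupp_deriv (smooth_has_deriv sf) bf).
exists (Num.max N1 N2) => x; rewrite ge_max => /andP[x1 x2].
by rewrite (genE x (smooth_has_deriv sf) (smooth_has_deriv s1)) h1// h2// !mulr0 addr0.
Qed.

Lemma testfun_L2 f : testfun f -> f \in L2.
Proof. by move=> tf; apply: L2_cont_bsupp; [exact: continuous_testfun|case: tf]. Qed.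

Lemma testfun_gen f : testfun f -> testfun (L f).
Proof. by move=> [sf bf]; split; [exact: smooth_gen|exact: bsupp_gen]. Qed.

Lemma testfun_gen_L2 f : testfun f -> L f \in L2.
Proof. by move=> tf; apply: testfun_L2; exact: testfun_gen. Qed.

(** Integration by parts of (p f')' = w L f. The bounded support of f disposes of the boundary
    terms, so g may be the constant 1, which yields [gen_mean0]. *)
Lemma ip_gen f g g1 : testfun f -> has_deriv g g1 -> continuous g1 ->
  \int[mu]_x (L f x * g x) = - \int[mu]_x ((1 + x ^+ 2) * (f^`()%classic x * g1 x)).
Proof.
move=> tf dg cg1; have [sf bf] := tf.
have d1 := smooth_has_deriv sf; have s1 := smooth_derive1 sf.
have d2 := smooth_has_deriv s1; have tL := testfun_gen tf.
have cg := has_deriv_cont dg; have cw := @cont_japow R (- b).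
have cL := continuous_testfun tL; have c1 := smooth_cont s1.
have cs : continuous (fun x : R => 1 + x ^+ 2).
  by move=> x; apply: cvgD; [exact: cvg_cst|exact: exprn_continuous].
have b1 : bsupp f^`()%classic by exact: bsupp_deriv bf.
have ci1 : continuous (fun x => L f x * g x) by move=> x; exact: (cvgM (cL x) (cg x)).
have ci2 : continuous (fun x => (1 + x ^+ 2) * (f^`()%classic x * g1 x)).
  by move=> x; exact: (cvgM (cs x) (cvgM (c1 x) (cg1 x))).
have i1 : leb.-integrable setT (EFin \o (fun x => L f x * g x * w x)).
  apply: bsupp_integrable; first by move=> x; exact: (cvgM (ci1 x) (cw x)).
  by do 2 apply: bsuppMl; case: tL.
have i2 : leb.-integrable setT (EFin \o
    (fun x => (1 + x ^+ 2) * (f^`()%classic x * g1 x) * w x)).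
  apply: bsupp_integrable; first by move=> x; exact: (cvgM (ci2 x) (cw x)).
  by apply: bsuppMl; apply: bsuppMr; exact: bsuppMl.
rewrite !gcauchy_Rintegral//; try exact: continuous_measurable.
rewrite -mulrN; congr (_ * _).
have dF := has_deriv_flux d1 d2.
have cwL : continuous (fun x => w x * L f x) by move=> x; exact: (cvgM (cw x) (cL x)).
have h := Rintegral_ibp dg cg1 dF cwL (bsuppMr (fun x => p x) b1).
rewrite (@eq_Rintegral _ _ _ leb setT (fun x => g x * (w x * L f x))); last first.
  by move=> x _; ring.
rewrite h; congr (- _); apply: eq_Rintegral => x _.
by rewrite pw; ring.
Qed.

Lemma gen_mean0 f : testfun f -> \int[mu]_x L f x = 0.
Proof.
move=> tf.
have c0 : continuous (fun _ : R => 0 : R) by move=> x; exact: cvg_cst.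
have := ip_gen tf (has_deriv_cst 1) c0.
rewrite (@eq_Rintegral _ _ _ mu setT (L f)); last by move=> x _; rewrite mulr1.
move=> ->; rewrite (@eq_Rintegral _ _ _ mu setT (fun=> 0)) ?Rintegral_one ?oppr0//.
by move=> x _; rewrite !mulr0.
Qed.

(* Testing -Lf - tf against the combination s f0 - t m of the centered part
   f0 = f - m and of the constants, with s = lam - t. *)
Lemma gen_lower_bound (lam t c : R) f : testfun f ->
  lam * Variance mu f <= \int[mu]_x ((1 + x ^+ 2) * f^`()%classic x ^+ 2) ->
  t < lam -> c ^+ 2 <= (lam - t) ^+ 2 -> c ^+ 2 <= t ^+ 2 ->
  c ^+ 2 * sqn mu f <= sqn mu (fun x => - L f x - t * f x).
Proof.
move=> tf hP tlam cs ct.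
have fL := testfun_L2 tf; have LL := testfun_gen_L2 tf.
pose m := \int[mu]_x f x; pose V := Variance mu f.
pose E := \int[mu]_x ((1 + x ^+ 2) * f^`()%classic x ^+ 2).
have one : (fun=> 1 : R) \in L2 by exact: L2_cst.
have f0L : (fun x => f x - m) \in L2 by apply: L2B => //; exact: L2_cst.
pose u x := - L f x - t * f x.
have NLL : (fun x => - L f x) \in L2.
  by rewrite (_ : (fun x => _) = fun x => -1 * L f x);
    [exact: L2Z|apply/funext => x; rewrite mulN1r].
have uL : u \in L2 by apply: L2B => //; exact: L2Z.
have ip1 g : ip mu g (fun=> 1) = \int[mu]_x g x by apply: eq_Rintegral => x _; rewrite mulr1.
have ipLf : ip mu (L f) f = - E.
  rewrite /ip (ip_gen tf (smooth_has_deriv tf.1) (smooth_cont (smooth_derive1 tf.1))).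
  by congr (- _); apply: eq_Rintegral => x _; rewrite expr2.
have ipNL g : g \in L2 -> ip mu (fun x => - L f x) g = - ip mu (L f) g.
  move=> gL; rewrite -mulN1r -ipZl//; apply: eq_ip => // x; by rewrite mulN1r.
have u1 : ip mu u (fun=> 1) = - t * m.
  by rewrite ipBl ?ipZl ?ipNL ?ip1 ?gen_mean0 ?oppr0 ?sub0r ?mulNr//; exact: L2Z.
have uf : ip mu u f = E - t * sqn mu f.
  by rewrite ipBl ?ipZl ?ipNL ?ipLf ?opprK ?ip_sqn//; exact: L2Z.
have uf0 : ip mu u (fun x => f x - m) = E - t * V.
  rewrite ipC (_ : ip mu _ _ = ip mu f u - m * ip mu (fun=> 1) u); last first.
    rewrite -ipZl// -ipBl//; last exact: L2Z.
    by apply: eq_ip => // x; rewrite mulr1.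
  by rewrite !(ipC mu _ u) uf u1 /V /Variance -/(sqn mu f) -/m; ring.
have f00 : ip mu (fun x => f x - m) (fun=> 1) = 0.
  rewrite ip1 RintegralB ?Rintegral_one//; last 2 first.
  - by apply: L2_integrable => //; exact: gcauchy_fin.
  - by apply: L2_integrable => //; [exact: gcauchy_fin|exact: L2_cst].
  by rewrite -/m subrr.
have qf0 : sqn mu (fun x => f x - m) = V.
  by rewrite sqn_sub_cst// -/m /V /Variance -/(sqn mu f) -/m; ring.
have q1 : sqn mu (fun=> 1) = 1.
  rewrite /sqn (@eq_Rintegral _ _ _ mu setT (fun=> 1)) ?Rintegral_one//.
  by move=> x _; rewrite expr1n.
(* With u = -L f - t f, expanding |u - s f0 + t m|^2 >= 0 gives |u|^2 >= 2 s (E - t V) - s^2 V + t^2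
   m^2, which is at least s^2 V + t^2 m^2 because E >= lam V. *)
pose s := lam - t.
have := sqn_ge0 mu (fun x => (u x + (- s) * (f x - m)) + (t * m) * 1).
have f0L' := L2Z (- s) f0L.
rewrite (sqnD (t * m) (L2D uL f0L') one) (sqnD (- s) uL f0L) (ipDl uL f0L' one).
rewrite (ipZl (- s) f0L one) uf0 u1 f00 qf0 q1.
have V0 : 0 <= V by rewrite -qf0 sqn_ge0.
have s0 : 0 <= s by rewrite subr_ge0 ltW.
have qf : sqn mu f = V + m ^+ 2 by rewrite /V /Variance -/(sqn mu f) -/m subrK.
rewrite qf => H.
have h1 : 0 <= 2 * s * (E - t * V - s * V).
  rewrite !mulr_ge0// (_ : E - t * V - s * V = E - lam * V) ?subr_ge0//; last by rewrite /s; ring.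
have h2 : c ^+ 2 * V <= s ^+ 2 * V by rewrite ler_wpM2r.
have h3 : c ^+ 2 * m ^+ 2 <= t ^+ 2 * m ^+ 2 by rewrite ler_wpM2r ?sqr_ge0.
rewrite mulrDr -/u; move: H h1 h2 h3; move: (sqn mu u) (E) (V) (c ^+ 2) => q e v cc.
rewrite !expr2 => *; lra.
Qed.

End gcauchy_measure.

(** * Cutoffs and Weyl sequences *)

Section cutoff.
Context {R : realType}.
Implicit Types (f g : R -> R) (x : R).

Definition bump (y : R) : R := step (2 - y) * step (2 + y).

Lemma smooth_bump : smooth bump.
Proof.
apply: smoothM.
  apply: (@smooth_comp _ step (fun y => 2 - y)); first exact: smooth_step.
  by apply: smoothB; [exact: smooth_cst|exact: smooth_id].
apply: (@smooth_comp _ step (fun y => 2 + y)); first exact: smooth_step.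
by apply: smoothD; [exact: smooth_cst|exact: smooth_id].
Qed.

Lemma bump_eq1 y : `|y| <= 1 -> bump y = 1.
Proof. by rewrite ler_norml => /andP[y1 y2]; rewrite /bump !step_eq1 ?mulr1//; lra. Qed.

Lemma bump_eq0 y : 2 <= `|y| -> bump y = 0.
Proof.
rewrite ler_normr => /orP[y2|y2]; rewrite /bump.
  by rewrite step_eq0 ?mul0r//; lra.
by rewrite [X in _ * X]step_eq0 ?mulr0//; lra.
Qed.

Lemma bump_ge0 y : 0 <= bump y.
Proof. by rewrite mulr_ge0// step_ge0. Qed.

Lemma bump_le1 y : bump y <= 1.
Proof. by rewrite mulr_ile1 ?step_ge0 ?step_le1. Qed.

Definition logjap x : R := ln (1 + x ^+ 2).

Lemma logjap_ge0 x : 0 <= logjap x.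
Proof. by rewrite ln_ge0// lerDl sqr_ge0. Qed.

Lemma has_deriv_logjap : has_deriv logjap (fun x => 2 * x / (1 + x ^+ 2)).
Proof.
move=> x; have dl := @is_derive1_ln R (1 + x ^+ 2) (japbase_gt0 x).
have dC := @is_derive1_comp R (@ln R) (fun y => 1 + y ^+ 2) x _ _ dl (has_deriv_japbase x).
by apply: (is_derive_eq dC); rewrite mulrC.
Qed.

Lemma smooth_logjap : smooth logjap.
Proof.
apply: has_deriv_smooth has_deriv_logjap _.
apply: (@smoothM _ (fun x => 2 * x) (fun x => (1 + x ^+ 2)^-1)).
  by apply: smoothZ; exact: smooth_id.
apply: (@smoothV _ (fun x => 1 + x ^+ 2)); first by move=> x; rewrite gt_eqF// japbase_gt0.
by apply: smoothD; [exact: smooth_cst|apply: smoothX; exact: smooth_id].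
Qed.

(* Cutoffs [bump (ln (1+x^2) / (n+1))]: the metric of the Dirichlet form is
   dx^2/(1+x^2), so that ln (1+x^2) is Lipschitz for it. *)
Lemma exists_cutoff (b : R) : exists (C : R) (ze ze1 : nat -> R -> R), 0 <= C /\ forall n,
  [/\ testfun (ze n), has_deriv (ze n) (ze1 n), (forall x, 0 <= ze n x <= 1) &
   [/\ forall x, `|(1 + x ^+ 2) * ze1 n x| <= C * n.+1%:R^-1 * `|x|,
       forall x, (1 + x ^+ 2) * ze1 n x ^+ 2 <= (C * n.+1%:R^-1) ^+ 2,
       forall x, `|gcauchy_gen b (ze n) x| <= C * n.+1%:R^-1 &
       forall x, ze m x @[m --> \oo] --> (1 : R)]].
Proof.
have sb := smooth_bump; have d1 := smooth_has_deriv sb.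
have s1 := smooth_derive1 sb; have d2 := smooth_has_deriv s1.
have bb : bsupp bump by exists 2 => y; exact: bump_eq0.
have bb1 := bsupp_deriv d1 bb; have bb2 := bsupp_deriv d2 bb1.
have [K1 hK1] := cont_bsupp_bounded (smooth_cont s1) bb1.
have [K2 hK2] := cont_bsupp_bounded (smooth_cont (smooth_derive1 s1)) bb2.
pose K := K1 + K2.
have K1_ge0 : 0 <= K1 by apply: le_trans (hK1 0).
have K2_ge0 : 0 <= K2 by apply: le_trans (hK2 0).
have K0 : 0 <= K by rewrite addr_ge0.
(* In L (ze n), the term in bump'' contributes at most 4 K / (n+1) and the term in bump' at most (2
   + 4 |1 - b|) K / (n+1). The two gradient bounds ask only for 2 K. *)
pose C := (6 + 4 * `|1 - b|) * K.
have C2K : 2 * K <= C by rewrite ler_wpM2r//; have := normr_ge0 (1 - b); lra.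
have C0 : 0 <= C by apply: le_trans C2K; rewrite mulr_ge0.
pose c n : R := n.+1%:R^-1.
have c0 n : 0 < c n by rewrite invr_gt0.
have c1 n : c n <= 1 by rewrite invf_le1// ler1n.
pose u n x := c n * logjap x.
have du n : has_deriv (u n) (fun x => c n * (2 * x / (1 + x ^+ 2))).
  by apply: has_derivZ; exact: has_deriv_logjap.
have u0 n x : 0 <= u n x by apply: mulr_ge0; [exact: ltW|exact: logjap_ge0].
pose ze n x := bump (u n x).
pose ze1 n x := bump^`()%classic (u n x) * (c n * (2 * x / (1 + x ^+ 2))).
have dze n : has_deriv (ze n) (ze1 n) := has_deriv_comp d1 (du n).
have bn0 x : 1 + x ^+ 2 != 0 by rewrite gt_eqF// japbase_gt0.
have dq : has_deriv (fun x => 2 * x / (1 + x ^+ 2))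
    (fun x => 2 / (1 + x ^+ 2) - 4 * x ^+ 2 / (1 + x ^+ 2) ^+ 2).
  apply: has_deriv_ext (has_derivM (has_derivZ 2 has_deriv_id) (has_derivV bn0 has_deriv_japbase)) _ => x.
  by field; rewrite bn0.
pose ze2 n x := bump^`()^`()%classic (u n x) * (c n * (2 * x / (1 + x ^+ 2))) * (c n * (2 * x / (1 + x ^+ 2)))
  + bump^`()%classic (u n x) * (c n * (2 / (1 + x ^+ 2) - 4 * x ^+ 2 / (1 + x ^+ 2) ^+ 2)).
have dze1 n : has_deriv (ze1 n) (ze2 n).
  exact: has_derivM (has_deriv_comp d2 (du n)) (has_derivZ (c n) dq).
pose tau x := x ^+ 2 / (1 + x ^+ 2).
have tau0 x : 0 <= tau x by rewrite divr_ge0 ?sqr_ge0// ltW// japbase_gt0.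
have tau1 x : tau x <= 1 by rewrite ler_pdivrMr ?japbase_gt0// mul1r lerDr.
have h1 n x : (1 + x ^+ 2) * ze1 n x = bump^`()%classic (u n x) * (c n * (2 * x)).
  by rewrite /ze1; field; rewrite bn0.
have hK1K y : `|bump^`()%classic y| <= K by rewrite (le_trans (hK1 y))// lerDl.
have hK2K y : `|bump^`()^`()%classic y| <= K by rewrite (le_trans (hK2 y))// lerDr.
exists C, ze, ze1; split; first exact: C0.
move=> n; split; [|exact: dze| |].
- split.
    apply: (@smooth_comp _ bump (u n)); first exact: sb.
    by apply: smoothZ; exact: smooth_logjap.
  (* For |x| beyond this radius, ln (1 + x^2) >= 2 (n+1), so the argument of [bump] is at least
     2. *)
  exists (expR (2 * n.+1%:R)) => x Nx; apply: bump_eq0.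
  have lx : 2 * n.+1%:R <= logjap x.
    rewrite -[X in X <= _]expRK /logjap ler_ln ?posrE ?expR_gt0 ?japbase_gt0//.
    have N1 : 1 <= expR (2 * n.+1%:R) :> R by rewrite -expR0 ler_expR mulr_ge0.
    apply: (le_trans Nx); rewrite -[x ^+ 2]real_normK ?num_real//.
    have x1 : 1 <= `|x| by apply: le_trans Nx.
    by rewrite expr2; apply: ler_wpDl => //; rewrite ler_peMl.
  rewrite (ger0_norm (u0 n x)).
  by rewrite /u /c mulrC ler_pdivlMr.
- by move=> x; rewrite bump_ge0 bump_le1.
split.
- move=> x; rewrite h1 !normrM (ger0_norm (ltW (c0 n))) -/(c n).
  have a2 : `|2 : R| = 2 by rewrite ger0_norm.
  rewrite a2; have := hK1K (u n x); have := normr_ge0 x; have := c0 n.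
  move: `|bump^`()%classic (u n x)| `|x| (c n) => y z cc cc0 z0 yK.
  rewrite (_ : y * (cc * (2 * z)) = 2 * y * (cc * z)); last by ring.
  rewrite -(mulrA C) ler_wpM2r//; first by rewrite mulr_ge0// ltW.
  by apply: le_trans C2K; rewrite ler_wpM2l.
- move=> x; rewrite (_ : _ * _ ^+ 2 = (bump^`()%classic (u n x) * (2 * c n)) ^+ 2 * tau x); last first.
    by rewrite /ze1 /tau; field; rewrite bn0.
  apply: (@le_trans _ _ ((bump^`()%classic (u n x) * (2 * c n)) ^+ 2)).
    by rewrite ler_piMr ?sqr_ge0.
  rewrite -real_normK ?num_real// ler_sqr ?nnegrE//; last by rewrite mulr_ge0// ltW.
  rewrite normrM (ger0_norm (_ : 0 <= 2 * c n)); last by rewrite mulr_ge0// ltW.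
  rewrite mulrA -/(c n) ler_wpM2r ?(ltW (c0 n))//.
  by apply: le_trans C2K; rewrite mulrC ler_wpM2l.
- move=> x; rewrite (genE b x (dze n) (dze1 n)).
  rewrite (_ : _ + _ = bump^`()^`()%classic (u n x) * (c n * c n * (4 * tau x))
     + bump^`()%classic (u n x) * (c n * (2 - 4 * tau x + 4 * (1 - b) * tau x))); last first.
    by rewrite /ze2 /ze1 /tau; field; rewrite bn0.
  move: (tau x) (tau0 x) (tau1 x) => y y0 y1.
  apply: le_trans (ler_normD _ _) _; rewrite !normrM.
  rewrite (ger0_norm (ltW (c0 n))) (ger0_norm y0) (ger0_norm (_ : 0 <= 4))//.
  have t1 : `|2 - 4 * y + 4 * (1 - b) * y| <= 2 + 4 * `|1 - b|.
    apply: le_trans (ler_normD _ _) _; apply: lerD.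
      by rewrite ler_norml; lra.
    rewrite !normrM (ger0_norm y0) (ger0_norm (_ : 0 <= 4))// ler_piMr//.
  rewrite /C -/(c n) (_ : _ * K * c n = K * (c n * 4) + K * (c n * (2 + 4 * `|1 - b|))); last by ring.
  have cn0 := ltW (c0 n).
  have y4 : 0 <= 4 * y by exact: mulr_ge0.
  apply: lerD; apply: ler_pM; [exact: normr_ge0| |exact: hK2K| |exact: normr_ge0| |exact: hK1K|].
  + by apply: mulr_ge0 => //; exact: mulr_ge0.
  + rewrite -mulrA; apply: ler_wpM2l => //.
    rewrite -[leRHS]mul1r; apply: ler_pM => //.
    by rewrite -[leRHS]mulr1 ler_wpM2l.
  + exact: mulr_ge0.
  + by rewrite ler_wpM2l.
- move=> x; apply: cvg_near_cst; near=> m; apply: bump_eq1.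
  rewrite (ger0_norm (u0 m x)).
  rewrite /u /c ler_pdivrMl// mulr1.
  have : logjap x <= m%:R by near: m; exact: nbhs_infty_ger.
  by move=> h; apply: le_trans h _; rewrite ler_nat.
Unshelve. all: by end_near. Qed.

End cutoff.

(** * Truncation in the graph norm *)

Section graph.
Context {R : realType}.
Variable b : R.
Hypothesis hb : 1 / 2 < b.
Implicit Types (f g k : R -> R) (x : R).
Local Notation mu := (gcauchy b).
Local Notation L2 := (Lfun mu 2%:E).
Local Notation L := (gcauchy_gen b).

Lemma cvg_sqn_cutoff (ze : nat -> R -> R) g : (forall n, measurable_fun setT (ze n)) ->
  (forall n x, 0 <= ze n x <= 1) -> (forall x, ze n x @[n --> \oo] --> (1 : R)) ->
  g \in L2 -> sqn mu (fun x => (ze n x - 1) * g x) @[n --> \oo] --> (0 : R).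
Proof.
move=> mze ze01 zel gL; have [mg ig] := (L2P mu g).1 gL.
have -> : (0 : R) = \int[mu]_x (0 : R) by rewrite Rintegral_one.
apply: (@Rdominated_cvg _ (measurableTypeR R) _ mu setT _ _ (fun x => g x ^+ 2)) => //.
- move=> n; apply: measurable_funX; apply: measurable_funM => //.
  by apply: measurable_funB => //; exact: mze.
- move=> x _; rewrite (_ : 0 = ((1 - 1) * g x) ^+ 2); last by rewrite subrr mul0r expr0n.
  have h : (ze n x - 1) * g x @[n --> \oo] --> (1 - 1) * g x.
    by apply: cvgMr_tmp; apply: cvgB => //; exact: cvg_cst.
  exact: (cvg_comp _ _ h (@exprn_continuous _ 2 _)).
- move=> n x _; rewrite (ger0_norm (sqr_ge0 _)) exprMn.
  rewrite ler_piMl ?sqr_ge0// -real_normK ?num_real// exprn_ile1//.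
  by have /andP[z0 z1] := ze01 n x; rewrite ler_norml; lra.
Qed.

Lemma gen_mul f g f1 f2 g1 g2 x : has_deriv f f1 -> has_deriv f1 f2 ->
  has_deriv g g1 -> has_deriv g1 g2 ->
  L (fun y => f y * g y) x = f x * L g x + g x * L f x + 2 * ((1 + x ^+ 2) * f1 x) * g1 x.
Proof.
move=> df df1 dg dg1.
rewrite (genE _ _ (has_derivM df dg) (has_derivD (has_derivM df1 dg) (has_derivM df dg1))).
by rewrite (genE _ _ df df1) (genE _ _ dg dg1); ring.
Qed.

(** In L (ze g) - ze L g the cross term 2 (1 + x^2) ze' g' is at most 2 C / (n+1) times |x g'|. The
    growth condition on g' turns this into a multiple of |g|, so the whole commutator is at most C
    (1 + 2 M) / (n+1) times |g|. *)
Lemma graph_approx g (M : R) : smooth g -> g \in L2 -> L g \in L2 ->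
  (forall x, `|x * g^`()%classic x| <= M * `|g x|) ->
  exists u : nat -> R -> R, [/\ forall n, testfun (u n),
    sqn mu (fun x => u n x - g x) @[n --> \oo] --> (0 : R) &
    sqn mu (fun x => L (u n) x - L g x) @[n --> \oo] --> (0 : R)].
Proof.
move=> sg gL LgL hM; have [C [ze [ze1 [C0 hze]]]] := exists_cutoff b.
have tze n : testfun (ze n) by have [] := hze n.
have dze n : has_deriv (ze n) (ze1 n) by have [] := hze n.
have ze01 n x : 0 <= ze n x <= 1 by have [_ _ /(_ x)] := hze n.
have zel x : ze n x @[n --> \oo] --> (1 : R) by have [_ _ _ [_ _ _ /(_ x)]] := hze 0.
have mze n : measurable_fun setT (ze n) by apply: continuous_measurable; exact: continuous_testfun.
have dg := smooth_has_deriv sg; have sg1 := smooth_derive1 sg.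
have dg1 := smooth_has_deriv sg1.
have mg : measurable_fun setT g by exact: L2_measurable gL.
pose c n : R := n.+1%:R^-1.
have tu n : testfun (fun x => ze n x * g x).
  by have [s1 b1] := tze n; split; [exact: smoothM|exact: bsuppMl].
exists (fun n x => ze n x * g x); split => //.
  have := cvg_sqn_cutoff mze ze01 zel gL; apply: cvg_trans; apply: near_eq_cvg.
  by near=> n; apply: eq_sqn => x; rewrite mulrBl mul1r.
have LzL n : (fun x => (ze n x - 1) * L g x) \in L2.
  apply: (L2_le _ LgL).
    apply: measurable_funM; last exact: L2_measurable LgL.
    by apply: measurable_funB => //; exact: mze.
  move=> x; rewrite normrM ler_piMl//.
  by have /andP[z0 z1] := ze01 n x; rewrite ler_norml; lra.
have LuL n := testfun_gen_L2 hb (tu n).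
pose r n x := (L (fun y => ze n y * g y) x - L g x) - (ze n x - 1) * L g x.
have rL n : r n \in L2 by apply: L2B => //; exact: L2B.
have rE n x : `|r n x| <= (C * c n * (1 + 2 * M)) * `|g x|.
  have [_ _ _ [h1 _ h3 _]] := hze n.
  have d2 := smooth_has_deriv (smooth_derive1 (tze n).1).
  have d1 := smooth_has_deriv (tze n).1.
  rewrite /r (gen_mul x d1 d2 dg dg1) (has_derivE (dze n)).
  rewrite (_ : _ - _ = g x * L (ze n) x + 2 * ((1 + x ^+ 2) * ze1 n x) * g^`()%classic x); last by ring.
  apply: le_trans (ler_normD _ _) _; rewrite [leRHS](_ : _ =
    C * c n * `|g x| + C * c n * (2 * M) * `|g x|); last by ring.
  apply: lerD.
    by rewrite normrM mulrC ler_wpM2r// h3.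
  rewrite -mulrA normrM (ger0_norm (_ : 0 <= 2))// normrM.
  have h1x := h1 x; have hMx := hM x; rewrite normrM in hMx.
  apply: (@le_trans _ _ (2 * ((C * c n * `|x|) * `|g^`()%classic x|))).
    by rewrite ler_wpM2l// ler_wpM2r.
  have Cc : 0 <= C * c n by rewrite mulr_ge0// invr_ge0.
  have := ler_wpM2l Cc hMx.
  by move: (C * c n) `|x| `|g x| `|_| => *; lra.
have q0 : (2 * sqn mu (fun x => (ze n x - 1) * L g x) + 2 * ((C * c n * (1 + 2 * M)) ^+ 2 * sqn mu g))
    @[n --> \oo] --> (0 : R).
  rewrite [X in _ --> X](_ : 0 = 2 * 0 + 2 * ((C * 0 * (1 + 2 * M)) ^+ 2 * sqn mu g)); last first.
    by rewrite !(mulr0, mul0r) expr0n mul0r mulr0 addr0.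
  apply: cvgD; first by apply: cvgMl_tmp; exact: cvg_sqn_cutoff.
  apply: cvgMl_tmp; apply: cvgMr_tmp.
  have h : C * c n * (1 + 2 * M) @[n --> \oo] --> C * 0 * (1 + 2 * M).
    by apply: cvgMr_tmp; apply: cvgMl_tmp; exact: cvg_harmonic.
  exact: (cvg_comp _ _ h (@exprn_continuous _ 2 _)).
apply: (squeeze_cvgr _ (cvg_cst 0) q0); near=> n; rewrite sqn_ge0/=.
rewrite (@eq_sqn _ _ _ mu _ (fun x => (ze n x - 1) * L g x + r n x)); last first.
  by move=> x; rewrite /r; ring.
apply: le_trans (sqnD_le (LzL n) (rL n)) _; rewrite lerD2l ler_wpM2l//.
exact: (sqn_bound (L2_measurable (rL n)) gL (rE n)).
Unshelve. all: by end_near. Qed.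

(** The factor 16 pays for the truncation: the squared residual of u n is at most three times eps/16
    |g|^2, while |g|^2 <= 4 |u n|^2 as soon as |u n - g|^2 < |g|^2 / 8. *)
Lemma weyl_approx g (M eps : R) : smooth g -> g \in L2 -> L g \in L2 ->
  (forall x, `|x * g^`()%classic x| <= M * `|g x|) -> 0 < sqn mu g -> 0 < eps ->
  sqn mu (fun x => - L g x - gap b * g x) <= eps / 16 * sqn mu g ->
  exists f, [/\ testfun f, 0 < sqn mu f &
    sqn mu (fun x => - L f x - gap b * f x) <= eps * sqn mu f].
Proof.
move=> sg gL LgL hM g0 e0 hr.
have [u [tu u1 u2]] := graph_approx sg gL LgL hM.
pose G := gap b.
have q0 : (4 * sqn mu (fun x => L (u n) x - L g x) + 4 * G ^+ 2 * sqn mu (fun x => u n x - g x))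
    @[n --> \oo] --> (0 : R).
  rewrite [X in _ --> X](_ : 0 = 4 * 0 + 4 * G ^+ 2 * 0); last by rewrite !mulr0 addr0.
  by apply: cvgD; apply: cvgMl_tmp.
have e1 : 0 < eps / 16 * sqn mu g by rewrite mulr_gt0// divr_gt0.
have e2 : 0 < sqn mu g / 8 by rewrite divr_gt0.
near \oo => n.
have h1 : 4 * sqn mu (fun x => L (u n) x - L g x) + 4 * G ^+ 2 * sqn mu (fun x => u n x - g x)
   < eps / 16 * sqn mu g by near: n; exact: (cvgr_lt _ q0).
have h2 : sqn mu (fun x => u n x - g x) < sqn mu g / 8 by near: n; exact: (cvgr_lt _ u1).
have uL := testfun_L2 hb (tu n); have LuL := testfun_gen_L2 hb (tu n).
have dL : (fun x => u n x - g x) \in L2 by exact: L2B.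
have dLL : (fun x => L (u n) x - L g x) \in L2 by exact: L2B.
have h3 : sqn mu g <= 2 * sqn mu (u n) + 2 * sqn mu (fun x => u n x - g x).
  have dL' : (fun x => g x - u n x) \in L2 by exact: L2B.
  have := sqnD_le uL dL'.
  rewrite (@eq_sqn _ _ _ mu (fun x => u n x + (g x - u n x)) g); last by move=> x; ring.
  by rewrite [X in 2 * _ + 2 * X]sqnBC.
have rL : (fun x => - L g x - G * g x) \in L2.
  apply: L2B; last exact: L2Z.
  by rewrite (_ : (fun x => _) = fun x => -1 * L g x);
    [exact: L2Z|apply/funext => x; rewrite mulN1r].
have r'L : (fun x => -1 * (L (u n) x - L g x) + (- G) * (u n x - g x)) \in L2.
  by apply: L2D; exact: L2Z.
exists (u n); split => //; first lra.
rewrite (@eq_sqn _ _ _ mu _ (fun x => (- L g x - G * g x) +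
   (-1 * (L (u n) x - L g x) + (- G) * (u n x - g x)))); last by move=> x; rewrite -/G; ring.
apply: le_trans (sqnD_le rL r'L) _.
have := sqnD_le (L2Z (-1) dLL) (L2Z (- G) dL); rewrite !sqnZ// !sqrrN expr1n mul1r => h4.
have h5 : eps / 16 * sqn mu g <= eps / 4 * sqn mu (u n).
  rewrite (_ : eps / 16 * _ = eps / 4 * (sqn mu g / 4)); last by field.
  by rewrite ler_wpM2l ?divr_ge0 ?ltW//; lra.
move: hr h1 h4 h5; rewrite -/G => *; lra.
Unshelve. all: by end_near. Qed.

End graph.

(** * Approximate eigenfunctions at the gap *)

Section weyl.
Context {R : realType}.
Variable b : R.
Hypothesis hb : 1 / 2 < b.
Implicit Types (f g k : R -> R) (x : R).
Local Notation leb := (@lebesgue_measure R).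
Local Notation mu := (gcauchy b).
Local Notation L2 := (Lfun mu 2%:E).
Local Notation w := (japow (- b)).
Local Notation Z := (gcauchy_norm b).
Local Notation L := (gcauchy_gen b).

Lemma integrable_japow (s : R) : 1 / 2 < - s -> leb.-integrable setT (EFin \o japow s).
Proof.
move=> hs; apply/integrableP; split.
  by apply/measurable_EFinP; apply: continuous_measurable; exact: cont_japow.
have := gcauchy_fun_lty hs; congr (_ < _)%E; apply: eq_integral => x _ /=.
by rewrite gcauchy_funE opprK ger0_norm// ltW// japow_gt0.
Qed.

Lemma L2_gcauchyP g : measurable_fun setT g ->
  leb.-integrable setT (EFin \o (fun x => g x ^+ 2 * w x)) -> g \in L2.
Proof.
move=> mg ig; apply/L2P; split => //.
by apply/(gcauchy_integrableP hb) => //; exact: measurable_funX.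
Qed.

Lemma sqn_gcauchy g : g \in L2 -> sqn mu g = Z^-1 * \int[leb]_x (g x ^+ 2 * w x).
Proof.
move=> /L2P[mg ig]; have mg2 := measurable_funX 2 mg.
by rewrite /sqn gcauchy_Rintegral//; exact/(gcauchy_integrableP hb).
Qed.

(** The integral dominates the minimum of g^2 w over [1, 2]. The hypothesis starts at x = 1 because
    the eigenfunction x vanishes at 0. *)
Lemma sqn_gt0 g : continuous g -> g \in L2 -> (forall x, 1 <= x -> g x != 0) -> 0 < sqn mu g.
Proof.
move=> cg gL g0; have [mg ig] := (L2P mu g).1 gL.
rewrite sqn_gcauchy// mulr_gt0// ?invr_gt0 ?Z_gt0//.
pose h x := g x ^+ 2 * w x.
have ih : leb.-integrable setT (EFin \o h).
  by apply/(gcauchy_integrableP hb) => //; exact: measurable_funX.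
have ch : continuous h.
  move=> x; apply: cvgM; last exact: cont_japow.
  exact: (cvg_comp _ _ (cg x) (@exprn_continuous _ 2 _)).
have h0 x : 0 <= h x by rewrite mulr_ge0 ?sqr_ge0// ltW// japow_gt0.
have le12 : 1 <= 2 :> R by rewrite ler1n.
have [c] := EVT_min le12 (continuous_subspaceT ch).
rewrite in_itv/= => /andP[c1 c2] hc.
have hc0 : 0 < h c by rewrite mulr_gt0 ?japow_gt0// exprn_even_gt0//= g0.
have -> : \int[leb]_x (g x ^+ 2 * w x) = \int[leb]_x h x by [].
apply: (lt_le_trans hc0).
have -> : h c = \int[leb]_x ((fun=> h c) \_ `[1, 2]) x.
  rewrite -Rintegral_mkcond Rintegral_cst//= lebesgue_measure_itv/= lte_fin ltr1n/=; ring.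
apply: le_Rintegral => //.
  rewrite (_ : _ \o _ = (EFin \o (fun=> h c)) \_ `[1, 2]); last first.
    by apply/funext => x /=; rewrite !patchE; case: ifP.
  apply/(integrable_mkcond _ _).1 => //; apply/integrableP; split.
    by apply/measurable_EFinP; exact: measurable_cst.
  rewrite (eq_integral (fun=> `|h c|%:E))// integral_cst//= lebesgue_measure_itv/=.
  by rewrite lte_fin ltr1n/= -EFinB -EFinM ltry.
by move=> x _; rewrite patchE; case: ifPn => // /set_mem; exact: hc.
Qed.

Lemma cvg_japow_infty (d : R) : 0 < d -> japow (- d) n%:R @[n --> \oo] --> (0 : R).
Proof.
move=> d0; apply/cvgrPdist_le => e e0; near=> n.
rewrite sub0r normrN ger0_norm; last by rewrite ltW// japow_gt0.
rewrite /japow powRN -[e]invrK lef_pV2 ?posrE ?powR_gt0 ?invr_gt0 ?japbase_gt0//.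
have -> : e^-1 = (e^-1 `^ d^-1) `^ d.
  by rewrite -powRrM mulVf ?gt_eqF// powRr1// invr_ge0 ltW.
rewrite ge0_ler_powR ?nnegrE ?powR_ge0 ?(ltW d0) ?(ltW (japbase_gt0 _))//.
apply: (@le_trans _ _ n%:R); first by near: n; exact: nbhs_infty_ger.
rewrite -natrX -(natrD _ 1) ler_nat.
by rewrite add1n ltnW// ltnS -mulnn; case: (n) => // m; rewrite leq_pmulr.
Unshelve. all: by end_near. Qed.

(* Integrating the derivative of x (1+x^2)^(-1/2-d). *)
Lemma Rintegral_japow_rec (d : R) : 0 < d ->
  (1 + 2 * d) * \int[leb]_x japow (- (3 / 2) - d) x = 2 * d * \int[leb]_x japow (- (1 / 2) - d) x.
Proof.
move=> d0; pose F x := x * japow (- (1 / 2) - d) x.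
pose f x := (1 + 2 * d) * japow (- (3 / 2) - d) x - 2 * d * japow (- (1 / 2) - d) x.
have i1 : leb.-integrable setT (EFin \o japow (- (1 / 2) - d)) by apply: integrable_japow; lra.
have i3 : leb.-integrable setT (EFin \o japow (- (3 / 2) - d)) by apply: integrable_japow; lra.
have i1' : leb.-integrable setT (EFin \o (fun x => 2 * d * japow (- (1 / 2) - d) x)) :=
  integrableZl measurableT (2 * d) i1.
have i3' : leb.-integrable setT (EFin \o (fun x => (1 + 2 * d) * japow (- (3 / 2) - d) x)) :=
  integrableZl measurableT (1 + 2 * d) i3.
have fi : leb.-integrable setT (EFin \o f) := integrableB measurableT i3' i1'.
have japE x : japow (- (1 / 2) - d) x = (1 + x ^+ 2) * japow (- (3 / 2) - d) x.
  by rewrite -japowS; congr (japow _ x); field.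
have dF : has_deriv F f.
  apply: has_deriv_ext (has_derivM has_deriv_id (has_deriv_japow (- (1 / 2) - d))) _ => x.
  rewrite (_ : - (1 / 2) - d - 1 = - (3 / 2) - d); last by field.
  by rewrite /f japE; field.
have cf : continuous f.
  move=> x; apply: cvgB.
    by apply: cvgMl_tmp; exact: cont_japow.
  by apply: cvgMl_tmp; exact: cont_japow.
(* Since x <= (1 + x^2)^(1/2), F is bounded by (1 + x^2)^(-d) on x >= 0; F is odd, so the other end
   follows. *)
have F0 : F n%:R @[n --> \oo] --> (0 : R).
  apply: (squeeze_cvgr _ (cvg_cst 0) (cvg_japow_infty d0)); near=> n.
  rewrite /F mulr_ge0//=; last by rewrite ltW// japow_gt0.
  rewrite japowD mulrA ler_piMl//; first by rewrite ltW// japow_gt0.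
  rewrite /japow powRN ler_pdivrMr ?powR_gt0 ?japbase_gt0// mul1r mul1r.
  rewrite powR12_sqrt; last by rewrite ltW// japbase_gt0.
  rewrite -[leLHS]ger0_norm// -sqrtr_sqr ler_sqrt ?lerDr// ?ltW ?japbase_gt0//.
have h1 : \int[leb]_(x in `[- n%:R, n%:R]) f x @[n --> \oo] --> (0 : R).
  rewrite [X in _ --> X](_ : 0 = 0 - - 0); last by rewrite opprK addr0.
  have h : F n%:R - - F n%:R @[n --> \oo] --> (0 : R) - - 0.
    by apply: cvgB => //; exact: cvgN.
  apply: cvg_trans h; apply: near_eq_cvg; near=> n.
  have nn : - n%:R <= n%:R :> R by rewrite (@le_trans _ _ 0) ?oppr_le0.
  rewrite (FTC2_itv dF cf nn).
  by rewrite /F /japow sqrrN mulNr.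
have E : \int[leb]_x f x = 0.
  exact: (cvg_unique _ (cvg_Rintegral_itv fi) h1).
by move: E; rewrite /f (RintegralB measurableT i3' i1') !RintegralZl// => /eqP; rewrite subr_eq0 => /eqP.
Unshelve. all: by end_near. Qed.

(* For b > 3/2 the gap is attained at x.  Otherwise it is the bottom of the
   essential spectrum, approached by the powers of 1 + x^2 whose exponent lies
   just below the threshold (b - 1/2) / 2 of square integrability. *)
Lemma weyl (eps : R) : 0 < eps -> exists f, [/\ testfun f, 0 < sqn mu f &
  sqn mu (fun x => - L f x - gap b * f x) <= eps * sqn mu f].
Proof.
move=> e0; have [b3|b3] := ltP (3 / 2) b.
  have idL : (id : R -> R) \in L2.
    apply: L2_gcauchyP; first exact: measurable_id.
    have i1 : leb.-integrable setT (EFin \o japow (1 - b)) by apply: integrable_japow; lra.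
    apply: (le_integrable measurableT _ _ i1).
      apply/measurable_EFinP; apply: measurable_funM; first exact: measurable_funX.
      by apply: continuous_measurable; exact: cont_japow.
    move=> x _ /=; rewrite lee_fin pw; have w0 := ltW (japow_gt0 (- b) x).
    have x0 := sqr_ge0 x; have x1 : 0 <= 1 + x ^+ 2 by rewrite addr_ge0.
    rewrite (normrM (x ^+ 2)) (normrM (1 + x ^+ 2)); apply: ler_wpM2r; first exact: normr_ge0.
    by rewrite (ger0_norm x0) (ger0_norm x1) lerDr.
  have LE x : L id x = 2 * (1 - b) * x.
    by rewrite (genE _ _ has_deriv_id (has_deriv_cst 1)) mulr0 add0r mulr1.
  apply: (@weyl_approx _ b hb id 1 eps) => //.
  - exact: smooth_id.
  - by rewrite (_ : L id = fun x => 2 * (1 - b) * x); [exact: L2Z|exact/funext].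
  - by move=> x; rewrite (has_derivE has_deriv_id) mulr1 mul1r.
  - apply: sqn_gt0 => // x x1; first exact: cvg_id.
    by rewrite gt_eqF// (lt_le_trans _ x1).
  rewrite (@eq_sqn _ _ _ mu _ (fun x => 0 * x)); last first.
    by move=> x; rewrite LE /gap ifT//; ring.
  by rewrite sqnZ// expr0n mul0r mulr_ge0 ?sqn_ge0// divr_ge0// ltW.
have hb' := hb.
pose e' := eps / 16; have e'0 : 0 < e' by rewrite divr_gt0.
(* K collects the bounds 2 d^4 <= 2 d and 2 q^2 (2 d) <= 4 b^4 d for the two parts of the squared
   residual, relative to |g|^2. *)
pose K := 2 + 4 * (b ^+ 2) ^+ 2; have K0 : 0 < K by rewrite ltr_wpDr// mulr_ge0// sqr_ge0.
pose d := Num.min (b - 1 / 2) (Num.min 1 (e' / K)).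
have [d0 dB d1 dK] : [/\ 0 < d, d <= b - 1 / 2, d <= 1 & d * K <= e'].
  split; rewrite /d.
  - by rewrite !lt_min subr_gt0 hb ltr01 divr_gt0.
  - by rewrite ge_min lexx.
  - by rewrite !ge_min lexx orbT.
  - by rewrite -ler_pdivlMr// !ge_min lexx !orbT.
(* This s makes g^2 w = (1 + x^2)^(-1/2 - d), integrable just because d > 0. *)
pose s := (b - 1 / 2 - d) / 2; pose g := japow s.
have s0 : 0 <= s by rewrite divr_ge0// subr_ge0.
have sb : s <= b by rewrite /s; lra.
pose q := 4 * s * (s - b).
have q2 : q ^+ 2 <= (b ^+ 2) ^+ 2.
  have h1 : 0 <= 4 * s * (b - s) by rewrite mulr_ge0 ?subr_ge0// mulr_ge0.
  have h2 : 4 * s * (b - s) <= b ^+ 2.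
    by rewrite -subr_ge0 (_ : _ - _ = (b - 2 * s) ^+ 2) ?sqr_ge0//; ring.
  rewrite (_ : q ^+ 2 = (4 * s * (b - s)) ^+ 2); last by rewrite /q; ring.
  by rewrite ler_sqr ?nnegrE ?sqr_ge0.
have sg : smooth g by exact: smooth_japow.
have dg := has_deriv_japow' s.
have bn0 x : 1 + x ^+ 2 != 0 by rewrite gt_eqF// japbase_gt0.
have g0 x : 0 < g x by exact: japow_gt0.
have dg1 : has_deriv (fun x => 2 * s * x / (1 + x ^+ 2) * g x)
    (fun x => (2 * s / (1 + x ^+ 2) + 4 * s * (s - 1) * x ^+ 2 / (1 + x ^+ 2) ^+ 2) * g x).
  have dV := has_derivV bn0 has_deriv_japbase.
  apply: has_deriv_ext (has_derivM (has_derivM (has_derivZ (2 * s) has_deriv_id) dV) dg) _ => x.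
  by rewrite /g; field; rewrite bn0.
(* The part -d^2 of the residual factor is uniformly small. The part q / (1 + x^2) is not small but
   is concentrated near the origin, where g carries little of its norm. *)
have LE x : - L g x - gap b * g x = g x * (- d ^+ 2 + q / (1 + x ^+ 2)).
  rewrite (genE _ _ dg dg1) /gap ifF; last by apply/negbTE; rewrite -leNgt.
  by rewrite /q /s /g; field; rewrite bn0.
have mg : measurable_fun setT g by apply: continuous_measurable; exact: cont_japow.
have gwE x : g x ^+ 2 * w x = japow (- (1 / 2) - d) x.
  by rewrite expr2 /g -!japowD; congr (japow _ x); rewrite /s; field.
have gwE3 x : g x ^+ 2 / (1 + x ^+ 2) * w x = japow (- (3 / 2) - d) x.
  rewrite mulrAC gwE (_ : - (1 / 2) - d = - (3 / 2) - d + 1) ?japowS; last by field.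
  by field; rewrite bn0.
have i1 : leb.-integrable setT (EFin \o (fun x => g x ^+ 2 * w x)).
  rewrite (_ : (fun x => _) = japow (- (1 / 2) - d)); last exact/funext.
  by apply: integrable_japow; lra.
have i3 : leb.-integrable setT (EFin \o (fun x => g x ^+ 2 / (1 + x ^+ 2) * w x)).
  rewrite (_ : (fun x => _) = japow (- (3 / 2) - d)); last exact/funext.
  by apply: integrable_japow; lra.
have gL : g \in L2 by exact: L2_gcauchyP.
have mJ : measurable_fun setT (fun x : R => g x ^+ 2 / (1 + x ^+ 2)).
  apply: continuous_measurable => x; apply: cvgM.
    exact: (cvg_comp _ _ (@cont_japow R s x) (@exprn_continuous _ 2 _)).
  apply: cvgV => //.
  by apply: cvgD; [exact: cvg_cst|exact: exprn_continuous].
have i1m : mu.-integrable setT (EFin \o (fun x => g x ^+ 2)) by have [] := (L2P mu g).1 gL.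
have i3m : mu.-integrable setT (EFin \o (fun x => g x ^+ 2 / (1 + x ^+ 2))).
  exact/(gcauchy_integrableP hb).
(* By [Rintegral_japow_rec], the weight 1/(1 + x^2) multiplies the square norm by 2 d / (1 + 2 d):
   as d decreases, the mass of g escapes to infinity. *)
have JE : \int[mu]_x (g x ^+ 2 / (1 + x ^+ 2)) <= 2 * d * sqn mu g.
  rewrite sqn_gcauchy// gcauchy_Rintegral// mulrCA.
  have Z0 : 0 <= Z^-1 by rewrite invr_ge0 ltW// Z_gt0.
  apply: (ler_wpM2l Z0).
  have -> : \int[leb]_x (g x ^+ 2 / (1 + x ^+ 2) * w x) = \int[leb]_x japow (- (3 / 2) - d) x.
    by apply: eq_Rintegral => x _; exact: gwE3.
  have -> : \int[leb]_x (g x ^+ 2 * w x) = \int[leb]_x japow (- (1 / 2) - d) x.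
    by apply: eq_Rintegral => x _; exact: gwE.
  rewrite -Rintegral_japow_rec// ler_peMl//; last by rewrite lerDl mulr_ge0// ltW.
  by apply: Rintegral_ge0 => x _; rewrite ltW// japow_gt0.
have rL : (fun x => - L g x - gap b * g x) \in L2.
  rewrite (_ : (fun x => _) = fun x => g x * (- d ^+ 2 + q / (1 + x ^+ 2))); last exact/funext.
  apply: (L2_le _ (L2Z (d ^+ 2 + `|q|) gL)).
    apply: continuous_measurable => x; apply: cvgM; first exact: cont_japow.
    apply: cvgD; first exact: cvg_cst.
    apply: cvgM; first exact: cvg_cst.
    apply: cvgV => //.
    by apply: cvgD; [exact: cvg_cst|exact: exprn_continuous].
  move=> x; rewrite (normrM (g x)) (normrM (d ^+ 2 + `|q|)) mulrC.
  have y0 : 0 <= (1 + x ^+ 2)^-1 by rewrite invr_ge0 ltW// japbase_gt0.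
  have y1 : (1 + x ^+ 2)^-1 <= 1 by rewrite invf_le1 ?japbase_gt0// lerDl sqr_ge0.
  have D0 : 0 <= d ^+ 2 + `|q| by rewrite addr_ge0 ?sqr_ge0.
  apply: ler_wpM2r; first exact: normr_ge0.
  rewrite (ger0_norm D0); apply: (le_trans (ler_normD _ _)).
  rewrite normrN (ger0_norm (sqr_ge0 d)) lerD2l (normrM q) (ger0_norm y0).
  by apply: ler_piMr; first exact: normr_ge0.
apply: (@weyl_approx _ b hb g (2 * s) eps) => //.
- rewrite (_ : L g = fun x => -1 * ((- L g x - gap b * g x) + gap b * g x)).
    by apply: L2Z; apply: L2D => //; exact: L2Z.
  by apply/funext => x; ring.
- move=> x; rewrite (has_derivE dg) -/(g x).
  rewrite (_ : x * _ = (x ^+ 2 / (1 + x ^+ 2)) * (2 * s * g x)); last by field; rewrite bn0.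
  have h : 0 <= 2 * s * g x := mulr_ge0 (mulr_ge0 (ler0n _ 2) s0) (ltW (g0 x)).
  have h' : 0 <= x ^+ 2 / (1 + x ^+ 2) by rewrite divr_ge0 ?sqr_ge0// ltW// japbase_gt0.
  rewrite normrM (ger0_norm h) (ger0_norm h') (ger0_norm (ltW (g0 x))) ler_piMl//.
  by rewrite ler_pdivrMr ?japbase_gt0// mul1r lerDr.
- by apply: sqn_gt0 => // [|x _]; [exact: cont_japow|rewrite gt_eqF].
have h1 : sqn mu (fun x => - L g x - gap b * g x) <=
    \int[mu]_x (2 * d ^+ 4 * g x ^+ 2 + 2 * q ^+ 2 * (g x ^+ 2 / (1 + x ^+ 2))).
  apply: le_Rintegral => //.
  - by have [] := (L2P mu _).1 rL.
  - exact: (integrableD measurableT (integrableZl measurableT (2 * d ^+ 4) i1m)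
      (integrableZl measurableT (2 * q ^+ 2) i3m)).
  move=> x _; rewrite LE exprMn.
  have y0 : 0 <= (1 + x ^+ 2)^-1 by rewrite invr_ge0 ltW// japbase_gt0.
  have y1 : (1 + x ^+ 2)^-1 <= 1 by rewrite invf_le1 ?japbase_gt0// lerDl sqr_ge0.
  move: ((1 + x ^+ 2)^-1) y0 y1 => y y0 y1.
  rewrite [leRHS](_ : _ = g x ^+ 2 * (2 * d ^+ 4 + 2 * q ^+ 2 * y)); last by ring.
  rewrite ler_wpM2l ?sqr_ge0//.
  apply: (@le_trans _ _ (2 * d ^+ 4 + 2 * q ^+ 2 * y ^+ 2)).
    rewrite -subr_ge0 (_ : _ - _ = (d ^+ 2 + q * y) ^+ 2) ?sqr_ge0//; ring.
  rewrite lerD2l ler_wpM2l//; first by rewrite mulr_ge0 ?sqr_ge0.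
  by rewrite expr2 ler_piMl.
apply: (le_trans h1); rewrite RintegralD//; last 2 first.
- exact: integrableZl i1m.
- exact: integrableZl i3m.
rewrite !RintegralZl//.
have S0 := sqn_ge0 mu g.
have h2 : 2 * q ^+ 2 * \int[mu]_x (g x ^+ 2 / (1 + x ^+ 2)) <= 2 * (b ^+ 2) ^+ 2 * (2 * d * sqn mu g).
  apply: ler_pM => //; first by rewrite mulr_ge0 ?sqr_ge0.
    by apply: Rintegral_ge0 => x _; rewrite divr_ge0 ?sqr_ge0// ltW// japbase_gt0.
  by rewrite ler_wpM2l.
have h3 : 2 * d ^+ 4 * sqn mu g <= 2 * d * sqn mu g.
  have d4 : d ^+ 4 <= d.
    by rewrite exprS; apply: ler_piMr; [exact: ltW|apply: exprn_ile1 => //; exact: ltW].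
  by apply: ler_wpM2r => //; rewrite ler_wpM2l.
apply: (@le_trans _ _ (d * K * sqn mu g)); last by rewrite ler_wpM2r.
rewrite -/(sqn mu g) /K; move: h2 h3; move: (\int[mu]_x _) => J.
by move: (sqn mu g) ((b ^+ 2) ^+ 2) (q ^+ 2) (d ^+ 4) => *; lra.
Qed.

End weyl.

(** * Resolvent and spectrum *)

Section orthogonality.
Context {R : realType}.
Variable b : R.
Hypothesis hb : 1 / 2 < b.
Implicit Types (f g k : R -> R) (x : R).
Local Notation leb := (@lebesgue_measure R).
Local Notation mu := (gcauchy b).
Local Notation L2 := (Lfun mu 2%:E).
Local Notation w := (japow (- b)).
Local Notation p := (japow (1 - b)).
Local Notation L := (gcauchy_gen b).

Lemma L2_ae f g : f \in L2 -> measurable_fun setT g -> {ae mu, forall x, f x = g x} ->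
  g \in L2 /\ sqn mu f = sqn mu g.
Proof.
move=> fL mg fg; have [mf ifm] := (L2P mu f).1 fL.
have mf2 := measurable_funX 2 mf; have mg2 := measurable_funX 2 mg.
have e2 : (\int[mu]_x (f x ^+ 2)%:E = \int[mu]_x (g x ^+ 2)%:E)%E.
  apply: ae_eq_integral => //; [exact/measurable_EFinP|exact/measurable_EFinP|].
  apply: filterS fg; first exact: (ae_filter_ringOfSetsType mu).
  by move=> x -> _.
split; last by rewrite /sqn /Rintegral e2.
apply/L2P; split => //; apply/integrableP; split; first exact/measurable_EFinP.
have E (u : R -> R) : (\int[mu]_x `|(EFin \o (fun x => u x ^+ 2)%R) x| = \int[mu]_x (u x ^+ 2)%:E)%E.
  by apply: eq_integral => x _ /=; rewrite ger0_norm// sqr_ge0.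
by rewrite E -e2 -E; case/integrableP: ifm.
Qed.

Lemma cvg_Rintegral_cutoff (a : nat -> R -> R) g : (forall n, measurable_fun setT (a n)) ->
  (forall n x, 0 <= a n x <= 1) -> (forall x, a n x @[n --> \oo] --> (1 : R)) ->
  mu.-integrable setT (EFin \o g) ->
  \int[mu]_x (a n x * g x) @[n --> \oo] --> \int[mu]_x g x.
Proof.
move=> ma a01 al ig; have mg : measurable_fun setT g by have /integrableP[/measurable_EFinP] := ig.
apply: (@Rdominated_cvg _ (measurableTypeR R) _ mu setT _ _ (fun x => `|g x|)) => //.
- by move=> n; apply: measurable_funM => //; exact: ma.
- move=> x _; rewrite -[X in _ --> X]mul1r; apply: cvgMr_tmp; exact: al.
- exact: integrable_norm ig.
- move=> n x _; have /andP[a0 a1] := a01 n x.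
  by rewrite normrM ler_piMl// ger0_norm.
Qed.

(* The Euler-Lagrange equation (p k1)' = - t k w, tested against ze^2 k. *)
Lemma energy_identity (t : R) k k1 ze ze1 : has_deriv k k1 ->
  has_deriv (fun x => p x * k1 x) (fun x => - t * (k x * w x)) ->
  testfun ze -> has_deriv ze ze1 ->
  \int[mu]_x ((1 + x ^+ 2) * (ze1 x * k x + ze x * k1 x) ^+ 2) =
  \int[mu]_x ((1 + x ^+ 2) * ze1 x ^+ 2 * k x ^+ 2) + t * sqn mu (fun x => ze x * k x).
Proof.
move=> dk dpk [sze bze] dze.
have cp := @cont_japow R (1 - b); have cw := @cont_japow R (- b).
have ck := has_deriv_cont dk; have cze := has_deriv_cont dze.
have sz1 : smooth ze1 := smooth_deriv dze sze.
have cz1 := smooth_cont sz1; have bz1 := bsupp_deriv dze bze.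
have cj : continuous (fun x : R => 1 + x ^+ 2).
  by move=> x; apply: cvgD; [exact: cvg_cst|exact: exprn_continuous].
have ck1 : continuous k1.
  have -> : k1 = fun x => (p x * k1 x) * (p x)^-1.
    by apply/funext => x; rewrite mulrC mulKf// gt_eqF// japow_gt0.
  have cpk := has_deriv_cont dpk; move=> x; apply: cvgM; first exact: cpk.
  by apply: cvgV; [rewrite gt_eqF// japow_gt0|exact: cp].
have cX2 g : continuous g -> continuous (fun x => g x ^+ 2).
  by move=> cg x; exact: (cvg_comp _ _ (cg x) (@exprn_continuous _ 2 _)).
have cf1 : continuous (fun x => ze1 x * k x + ze x * k1 x).
  move=> x; exact: (cvgD (cvgM (cz1 x) (ck x)) (cvgM (cze x) (ck1 x))).
have cA : continuous (fun x => (1 + x ^+ 2) * (ze1 x * k x + ze x * k1 x) ^+ 2).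
  by move=> x; exact: (cvgM (cj x) (cX2 _ cf1 x)).
have cB : continuous (fun x => (1 + x ^+ 2) * ze1 x ^+ 2 * k x ^+ 2).
  by move=> x; exact: (cvgM (cvgM (cj x) (cX2 _ cz1 x)) (cX2 _ ck x)).
have cC : continuous (fun x => (ze x * k x) ^+ 2).
  by apply: cX2 => x; exact: (cvgM (cze x) (ck x)).
have bX2 g : bsupp g -> bsupp (fun x => g x ^+ 2).
  by move=> [N hN]; exists N => x /hN ->; rewrite expr0n.
have bf1 : bsupp (fun x => ze1 x * k x + ze x * k1 x).
  exact: (bsuppD (bsuppMl _ bz1) (bsuppMl _ bze)).
have cwi g : continuous g -> bsupp g -> leb.-integrable setT (EFin \o (fun x => g x * w x)).
  move=> cg bg; apply: bsupp_integrable; last exact: bsuppMl.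
  by move=> x; exact: (cvgM (cg x) (cw x)).
have iA := cwi _ cA (bsuppMr (fun x => 1 + x ^+ 2) (bX2 _ bf1)).
have iB := cwi _ cB (bsuppMl (fun x => k x ^+ 2) (bsuppMr (fun x => 1 + x ^+ 2) (bX2 _ bz1))).
have iC := cwi _ cC (bX2 _ (bsuppMl k bze)).
rewrite /sqn !gcauchy_Rintegral//; try exact: continuous_measurable.
pose F x := ze x ^+ 2 * k x.
pose f x := (ze1 x * ze x + ze x * ze1 x) * k x + ze x ^+ 2 * k1 x.
have dF : has_deriv F f.
  apply: has_deriv_ext (has_derivM (has_derivM dze dze) dk) _ => x.
  by rewrite /f expr2.
have cf : continuous f.
  move=> x; apply: cvgD.
    apply: cvgM; last exact: ck.
    exact: (cvgD (cvgM (cz1 x) (cze x)) (cvgM (cze x) (cz1 x))).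
  exact: (cvgM (cX2 _ cze x) (ck1 x)).
have cg : continuous (fun x => - t * (k x * w x)).
  by move=> x; apply: cvgMl_tmp; exact: (cvgM (ck x) (cw x)).
have bF : bsupp F by exact: bsuppMl (bX2 _ bze).
have bf : bsupp f.
  exact: bsuppD (bsuppMl _ (bsuppD (bsuppMl _ bz1) (bsuppMl _ bze))) (bsuppMl _ (bX2 _ bze)).
have ipf : leb.-integrable setT (EFin \o (fun x => p x * k1 x * f x)).
  apply: bsupp_integrable; last exact: bsuppMr.
  by move=> x; exact: (cvgM (cvgM (cp x) (ck1 x)) (cf x)).
have E1 : \int[leb]_x ((1 + x ^+ 2) * (ze1 x * k x + ze x * k1 x) ^+ 2 * w x) =
    \int[leb]_x ((1 + x ^+ 2) * ze1 x ^+ 2 * k x ^+ 2 * w x) + \int[leb]_x (p x * k1 x * f x).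
  rewrite -RintegralD//; apply: eq_Rintegral => x _.
  by rewrite /f pw; ring.
have E2 : \int[leb]_x (- t * (k x * w x) * F x) = - t * \int[leb]_x ((ze x * k x) ^+ 2 * w x).
  rewrite -RintegralZl//; apply: eq_Rintegral => x _.
  by rewrite /F; ring.
rewrite E1 (Rintegral_ibp dpk cg dF cf bF) E2.
by rewrite mulNr opprK mulrDr mulrCA.
Qed.

(** The variance in the Poincare inequality leaves the mean of k to be handled on its own, and this
    is where t != 0 is used. Once the mean vanishes, the limit of the truncated inequalities reads
    (gap - t) |k|^2 <= 0. *)
Lemma orthogonal_range k t : k \in L2 -> t < gap b -> t != 0 ->
  (forall f, testfun f -> ip mu k (fun x => - L f x - t * f x) = 0) -> sqn mu k = 0.
Proof.
move=> kL tgap t0 hk; have [mk _] := (L2P mu k).1 kL.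
have ki : leb.-integrable setT (EFin \o (fun x => k x * w x)).
  by apply/(gcauchy_integrableP hb) => //; exact: (L2_integrable (gcauchy_fin hb) kL).
have hweak phi phi1 psi1 : testfun phi -> has_deriv phi phi1 ->
    has_deriv (fun x => p x * phi1 x) psi1 ->
    \int[leb]_x (k x * psi1 x + t * (k x * w x) * phi x) = 0.
  move=> tphi dphi dpsi; have [sphi bphi] := tphi.
  have s1 := smooth_deriv dphi sphi.
  have dpsi' := has_deriv_flux b dphi (smooth_has_deriv s1).
  have psiE x : psi1 x = w x * L phi x.
    have [e1 e2] := (@derive_val _ _ _ _ _ _ _ (dpsi x), @derive_val _ _ _ _ _ _ _ (dpsi' x)).
    by rewrite -e1 -e2.
  have tL := testfun_gen b tphi.
  have AL : (fun x => - L phi x - t * phi x) \in L2.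
    apply: (testfun_L2 hb).
    have := testfunD (testfunZ (-1) tL) (testfunZ (- t) tphi); congr testfun.
    by apply/funext => x; ring.
  have mA := L2_measurable AL.
  have iA : leb.-integrable setT (EFin \o (fun x => k x * (- L phi x - t * phi x) * w x)).
    apply/(gcauchy_integrableP hb); first exact: measurable_funM.
    exact: ip_integrable.
  have := hk _ tphi; rewrite /ip gcauchy_Rintegral//; last exact: measurable_funM.
  move=> /eqP; rewrite mulf_eq0 invr_eq0 gt_eqF ?Z_gt0//= => /eqP h.
  rewrite (@eq_Rintegral _ _ _ leb setT (fun x => -1 * (k x * (- L phi x - t * phi x) * w x))); last first.
    by move=> x _; rewrite psiE; ring.
  by rewrite RintegralZl// h mulr0.
have [K [K1 [dK dpK kK]]] := weak_regularity (@smooth_japow R (1 - b)) (japow_gt0 (1 - b))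
  (@smooth_japow R (- b)) (japow_gt0 (- b)) ki hweak.
have cK := has_deriv_cont dK.
have cK1 : continuous K1.
  have -> : K1 = fun x => (p x * K1 x) * (p x)^-1.
    by apply/funext => x; rewrite mulrC mulKf// gt_eqF// japow_gt0.
  have cpK := has_deriv_cont dpK; move=> x; apply: cvgM; first exact: cpK.
  by apply: cvgV; [rewrite gt_eqF// japow_gt0|exact: cont_japow].
have [KL ->] := L2_ae kL (continuous_measurable cK) (ae_gcauchy b kK).
have [mK iK2] := (L2P mu K).1 KL.
have iK := L2_integrable (gcauchy_fin hb) KL.
have [C [ze [ze1 [C0 hze]]]] := exists_cutoff b.
have tze n : testfun (ze n) by have [] := hze n.
have dze n : has_deriv (ze n) (ze1 n) by have [] := hze n.
have ze01 n x : 0 <= ze n x <= 1 by have [_ _ /(_ x)] := hze n.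
have zel x : ze n x @[n --> \oo] --> (1 : R) by have [_ _ _ [_ _ _ /(_ x)]] := hze 0.
have cz n := continuous_testfun (tze n).
have mze n : measurable_fun setT (ze n) by apply: continuous_measurable.
pose c n : R := n.+1%:R^-1.
have lim1 := cvg_Rintegral_cutoff mze ze01 zel iK.
have lim2 : sqn mu (fun x => ze n x * K x) @[n --> \oo] --> sqn mu K.
  rewrite (_ : (fun n => sqn _ _) = fun n => \int[mu]_x (ze n x ^+ 2 * K x ^+ 2)); last first.
    by apply/funext => n; apply: eq_Rintegral => x _; rewrite exprMn.
  apply: (@cvg_Rintegral_cutoff (fun n x => ze n x ^+ 2)) => //.
  - by move=> n; apply: measurable_funX; exact: mze.
  - by move=> n x; have /andP[z0 z1] := ze01 n x; rewrite sqr_ge0/= exprn_ile1.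
  - move=> x; rewrite -[X in _ --> X](expr1n R 2).
    exact: (cvg_comp _ _ (zel x) (@exprn_continuous _ 2 _)).
have limc : C * c n @[n --> \oo] --> (0 : R).
  by rewrite -[X in _ --> X](mulr0 C); apply: cvgMl_tmp; exact: cvg_harmonic.
have limc2 : (C * c n) ^+ 2 @[n --> \oo] --> (0 : R).
  rewrite [X in _ --> X](_ : 0 = 0 ^+ 2); last by rewrite expr0n.
  exact: (cvg_comp _ _ limc (@exprn_continuous _ 2 _)).
have ik := L2_integrable (gcauchy_fin hb) kL.
(* Orthogonality tested on ze_n, which approximates 1: t int ze_n k = - int (L ze_n) k, and L ze_n
   is uniformly of order 1/n. *)
have kmean0 : \int[mu]_x k x = 0.
  have h n : `|t * \int[mu]_x (ze n x * k x)| <= (C * c n) * \int[mu]_x `|k x|.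
    have zL := testfun_L2 hb (tze n); have LL := testfun_gen_L2 hb (tze n).
    have [_ _ _ [_ _ h3 _]] := hze n.
    have := hk _ (tze n); rewrite ipC.
    rewrite (@eq_ip _ _ _ mu _ _ (fun x => -1 * L (ze n) x + (- t) * ze n x) k)//; last first.
      by move=> x; ring.
    rewrite (ipDl (L2Z (-1) LL) (L2Z (- t) zL) kL) (ipZl (-1) LL kL) (ipZl (- t) zL kL) => E.
    have -> : t * \int[mu]_x (ze n x * k x) = - ip mu (L (ze n)) k.
      by move: E; rewrite /(ip mu (ze n) k); move: (ip _ _ _) (\int[mu]_x _) => *; lra.
    have iLk := ip_integrable LL kL.
    rewrite normrN; apply: (le_trans (le_normr_Rintegral measurableT iLk)).
    rewrite -RintegralZl//; last exact: integrable_norm ik.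
    apply: le_Rintegral => //.
    - exact: integrable_norm iLk.
    - exact: (integrableZl measurableT (C * c n) (integrable_norm ik)).
    - by move=> x _; rewrite normrM ler_wpM2r//; exact: h3.
  have l1 : `|t * \int[mu]_x (ze n x * k x)| @[n --> \oo] --> `|t * \int[mu]_x k x|.
    by apply: cvg_norm; apply: cvgMl_tmp; exact: (cvg_Rintegral_cutoff mze ze01 zel ik).
  have l2 : (C * c n) * \int[mu]_x `|k x| @[n --> \oo] --> 0 * \int[mu]_x `|k x|.
    by apply: cvgMr_tmp.
  have : `|t * \int[mu]_x k x| <= 0 * \int[mu]_x `|k x| by exact: (ler_cvg_to l1 l2 (nearW _ h)).
  by rewrite mul0r normr_le0 mulf_eq0 (negbTE t0)/= => /eqP.
have mean0 : \int[mu]_x K x = 0.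
  rewrite -kmean0 /Rintegral; congr fine; apply: ae_eq_integral => //.
  - exact/measurable_EFinP.
  - exact/measurable_EFinP.
  apply: filterS (ae_gcauchy b kK); first exact: (ae_filter_ringOfSetsType mu).
  by move=> x -> _.
(* The Poincare inequality for ze_n K, with its energy rewritten by [energy_identity]; the gradient
   of the cutoff costs at most (C / (n+1))^2 |K|^2. *)
have key n : gap b * (sqn mu (fun x => ze n x * K x) - (\int[mu]_x (ze n x * K x)) ^+ 2)
    - (C * c n) ^+ 2 * sqn mu K - t * sqn mu (fun x => ze n x * K x) <= 0.
  have [_ _ _ [_ h2 _ _]] := hze n.
  have [szn bzn] := tze n.
  have sz1 : smooth (ze1 n) := smooth_deriv (dze n) szn.
  have cz1 := smooth_cont sz1; have bz1 := bsupp_deriv (dze n) bzn.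
  have df := has_derivM (dze n) dK.
  have cf1 : continuous (fun x => ze1 n x * K x + ze n x * K1 x).
    by move=> x; exact: (cvgD (cvgM (cz1 x) (cK x)) (cvgM (cz n x) (cK1 x))).
  have := poincare hb df cf1 (bsuppMl K bzn).
  rewrite (energy_identity dK dpK (tze n) (dze n)) /Variance -/(sqn _ _) => hP.
  have cj : continuous (fun x : R => 1 + x ^+ 2).
    by move=> x; apply: cvgD; [exact: cvg_cst|exact: exprn_continuous].
  have cX2 g : continuous g -> continuous (fun x => g x ^+ 2).
    by move=> cg x; exact: (cvg_comp _ _ (cg x) (@exprn_continuous _ 2 _)).
  have cB : continuous (fun x => (1 + x ^+ 2) * ze1 n x ^+ 2 * K x ^+ 2).
    by move=> x; exact: (cvgM (cvgM (cj x) (cX2 _ cz1 x)) (cX2 _ cK x)).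
  have bB : bsupp (fun x => (1 + x ^+ 2) * ze1 n x ^+ 2 * K x ^+ 2).
    apply: bsuppMl; apply: bsuppMr; have [N hN] := bz1.
    by exists N => x /hN ->; rewrite expr0n.
  have hB : \int[mu]_x ((1 + x ^+ 2) * ze1 n x ^+ 2 * K x ^+ 2) <= (C * c n) ^+ 2 * sqn mu K.
    rewrite /sqn -RintegralZl//; apply: le_Rintegral => //.
    - apply/(gcauchy_integrableP hb); first exact: continuous_measurable.
      apply: bsupp_integrable; last exact: bsuppMl.
      by move=> x; exact: (cvgM (cB x) (@cont_japow R (- b) x)).
    - exact: integrableZl iK2.
    - by move=> x _; rewrite ler_wpM2r ?sqr_ge0//; exact: h2.
  by rewrite -addrA -opprD subr_le0; apply: (le_trans hP); rewrite lerD2r.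
have lim : gap b * (sqn mu (fun x => ze n x * K x) - (\int[mu]_x (ze n x * K x)) ^+ 2)
    - (C * c n) ^+ 2 * sqn mu K - t * sqn mu (fun x => ze n x * K x) @[n --> \oo] -->
    gap b * (sqn mu K - 0 ^+ 2) - 0 * sqn mu K - t * sqn mu K.
  apply: cvgB; last by apply: cvgMl_tmp.
  apply: cvgB; last by apply: cvgMr_tmp.
  apply: cvgMl_tmp; apply: cvgB => //; rewrite -mean0.
  exact: (cvg_comp _ _ lim1 (@exprn_continuous _ 2 _)).
have : gap b * (sqn mu K - 0 ^+ 2) - 0 * sqn mu K - t * sqn mu K <= 0.
  exact: (cvgr_to_le lim (nearW _ key)).
rewrite expr0n subr0 mul0r subr0 -mulrBl pmulr_rle0 ?subr_gt0// => K0.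
by apply/eqP; rewrite eq_le K0 sqn_ge0.
Qed.

End orthogonality.

(** * The closed operator, its resolvent and the two optimality statements *)

Section spectral_gap.
Context {R : realType}.
Variable b : R.
Hypothesis hb : 1 / 2 < b.
Implicit Types (f g k : R -> R) (x : R).
Local Notation mu := (gcauchy b).
Local Notation L2 := (Lfun mu 2%:E).
Local Notation L := (gcauchy_gen b).
Local Notation graph := (closure_graph mu (@Cc_infty R) (fun f x => - L f x)).

Lemma L2norm_cvg0 (u : nat -> R -> R) : (forall n, u n \in L2) ->
  L2norm mu (u n) @[n --> \oo] --> 0%E <-> sqn mu (u n) @[n --> \oo] --> (0 : R).
Proof.
move=> uL.
have E : (fun n => L2norm mu (u n)) = EFin \o (fun n => Num.sqrt (sqn mu (u n))).
  by apply/funext => n /=; rewrite /L2norm L2norm_sqn.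
rewrite E; split=> h.
  have h1 : Num.sqrt (sqn mu (u n)) @[n --> \oo] --> (0 : R) by exact: (fine_cvg h).
  have h2 := cvg_comp _ _ h1 (@exprn_continuous _ 2 _); move: h2; rewrite expr0n.
  apply: cvg_trans; apply: near_eq_cvg; near=> n.
  by rewrite /= sqr_sqrtr// sqn_ge0.
apply: cvg_EFin; first exact: nearW.
rewrite -sqrtr0; exact: (cvg_comp _ _ h (@sqrt_continuous R 0)).
Unshelve. all: by end_near. Qed.

Lemma testfun_oppgen_L2 f : testfun f -> (fun x => - L f x) \in L2.
Proof.
move=> tf; rewrite (_ : (fun x => _) = fun x => -1 * L f x).
  by apply: L2Z; exact: testfun_gen_L2.
by apply/funext => x; rewrite mulN1r.
Qed.

Lemma testfun_shifted_gen_L2 t f : testfun f -> (fun x => - L f x - t * f x) \in L2.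
Proof.
by move=> tf; apply: L2B; [exact: testfun_oppgen_L2|apply: L2Z; exact: testfun_L2].
Qed.

Lemma graphP f g : graph (f, g) <-> [/\ f \in L2, g \in L2 & exists u : nat -> R -> R,
  [/\ forall n, testfun (u n), sqn mu (fun x => u n x - f x) @[n --> \oo] --> (0 : R) &
      sqn mu (fun x => - L (u n) x - g x) @[n --> \oo] --> (0 : R)]].
Proof.
have NL u : testfun u -> (fun x => - L u x) \in L2 by exact: testfun_oppgen_L2.
split=> -[/= fL gL [u [Du u1 u2]]]; split => //; exists u.
  have tu n : testfun (u n) by apply/Cc_inftyP.
  split => //; first by apply/L2norm_cvg0 => // n; apply: L2B => //; exact: testfun_L2.
  by apply/L2norm_cvg0 => // n; apply: L2B => //; exact: NL.
split; first by move=> n; apply/Cc_inftyP; exact: Du.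
  by apply/L2norm_cvg0 => // n; apply: L2B => //; exact: testfun_L2.
by apply/L2norm_cvg0 => // n; apply: L2B => //; exact: NL.
Qed.

Lemma gap_poincare f : testfun f ->
  gap b * Variance mu f <= \int[mu]_x ((1 + x ^+ 2) * f^`()%classic x ^+ 2).
Proof.
move=> [sf bf].
exact: (poincare hb (smooth_has_deriv sf) (smooth_cont (smooth_derive1 sf)) bf).
Qed.

Lemma exists_lower_bound t : t < gap b -> t != 0 -> exists2 c : R, 0 < c & forall f, testfun f ->
  c ^+ 2 * sqn mu f <= sqn mu (fun x => - L f x - t * f x).
Proof.
move=> tgap t0; pose c := Num.min (gap b - t) `|t|.
have c0 : 0 < c by rewrite lt_min subr_gt0 tgap normr_gt0.
exists c => // f tf; apply: (gen_lower_bound hb tf (gap_poincare tf) tgap).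
  by rewrite ler_sqr ?nnegrE ?(ltW c0) ?subr_ge0 ?(ltW tgap)// ge_min lexx.
by rewrite -(real_normK (num_real t)) ler_sqr ?nnegrE ?(ltW c0)// ge_min lexx orbT.
Qed.

(** The passage to the limit uses only |f + g|^2 <= 2 |f|^2 + 2 |g|^2, twice, whence the factor 4
    and the resolvent bound 2/c. Boundedness is all that the resolvent set asks for. *)
Lemma graph_lower_bound t c f g : (forall f, testfun f ->
    c ^+ 2 * sqn mu f <= sqn mu (fun x => - L f x - t * f x)) ->
  graph (f, g) -> c ^+ 2 * sqn mu f <= 4 * sqn mu (fun x => g x - t * f x).
Proof.
move=> hc /graphP[fL gL [u [tu u1 u2]]].
pose h x := g x - t * f x; have hL : h \in L2 by apply: L2B => //; exact: L2Z.
have key n : c ^+ 2 * sqn mu f <= 4 * sqn mu h +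
   (8 * sqn mu (fun x => - L (u n) x - g x) + (2 * c ^+ 2 + 8 * t ^+ 2) * sqn mu (fun x => u n x - f x)).
  have uL := testfun_L2 hb (tu n).
  have dL : (fun x => u n x - f x) \in L2 by exact: L2B.
  have NL := testfun_oppgen_L2 (tu n).
  have dNL : (fun x => - L (u n) x - g x) \in L2 by exact: L2B.
  have h1 : sqn mu f <= 2 * sqn mu (u n) + 2 * sqn mu (fun x => u n x - f x).
    have := sqnD_le uL (L2Z (-1) dL); rewrite sqnZ// sqrrN expr1n mul1r.
    by rewrite (@eq_sqn _ _ _ mu (fun x => u n x + -1 * (u n x - f x)) f)// => x; ring.
  have h2 : sqn mu (fun x => - L (u n) x - t * u n x) <= 2 * sqn mu h +
      2 * sqn mu (fun x => (- L (u n) x - g x) + (- t) * (u n x - f x)).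
    have := sqnD_le hL (L2D dNL (L2Z (- t) dL)).
    rewrite (@eq_sqn _ _ _ mu (fun x => h x + (- L (u n) x - g x + - t * (u n x - f x)))
      (fun x => - L (u n) x - t * u n x))// => x.
    by rewrite /h; ring.
  have h3 := sqnD_le dNL (L2Z (- t) dL); rewrite sqnZ// sqrrN in h3.
  have h4 := hc _ (tu n).
  have h5 := ler_wpM2l (sqr_ge0 c) h1.
  rewrite mulrDr in h5; move: h2 h3 h4 h5.
  move: (sqn mu (fun x => (- L (u n) x - g x) + (- t) * (u n x - f x))) => a1.
  move: (sqn mu (fun x => - L (u n) x - t * u n x)) (sqn mu (fun x => - L (u n) x - g x)) => a2 a3.
  move: (sqn mu (fun x => u n x - f x)) (sqn mu (u n)) (sqn mu f) (sqn mu h) (c ^+ 2) (t ^+ 2) => *.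
  lra.
have lim : 4 * sqn mu h + (8 * sqn mu (fun x => - L (u n) x - g x) +
    (2 * c ^+ 2 + 8 * t ^+ 2) * sqn mu (fun x => u n x - f x)) @[n --> \oo] -->
    4 * sqn mu h + (8 * 0 + (2 * c ^+ 2 + 8 * t ^+ 2) * 0).
  by apply: cvgD; [exact: cvg_cst|apply: cvgD; exact: cvgMl_tmp].
have := cvgr_to_ge lim (nearW _ key); rewrite !mulr0 !addr0; exact.
Qed.

(** Density of the range gives test functions u n with (-L - t) u n -> h. The lower bound makes u n
    Cauchy, with limit f, and then -L u n -> h + t f puts (f, h + t f) in the closed graph. *)
Lemma graph_surjective t h : t < gap b -> t != 0 -> h \in L2 ->
  exists f g, graph (f, g) /\ forall x, g x - t * f x = h x.
Proof.
move=> tgap t0 hL; have [c c0 hc] := exists_lower_bound tgap t0.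
pose A f x := - L f x - t * f x.
have DL2 f : testfun f -> f \in L2 /\ A f \in L2.
  by move=> tf; split; [exact: testfun_L2|exact: testfun_shifted_gen_L2].
have Dlin f g (e : R) : testfun f -> testfun g -> testfun (fun x => f x + e * g x) /\
    forall x, A (fun x => f x + e * g x) x = A f x + e * A g x.
  move=> tf tg; have teg := testfunZ e tg; split; first exact: testfunD.
  move=> x; have [sf _] := tf; have [sg _] := tg.
  have df := smooth_has_deriv sf; have df1 := smooth_has_deriv (smooth_derive1 sf).
  have dg := smooth_has_deriv sg; have dg1 := smooth_has_deriv (smooth_derive1 sg).
  rewrite /A (genE b x (has_derivD df (has_derivZ e dg)) (has_derivD df1 (has_derivZ e dg1))).
  rewrite (genE b x df df1) (genE b x dg dg1).
  move: (f^`()^`()%classic x) (g^`()^`()%classic x) (f^`()%classic x) (g^`()%classic x) (f x) (g x).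
  by move=> *; ring.
have D0 : exists f : R -> R, testfun f.
  by exists (fun=> 0); split; [exact: smooth_cst|exists 0].
have [u tu uh] := dense_range (gcauchy_fin hb) DL2 Dlin D0
  (fun k kL => orthogonal_range hb kL tgap t0) hL.
have uL n : u n \in L2 by exact: testfun_L2.
have AL n : A (u n) \in L2 by exact: testfun_shifted_gen_L2.
have [|f fL uf] := L2_complete (gcauchy_fin hb) uL.
  (* Two residuals below d in square norm differ by at most 4 d = c^2 e, that is by e after division
     by c^2. *)
  move=> e e0; pose d := c ^+ 2 * e / 4.
  have d0 : 0 < d by rewrite divr_gt0// mulr_gt0// exprn_gt0.
  have [N _ hN] := cvgr_lt _ uh _ d0; exists N => m n Nm Nn.
  have hm := hN m Nm; have hn := hN n Nn; rewrite /= in hm hn.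
  have [tmn Amn] := Dlin _ _ (-1) (tu m) (tu n).
  have := hc _ tmn; rewrite (@eq_sqn _ _ _ mu (fun x => - L _ x - _) (fun x => (A (u m) x - h x) + -1 * (A (u n) x - h x))); last first.
    by move=> x; rewrite -/(A _ x) Amn; ring.
  rewrite (@eq_sqn _ _ _ mu (fun x => u m x + -1 * u n x) (fun x => u m x - u n x)); last first.
    by move=> x; ring.
  have Lm : (fun x => A (u m) x - h x) \in L2 by exact: L2B.
  have Ln : (fun x => A (u n) x - h x) \in L2 by exact: L2B.
  have h1 := sqnD_le Lm (L2Z (-1) Ln); rewrite (sqnZ (-1) Ln) sqrrN expr1n mul1r in h1.
  move=> h2; have h3 : c ^+ 2 * sqn mu (fun x => u m x - u n x) <= c ^+ 2 * e.
    apply: (le_trans h2); apply: (le_trans h1).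
    by move: hm hn; rewrite /d; move: (sqn _ _) (sqn _ _) (c ^+ 2 * e) => *; lra.
  by move: h3; rewrite ler_pM2l// exprn_gt0.
exists f, (fun x => h x + t * f x); split; last by move=> x; ring.
apply/graphP; split => //; first by apply: L2D => //; exact: L2Z.
exists u; split => //.
have q0 : 2 * sqn mu (fun x => A (u n) x - h x) + 2 * (t ^+ 2 * sqn mu (fun x => u n x - f x))
   @[n --> \oo] --> (0 : R).
  rewrite [X in _ --> X](_ : 0 = 2 * 0 + 2 * (t ^+ 2 * 0)); last by rewrite !mulr0 addr0.
  by apply: cvgD; do ?apply: cvgMl_tmp.
apply: (squeeze_cvgr _ (cvg_cst 0) q0); near=> n; rewrite sqn_ge0/=.
have dA : (fun x => A (u n) x - h x) \in L2 by exact: L2B.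
have du : (fun x => u n x - f x) \in L2 by exact: L2B.
have := sqnD_le dA (L2Z t du); rewrite (sqnZ t du); apply: le_trans.
by rewrite le_eqVlt; apply/orP; left; apply/eqP; apply: eq_sqn => x; rewrite /A; ring.
Unshelve. all: by end_near. Qed.

Lemma resolvent_below_gap t : t < gap b -> t != 0 -> resolvent_set mu graph t.
Proof.
move=> tgap t0; split.
  move=> h hL; have [f [g [fg E]]] := graph_surjective tgap t0 hL.
  by exists f, g; split => //; exact: aeW.
have [c c0 hc] := exists_lower_bound tgap t0.
exists (2 / c) => f g fg; have [fL gL _] := (graphP f g).1 fg.
have hL : (fun x => g x - t * f x) \in L2 by apply: L2B => //; exact: L2Z.
have := graph_lower_bound hc fg.
rewrite /L2norm (L2norm_sqn fL) (L2norm_sqn hL) -EFinM lee_fin => H.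
have C0 : 0 <= 2 / c by rewrite divr_ge0// ltW.
rewrite -[X in X * _](ger0_norm C0) -sqrtr_sqr -sqrtrM ?sqr_ge0//.
rewrite ler_sqrt; last exact: mulr_ge0 (sqr_ge0 _) (sqn_ge0 _ _).
rewrite (_ : (2 / c) ^+ 2 = 4 / c ^+ 2); last by field; rewrite gt_eqF.
by rewrite mulrAC ler_pdivlMr ?exprn_gt0// mulrC.
Qed.

(** An inverse bounded by C would give |f|^2 <= C^2 |(-L - gap) f|^2 on test functions. Approximate
    eigenfunctions with eps = 1/(C^2 + 1) contradict it, as C^2 eps < 1. *)
Lemma spectrum_gap : spectrum mu graph (gap b).
Proof.
move=> [_ [C hC]].
pose eps := (C ^+ 2 + 1)^-1; have e1 : 0 < C ^+ 2 + 1 by rewrite ltr_wpDl ?sqr_ge0.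
have e0 : 0 < eps by rewrite invr_gt0.
have [f [tf f0 hf]] := weyl hb e0.
have fL := testfun_L2 hb tf; have rL := testfun_shifted_gen_L2 (gap b) tf.
have NL := testfun_oppgen_L2 tf.
have z0 g : sqn mu (fun x => g x - g x) @[_ --> \oo] --> (0 : R).
  rewrite (@eq_sqn _ _ _ mu _ (fun=> 0)); last by move=> x; rewrite subrr.
  rewrite /sqn (_ : \int[mu]_x 0 ^+ 2 = 0); first exact: cvg_cst.
  by rewrite -[RHS](Rintegral_one hb); apply: eq_Rintegral => x _; rewrite expr0n.
have fg : graph (f, fun x => - L f x).
  by apply/graphP; split => //; exists (fun=> f); split.
have := hC _ _ fg; rewrite /L2norm (L2norm_sqn fL) (L2norm_sqn rL) -EFinM lee_fin => H.
have := sqn_ge0 mu (fun x => - L f x - gap b * f x).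
move: hf H; move: (sqn mu (fun x => _)) => r hr H r0.
have H2 : sqn mu f <= C ^+ 2 * r.
  rewrite -[leLHS]sqr_sqrtr ?sqn_ge0// -[r in leRHS]sqr_sqrtr// -exprMn.
  by rewrite ler_sqr// nnegrE ?sqrtr_ge0// (le_trans _ H)// sqrtr_ge0.
have H3 : C ^+ 2 * r <= C ^+ 2 * (eps * sqn mu f) by rewrite ler_wpM2l// sqr_ge0.
have H4 : C ^+ 2 * (eps * sqn mu f) < sqn mu f.
  rewrite mulrA -[ltRHS]mul1r ltr_pM2r// /eps ltr_pdivrMr// mul1r ltrDl//.
by have := le_lt_trans (le_trans H2 H3) H4; rewrite ltxx.
Qed.

(** Maximality holds because the gap, being nonzero, is itself a spectral value that any admissible
    l must bound from below. *)
Lemma is_spectral_gap_gap : is_spectral_gap mu graph (gap b).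
Proof.
split.
  move=> t ht /=; have [->|t0] := eqVneq t 0; first by left.
  right; rewrite leNgt; apply/negP => tgap.
  by apply: ht; exact: resolvent_below_gap.
move=> l /= /(_ _ spectrum_gap)[E|//].
by have := gap_gt0 hb; rewrite E ltxx.
Qed.

(** A Poincare inequality with constant l > gap, fed into [gen_lower_bound] at t = gap, would give c
    |f| <= |(-L - gap) f| on test functions with c = min(l - gap, gap), against [weyl] for eps = c^2
    / 2. *)
Lemma is_largest_poincare : is_largest [set lambda : R | 0 < lambda /\
  forall f : R -> R, Cc_infty f -> lambda * Variance mu f <=
    \int[mu]_x ((1 + x ^+ 2) * (f^`()%classic x) ^+ 2)] (gap b).
Proof.
have G0 := gap_gt0 hb.
split; first by split => // f /Cc_inftyP tf; exact: gap_poincare.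
move=> l /= [l0 hl]; rewrite leNgt; apply/negP => gl.
pose c := Num.min (l - gap b) (gap b).
have c0 : 0 < c by rewrite lt_min subr_gt0 gl.
have c20 : 0 < c ^+ 2 by rewrite exprn_gt0.
have e0 : 0 < c ^+ 2 / 2 by rewrite divr_gt0.
have [f [tf f0 hf]] := weyl hb e0.
have hlf := hl f ((Cc_inftyP f).2 tf).
have := gen_lower_bound (c := c) hb tf hlf gl.
have c1 : c ^+ 2 <= (l - gap b) ^+ 2.
  by rewrite ler_sqr ?nnegrE ?(ltW c0) ?subr_ge0 ?(ltW gl)// ge_min lexx.
have c2 : c ^+ 2 <= gap b ^+ 2.
  by rewrite ler_sqr ?nnegrE ?(ltW c0) ?(ltW G0)// ge_min lexx orbT.
move=> /(_ c1 c2) /le_trans /(_ hf); rewrite ler_pM2r// => h.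
by lra.
Qed.

End spectral_gap.

Theorem theorem3p1 (R : realType) (beta : R) (hbeta : 1 / 2 < beta) :
  let lambda1 : R :=
    if 3 / 2 < beta then 2 * (beta - 1) else (beta - 1 / 2) ^+ 2 in
  is_spectral_gap (gcauchy beta)
    (closure_graph (gcauchy beta) Cc_infty
       (fun f x => - gcauchy_gen beta f x))
    lambda1
  /\
  is_largest
    [set lambda : R | 0 < lambda /\
      forall f : R -> R, Cc_infty f ->
        lambda * Variance (gcauchy beta) f <=
        \int[gcauchy beta]_x ((1 + x ^+ 2) * (f^`()%classic x) ^+ 2)]
    lambda1.
Proof.
by split; [exact: is_spectral_gap_gap|exact: is_largest_poincare].
Qed.
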